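(* Let $\mathbf F\in\{\mathbf R,\mathbf C,\mathbf H\}$, let $p,q$ be integers with $p\ge 1$ and $q-p\ge 2$, and let $\mathfrak g$ be $\mathfrak{so}(p,q)$, $\mathfrak{su}(p,q)$ or $\mathfrak{sp}(p,q)$ according as $\mathbf F=\mathbf R,\mathbf C,\mathbf H$. Let $a$ be an integer with $1\le a\le q-p$, put $b=q-p-a$, and let $S_a$ be the solvmanifold, with metric Lie algebra $\mathfrak s_a=\mathfrak a\oplus\mathfrak n_a$ as defined in the context, associated to the solvmanifold corresponding to the noncompact symmetric space $\mathsf{SO}(p,q)/\mathsf S(\mathsf O(p)\mathsf O(q))$, $\mathsf{SU}(p,q)/\mathsf S(\mathsf U(p)\mathsf U(q))$ or $\mathsf{Sp}(p,q)/\mathsf{Sp}(p)\mathsf{Sp}(q)$, respectively. Let $Z$ be any characteristic element, with corresponding set of simple roots $\Lambda'=\{\alpha\in\Lambda\mid\alpha(Z)=0\}$, and let $((S_a)_{\Lambda'},g')$ be the solvmanifold attached to $S_a$, i.e. the simply connected solvable Lie group with Lie algebra $(\mathfrak s_a)_{\Lambda'}=\mathfrak a_{\Lambda'}\oplus(\mathfrak n_a)_{\Lambda'}$, equipped with the left-invariant metric $g'$ determined by the inner product restricted from $\mathfrak s_a$. Then $((S_a)_{\Lambda'},g')$ is an Einstein solvmanifold.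
   Context: A (Riemannian) solvmanifold is a solvable Lie group with a left-invariant Riemannian metric; a metric Lie algebra is a Lie algebra with an inner product, and it determines a simply connected Lie group with left-invariant metric. Einstein means that the Ricci tensor is a constant multiple of the metric. The Lie algebra $\mathfrak g$. Let $A^*$ denote the ($\mathbf F$-)conjugate transpose. $\mathfrak g=\{A\in\mathfrak{gl}(p+q,\mathbf F)\mid AM=-MA^*\}$ with $M=\begin{pmatrix}\mathrm{Id}_p&0\\ 0&-\mathrm{Id}_q\end{pmatrix}$ (together with $\operatorname{tr}A=0$ if $\mathbf F=\mathbf C$), regarded as a real Lie algebra. Let $\sigma(A)=-A^*$ (a Cartan involution), let $B$ be the Killing form of $\mathfrak g$, and let $B_\sigma(X,Y)=-B(X,\sigma(Y))$. Write elements of $\mathfrak g$ in $3\times3$ block form with diagonal blocks of sizes $p,p,q-p$. Let $\mathfrak a\subset\mathfrak g$ be the abelian subalgebra of matrices $\begin{pmatrix}0&D&0\\ D&0&0\\ 0&0&0\end{pmatrix}$ with $D=\operatorname{diag}(d_1,\dots,d_p)$ real, and let $\omega_j\in\mathfrak a^*$ take such a matrix to $d_j$. For $\alpha\in\mathfrak a^*$ put $\mathfrak g_\alpha=\{X\in\mathfrak g\mid[A,X]=\alpha(A)X\ \ \forall A\in\mathfrak a\}$. Positive (restricted) roots: $\Delta^+=\{\omega_i\mid 1\le i\le p\}\cup\{\omega_j\pm\omega_i\mid 1\le i<j\le p\}$ if $\mathbf F=\mathbf R$, and this set together with $\{2\omega_i\mid 1\le i\le p\}$ if $\mathbf F=\mathbf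 C$ or $\mathbf H$. Simple roots: $\Lambda=\{\omega_1,\omega_2-\omega_1,\dots,\omega_p-\omega_{p-1}\}=\{\alpha_1,\dots,\alpha_p\}$. Put $\mathfrak n=\sum_{\alpha\in\Delta^+}\mathfrak g_\alpha$ and $\mathfrak s=\mathfrak a\oplus\mathfrak n$, with inner product $\langle\,,\rangle=2B_\sigma|_{\mathfrak a\times\mathfrak a}+B_\sigma|_{\mathfrak n\times\mathfrak n}$ ($\mathfrak a\perp\mathfrak n$); the corresponding simply connected solvmanifold is the symmetric space. The associated metric Lie algebra $\mathfrak s_a$. One has $$W:=\sum_{k=1}^p\mathfrak g_{\omega_k}=\left\{\begin{pmatrix}0&0&C\\ 0&0&C\\ C^*&-C^*&0\end{pmatrix}\ \Big|\ C\in\mathbf F^{p\times(q-p)}\right\}.$$ Let $W_a\subset W$ be the subspace where the last $b$ columns of $C$ vanish and $W_b\subset W$ the subspace where the first $a$ columns of $C$ vanish, so $W=W_a\oplus W_b$. Let $\mathfrak g^{\mathbf C}=\mathfrak g\otimes_{\mathbf R}\mathbf C$, viewed as a real Lie algebra, and let $\sqrt{-1}$ denote multiplication by the imaginary unit of the second tensor factor (distinct from any imaginary unit in $\mathbf F$). Inside $\mathfrak g^{\mathbf C}$ put $$\mathfrak n_a=\Big(\sum_{\alpha\in\Delta^+\setminus\{\omega_1,\dots,\omega_p\}}\mathfrak g_\alpha\Big)\oplus W_a\oplus\sqrt{-1}\,W_b,\qquad \mathfrak s_a=\mathfrak a\oplus\mathfrak n_a .$$ Then $\mathfrak s_a$ is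 a real solvable Lie subalgebra of $\mathfrak g^{\mathbf C}$. Its inner product is the one for which the linear bijection $\mathfrak s\to\mathfrak s_a$ that sends $X\in W_b$ to $\sqrt{-1}X$ and is the identity on $\mathfrak a$, $W_a$ and $\mathfrak g_\alpha$ ($\alpha\in\Delta^+\setminus\{\omega_1,\dots,\omega_p\}$) is an isometry. $S_a$ is the simply connected solvmanifold with metric Lie algebra $\mathfrak s_a$. Attached subalgebras. Let $\{H^1,\dots,H^p\}$ be the basis of $\mathfrak a$ with $\alpha_i(H^j)=\delta_{ij}$. A characteristic element is $Z=c_{i_1}H^{i_1}+\dots+c_{i_k}H^{i_k}$ with $k\ge1$, distinct indices $i_1,\dots,i_k$, and positive integers $c_{i_1},\dots,c_{i_k}$; then $\Lambda'=\{\alpha\in\Lambda\mid\alpha(Z)=0\}=\Lambda\setminus\{\alpha_{i_1},\dots,\alpha_{i_k}\}$. Put $\mathfrak a_{\Lambda'}=\operatorname{span}\{H^{i_1},\dots,H^{i_k}\}$ and $(\mathfrak n_a)_{\Lambda'}=\sum_{\alpha\in\Delta^+,\ \alpha(Z)>0}(\mathfrak n_a)_\alpha$, where $(\mathfrak n_a)_\alpha=\{X\in\mathfrak n_a\mid[A,X]=\alpha(A)X\ \ \forall A\in\mathfrak a\}$. *)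

(* Defs.v *)
From HB Require Import structures.
From mathcomp Require Import all_boot all_order all_algebra.
From mathcomp Require Import boolp classical_sets reals.
From mathcomp Require Import ring.

Set Implicit Arguments.
Unset Strict Implicit.
Unset Printing Implicit Defensive.

Import Order.TTheory GRing.Theory Num.Theory.

Local Open Scope ring_scope.

(* Hamilton's quaternions  q0 + q1 i + q2 j + q3 k.                          *)

Record quat (R : Type) := Quat { q0 : R; q1 : R; q2 : R; q3 : R }.

Section Quaternions.
Variable R : realType.
Implicit Types (s : R) (x y z : quat R).

Definition quat_tuple x := (q0 x, q1 x, q2 x, q3 x).
Definition tuple_quat (t : R * R * R * R) : quat R :=
  Quat t.1.1.1 t.1.1.2 t.1.2 t.2.

Lemma quat_tupleK : cancel quat_tuple tuple_quat.
Proof. by case. Qed.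

HB.instance Definition _ := Choice.copy (quat R) (can_type quat_tupleK).

Definition addq x y :=
  Quat (q0 x + q0 y) (q1 x + q1 y) (q2 x + q2 y) (q3 x + q3 y).
Definition oppq x := Quat (- q0 x) (- q1 x) (- q2 x) (- q3 x).
Definition realq s : quat R := Quat s 0 0 0.
Definition scaleq s x := Quat (s * q0 x) (s * q1 x) (s * q2 x) (s * q3 x).
Definition conjq x := Quat (q0 x) (- q1 x) (- q2 x) (- q3 x).
Definition mulq x y := Quat
  (q0 x * q0 y - q1 x * q1 y - q2 x * q2 y - q3 x * q3 y)
  (q0 x * q1 y + q1 x * q0 y + q2 x * q3 y - q3 x * q2 y)
  (q0 x * q2 y - q1 x * q3 y + q2 x * q0 y + q3 x * q1 y)
  (q0 x * q3 y + q1 x * q2 y - q2 x * q1 y + q3 x * q0 y).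

Lemma addqA : associative addq.
Proof. by case=> a b c d [e f g h] [i j k l]; congr Quat; exact: addrA. Qed.

Lemma addqC : commutative addq.
Proof. by case=> a b c d [e f g h]; congr Quat; exact: addrC. Qed.

Lemma add0q : left_id (realq 0) addq.
Proof. by case=> a b c d; congr Quat; exact: add0r. Qed.

Lemma addNq : left_inverse (realq 0) oppq addq.
Proof. by case=> a b c d; congr Quat; exact: addNr. Qed.

HB.instance Definition _ := GRing.isZmodule.Build (quat R) addqA addqC add0q addNq.

Lemma mulqA : associative mulq.
Proof. by case=> a b c d [e f g h] [i j k l]; congr Quat; rewrite /=; ring. Qed.

Lemma mul1q : left_id (realq 1) mulq.
Proof. by case=> a b c d; congr Quat; rewrite /=; ring. Qed.

Lemma mulq1 : right_id (realq 1) mulq.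
Proof. by case=> a b c d; congr Quat; rewrite /=; ring. Qed.

Lemma mulqDl : left_distributive mulq +%R.
Proof. by case=> a b c d [e f g h] [i j k l]; congr Quat; rewrite /=; ring. Qed.

Lemma mulqDr : right_distributive mulq +%R.
Proof. by case=> a b c d [e f g h] [i j k l]; congr Quat; rewrite /=; ring. Qed.

Lemma oneq_neq0 : realq 1 != 0 :> quat R.
Proof. by apply/eqP => -[] /eqP; rewrite oner_eq0. Qed.

HB.instance Definition _ := GRing.Zmodule_isNzRing.Build (quat R)
  mulqA mul1q mulq1 mulqDl mulqDr oneq_neq0.

Lemma scaleqA a b x : scaleq a (scaleq b x) = scaleq (a * b) x.
Proof. by congr Quat; exact: mulrA. Qed.

Lemma scale1q : left_id 1 scaleq.
Proof. by case=> a b c d; congr Quat; exact: mul1r. Qed.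

Lemma scaleqDr : right_distributive scaleq +%R.
Proof. by move=> a x y; congr Quat; exact: mulrDr. Qed.

Lemma scaleqDl x : {morph scaleq^~ x : a b / a + b}.
Proof. by move=> a b; congr Quat; exact: mulrDl. Qed.

HB.instance Definition _ := GRing.Zmodule_isLmodule.Build R (quat R)
  scaleqA scale1q scaleqDr scaleqDl.

Lemma scaleqAl (a : R) x y : a *: (x * y) = (a *: x) * y.
Proof. by case: x y => a0 b c d [e f g h]; congr Quat; rewrite /=; ring. Qed.

HB.instance Definition _ := GRing.Lmodule_isLalgebra.Build R (quat R) scaleqAl.

Lemma scaleqAr (a : R) x y : a *: (x * y) = x * (a *: y).
Proof. by case: x y => a0 b c d [e f g h]; congr Quat; rewrite /=; ring. Qed.

HB.instance Definition _ := GRing.Lalgebra_isAlgebra.Build R (quat R) scaleqAr.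

Definition quat_rV x : 'rV[R]_4 := \row_i [tuple q0 x; q1 x; q2 x; q3 x]`_i.
Definition rV_quat (v : 'rV[R]_4) : quat R :=
  Quat (v 0 (inord 0)) (v 0 (inord 1)) (v 0 (inord 2)) (v 0 (inord 3)).

Lemma quat_vect_iso : Vector.axiom 4 (quat R).
Proof.
exists quat_rV.
  by move=> a x y; apply/rowP=> -[[|[|[|[|//]]]] ?]; rewrite !mxE.
exists rV_quat.
  by move=> [a b c d]; congr Quat; rewrite mxE inordK.
move=> v; apply/rowP=> i; rewrite mxE.
by case: i => -[|[|[|[|//]]]] lti; congr (v 0 _); apply/val_inj; rewrite /= inordK.
Qed.

HB.instance Definition _ := Lmodule_hasFinDim.Build R (quat R) quat_vect_iso.

End Quaternions.

(* Square matrices over the quaternions as a real vector space; an alias is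
   needed because 'M[quat R]_n is already a module over quat R.               *)

Definition hmx (R : realType) (n : nat) : Type := 'M[quat R]_n.

Section HMatrix.
Variables (R : realType) (n : nat).

HB.instance Definition _ := GRing.Zmodule.copy (hmx R n) 'M[quat R]_n.

Definition scalehmx (a : R) (A : hmx R n) : hmx R n :=
  map_mx ( *:%R a) (A : 'M_n).

Lemma scalehmxA a b A : scalehmx a (scalehmx b A) = scalehmx (a * b) A.
Proof. by apply/matrixP=> i j; rewrite !mxE scalerA. Qed.

Lemma scale1hmx : left_id 1 scalehmx.
Proof. by move=> A; apply/matrixP=> i j; rewrite !mxE scale1r. Qed.

Lemma scalehmxDr : right_distributive scalehmx +%R.
Proof. by move=> a A B; apply/matrixP=> i j; rewrite !mxE scalerDr. Qed.

Lemma scalehmxDl A : {morph scalehmx^~ A : a b / a + b}.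
Proof. by move=> a b; apply/matrixP=> i j; rewrite !mxE scalerDl. Qed.

HB.instance Definition _ := GRing.Zmodule_isLmodule.Build R (hmx R n)
  scalehmxA scale1hmx scalehmxDr scalehmxDl.

Definition hmx_ffun (A : hmx R n) : {ffun 'I_n * 'I_n -> quat R} :=
  [ffun ij => A ij.1 ij.2].

Lemma hmx_vect_iso :
  Vector.axiom (dim {ffun 'I_n * 'I_n -> quat R}) (hmx R n).
Proof.
pose fT := {ffun 'I_n * 'I_n -> quat R} : vectType R.
have [f [fZ fD] bij_f] : SemiVector.axiom (dim fT) fT by exact: vector_subdef.
exists (f \o hmx_ffun).
  move=> a A B /=; rewrite -fZ -fD; congr (f _).
  by apply/ffunP=> ij; rewrite !ffunE !mxE.
case: bij_f => g fK gK.
exists (fun v => \matrix_(i, j) (g v (i, j))).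
  by move=> A; apply/matrixP=> i j; rewrite mxE /= fK ffunE.
move=> v /=; rewrite -[RHS]gK; congr (f _).
by apply/ffunP=> -[i j]; rewrite !ffunE mxE.
Qed.

HB.instance Definition _ := Lmodule_hasFinDim.Build R (hmx R n) hmx_vect_iso.

End HMatrix.

Section LinearSpan.
Variables (K : fieldType) (V : vectType K).
Implicit Types (P : set V) (U : {vspace V}).

Lemma lspan_ex P : exists U,
  (forall x, P x -> x \in U) /\
  (forall U', (forall x, P x -> x \in U') -> (U <= U')%VS).
Proof.
suff [s [sP maxs]] : exists s : seq V, (forall x, x \in s -> P x) /\
    (forall x, P x -> x \in <<s>>%VS).
  by exists <<s>>%VS; split=> // U' PU'; apply/span_subvP => x /sP /PU'.
have [m] := ubnP (dim V - \dim (<<[::] : seq V>>)%VS)%N.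
have : forall x, x \in ([::] : seq V) -> P x by [].
move: [::] => s; elim: m s => // m IHm s sP /ltnSE les.
have [[x [Px xNs]]|noext] := pselect (exists x, P x /\ x \notin <<s>>%VS); last first.
  exists s; split=> // x Px; apply/negPn/negP => xNs.
  by apply: noext; exists x.
apply: (IHm (x :: s)) => [y|].
  by rewrite in_cons => /predU1P[->//|/sP].
have lt_s : (\dim <<s>> < \dim <<x :: s>>)%N.
  rewrite ltn_neqAle dimvS ?andbT; last by apply: sub_span => y ys; rewrite inE ys orbT.
  apply: contra xNs => /eqP eqd.
  have /eqP -> : (<<s>> == <<x :: s>>)%VS.
    by rewrite eqEdim eqd leqnn andbT; apply: sub_span => y ys; rewrite inE ys orbT.
  by rewrite memv_span ?mem_head.
apply: leq_trans les; apply: ltn_sub2l => //.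
by apply: leq_trans lt_s _; rewrite -dimvf dimvS ?subvf.
Qed.

(* When P is closed under linear combinations, lspan P is P itself. *)
Definition lspan P : {vspace V} := sval (cid (lspan_ex P)).

Lemma memv_lspan P x : P x -> x \in lspan P.
Proof. by move=> Px; have [PU _] := svalP (cid (lspan_ex P)); exact: PU. Qed.

Lemma lspan_subv P U : (forall x, P x -> x \in U) -> (lspan P <= U)%VS.
Proof. by move=> PU; have [_ minU] := svalP (cid (lspan_ex P)); exact: minU. Qed.

(* The trace of the restriction of f to U, for f linear on U with f(U) in U. *)
Definition vtrace U (f : V -> V) : K :=
  \sum_(i < \dim U) coord (vbasis U) i (f (vbasis U)`_i).

End LinearSpan.

(* Metric Lie algebras, given as a subspace s of a real vector space E that
   carries a bracket br and a form ip; only the restrictions to s matter.     *)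

Section MetricLieAlgebra.
Variables (R : realType) (E : vectType R).
Variables (br : E -> E -> E) (ip : E -> E -> R) (s : {vspace E}).

Definition is_lie_algebra : Prop :=
  [/\ {in s &, forall X Y, br X Y \in s},
      forall a : R, {in s & &, forall X Y Z,
        br (a *: X + Y) Z = a *: br X Z + br Y Z /\
        br Z (a *: X + Y) = a *: br Z X + br Z Y},
      {in s, forall X, br X X = 0} &
      {in s & &, forall X Y Z,
        br X (br Y Z) + br Y (br Z X) + br Z (br X Y) = 0}].

Definition derived (U : {vspace E}) : {vspace E} :=
  lspan [set W | exists X Y, [/\ X \in U, Y \in U & W = br X Y]].

Definition is_solvable : Prop := exists k, iter k derived s = 0%VS.

Definition is_inner_product : Prop :=
  [/\ forall a : R, {in s & &, forall X Y Z,
        ip (a *: X + Y) Z = a * ip X Z + ip Y Z},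
      {in s &, forall X Y, ip X Y = ip Y X} &
      {in s, forall X, X != 0 -> 0 < ip X X}].

(* The left-invariant fields of the simply connected group are identified with
   the elements of s. Since the functions ip X Y are constant on the group,
   metric compatibility of the Levi-Civita connection reads
   <nabla_X Y, Z> + <Y, nabla_X Z> = 0.                                       *)
Definition levi_civita (nabla : E -> E -> E) : Prop :=
  [/\ {in s &, forall X Y, nabla X Y \in s},
      {in s &, forall X Y, nabla X Y - nabla Y X = br X Y} &
      {in s & &, forall X Y Z, ip (nabla X Y) Z + ip Y (nabla X Z) = 0}].

Definition curvature (nabla : E -> E -> E) (X Y Z : E) : E :=
  nabla X (nabla Y Z) - nabla Y (nabla X Z) - nabla (br X Y) Z.

Definition ricci (nabla : E -> E -> E) (X Y : E) : R :=
  vtrace s (fun Z => curvature nabla Z X Y).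

Definition is_einstein : Prop := exists2 nabla, levi_civita nabla &
  exists lambda : R, {in s &, forall X Y, ricci nabla X Y = lambda * ip X Y}.

Definition einstein_solvmanifold : Prop :=
  [/\ is_lie_algebra, is_solvable, is_inner_product & is_einstein].

End MetricLieAlgebra.

Inductive base_field := RealF | ComplexF | QuaternionF.

(* F is realised inside the quaternions: R = {q0}, C = {q0 + q1 i}. *)
Definition in_field (R : realType) (F : base_field) (x : quat R) : Prop :=
  match F with
  | RealF => [/\ q1 x = 0, q2 x = 0 & q3 x = 0]
  | ComplexF => q2 x = 0 /\ q3 x = 0
  | QuaternionF => True
  end.

Definition mx_over (R : realType) (F : base_field) m n (A : 'M[quat R]_(m, n)) :
  Prop := forall i j, in_field F (A i j).

Definition ctr (R : realType) m n (A : 'M[quat R]_(m, n)) : 'M[quat R]_(n, m) :=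
  map_mx (@conjq R) A^T.

(* so(p, q), su(p, q), sp(p, q) with q = p + r; the matrix size p + (p + r)
   gives access to the blocks of sizes p, p, r.                               *)

Section SymmetricSpace.
Variables (R : realType) (F : base_field) (p r : nat).

Notation V := (hmx R (p + (p + r))).

Definition signature_mx : V := block_mx 1%:M 0 0 (- 1%:M).

Definition comm_br (X Y : V) : V := X *m Y - Y *m X.

Definition g_ : {vspace V} := lspan [set A : V |
  [/\ mx_over F A, A *m signature_mx = - (signature_mx *m ctr A) &
      F = ComplexF -> \tr A = 0]].

Definition cartan_inv (A : V) : V := - ctr A.

Definition killing (X Y : V) : R :=
  vtrace g_ (fun T => comm_br X (comm_br Y T)).

Definition killing_sigma (X Y : V) : R := - killing X (cartan_inv Y).

(* The coordinates d = (d_1, ..., d_p) identify 'rV_p with the subalgebra a; a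
   linear form on a is the row of its coordinates in the basis omega_1, ...,
   omega_p. All indices start at 0.                                           *)
Definition amx (d : 'rV[R]_p) : V :=
  let D := diag_mx (map_mx (@realq R) d) in
  block_mx 0 (row_mx D 0) (col_mx D 0) 0.

Definition a_ : {vspace V} := lspan [set amx d | d in setT].

Definition form_eval (alpha d : 'rV[R]_p) : R := \sum_i alpha 0 i * d 0 i.

Definition omega (k : nat) : 'rV[R]_p := \row_j (j == k :> nat)%:R.

Definition simple_root (i : nat) : 'rV[R]_p :=
  if i is i'.+1 then omega i'.+1 - omega i' else omega 0.

Definition omegas : seq 'rV[R]_p := [seq omega i | i <- iota 0 p].

Definition pos_roots : seq 'rV[R]_p :=
  omegas
  ++ [seq omega j + omega i | j <- iota 0 p, i <- iota 0 j]
  ++ [seq omega j - omega i | j <- iota 0 p, i <- iota 0 j]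
  ++ (if F is RealF then [::] else [seq omega i *+ 2 | i <- iota 0 p]).

Definition root_space (alpha : 'rV[R]_p) : {vspace V} := lspan [set X : V |
  X \in g_ /\ forall d, comm_br (amx d) X = form_eval alpha d *: X].

Definition n_ : {vspace V} := (\sum_(alpha <- pos_roots) root_space alpha)%VS.

Definition ip_s (X Y : V) : R :=
  2 * killing_sigma (daddv_pi a_ n_ X) (daddv_pi a_ n_ Y)
  + killing_sigma (daddv_pi n_ a_ X) (daddv_pi n_ a_ Y).

(* The matrices (0 0 C; 0 0 C; C^* -C^* 0). *)
Definition wmx (C : 'M[quat R]_(p, r)) : V :=
  block_mx 0 (row_mx 0 C)
           (col_mx 0 (ctr C)) (block_mx 0 C (- ctr C) 0).

(* W_a and W_b, with r = a + b. *)
Definition Wa_ (b : nat) : {vspace V} := lspan [set wmx C | C in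
  [set C | mx_over F C /\ forall i (j : 'I_r), (r - b <= j)%N -> C i j = 0]].

Definition Wb_ (a : nat) : {vspace V} := lspan [set wmx C | C in
  [set C | mx_over F C /\ forall i (j : 'I_r), (j < a)%N -> C i j = 0]].

(* The complexification V (x) C as a real Lie algebra: (X, Y) stands for
   X (x) 1 + Y (x) sqrt(-1).                                                  *)
Notation VC := (V * V)%type.

Definition tensor1 (X : V) : VC := (X, 0).
Definition tensor_sqrtm1 (X : V) : VC := (0, X).

Definition comm_brC (X Y : VC) : VC :=
  (comm_br X.1 Y.1 - comm_br X.2 Y.2, comm_br X.1 Y.2 + comm_br X.2 Y.1).

Definition na_ (a b : nat) : {vspace VC} :=
  (lspan [set tensor1 X | X in [set X : V | X \in
     (\sum_(alpha <- pos_roots | alpha \notin omegas) root_space alpha)%VS]]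
   + lspan [set tensor1 X | X in [set X : V | X \in Wa_ b]]
   + lspan [set tensor_sqrtm1 X | X in [set X : V | X \in Wb_ a]])%VS.

(* On s_a, the inverse of the linear bijection s -> s_a that sends X in W_b to
   sqrt(-1) X and is the identity on the other summands of s.                 *)
Definition to_s (X : VC) : V := X.1 + X.2.

Definition ip_sa (X Y : VC) : R := ip_s (to_s X) (to_s Y).

Definition na_root_space (a b : nat) (alpha : 'rV[R]_p) : {vspace VC} :=
  lspan [set X : VC | X \in na_ a b /\
    forall d, comm_brC (tensor1 (amx d)) X = form_eval alpha d *: X].

(* (s_a)_Lambda' for Z = sum_(i in I) c_i H^i, where H^i is given by its
   coordinates d. *)
Definition attached_a (H : 'I_p -> 'rV[R]_p) (I : {set 'I_p}) : {vspace VC} :=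
  lspan [set tensor1 (amx (H i)) | i in [set i | i \in I]].

Definition attached_n (a b : nat) (Z : 'rV[R]_p) : {vspace VC} :=
  (\sum_(alpha <- pos_roots | (0 < form_eval alpha Z)%R)
     na_root_space a b alpha)%VS.

Definition attached_s (a b : nat) (H : 'I_p -> 'rV[R]_p) (I : {set 'I_p})
    (Z : 'rV[R]_p) : {vspace VC} :=
  (attached_a H I + attached_n a b Z)%VS.

End SymmetricSpace.

(* Main.v *)
(* Relative to an orthonormal basis of a_Lambda' + n_Lambda' made of root vectors
   of definite parity (a root vector is odd when it lies in W_b), passing from s
   to s_a changes the structure constants c(x, y, z) = <[x, y], z> only by the
   factor (-1)^(|x||y|). As n_Lambda' is graded by positive eigenvalues of ad Z, its
   Ricci tensor is a combination of the sums over z, m of c(x, z, m) c(y, z, m)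
   and c(z, m, x) c(z, m, y) and of the mean curvature term; the signs cancel in
   these products, since even and odd root vectors are orthogonal. It thus
   suffices to compute in g = sigma(g_+) + g_0 + g_+, the grading by ad Z: there the
   invariance of the Killing form gives Ric = -1/4 <,>. *)

From HB Require Import structures.
Require Import Defs.
From mathcomp Require Import boolp classical_sets.
From mathcomp Require Import all_boot all_order all_algebra.
From mathcomp Require Import reals ring lra.

Set Implicit Arguments.
Unset Strict Implicit.
Unset Printing Implicit Defensive.

Import Order.TTheory GRing.Theory Num.Theory.
Local Open Scope ring_scope.

(** * Linear spans and traces *)

(** The factor 2 in the metric on [a_] is what makes the constant -1/4 come out in both summands. An
    element of a_Lambda' centralises g_0, so the Killing form sees its eigenvalues on g_+ and again
    on sigma(g_+): B(A, A') is twice the eigenvalue sum over n_Lambda', and <A, A'> = 2 B(A, A') is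
    four times that sum. On n_Lambda' there remains, besides -1/4 <X, Y>, half of chi([sigma Y, X]),
    where chi(Y) is the trace of ad Y compressed to g_+; the mean curvature term has to cancel it.
    The obstacle is that a_Lambda' may be smaller than a: chi is B-dual to some A0 in a, but the
    cancellation needs A0 in a_Lambda'. For a simple root vector X of g_0, both X and sigma X
    preserve g_+, so chi vanishes on [X, sigma X], which forces the root of X to vanish on A0. Then
    A0 is twice the mean curvature vector, and half of chi is exactly the missing term. Positivity
    of B_sigma is obtained without structure theory, by comparison with the form Re tr X Y^* on all
    matrices, for which ad(sigma X) is also minus the adjoint of ad X. *)

Section Traces.
Variables (K : fieldType) (V : vectType K).
Implicit Types (U : {vspace V}) (P : V -> Prop).

(** Subspaces are mostly handled as predicates: weight, grading and parity are conditions on matrix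
    entries, not given as a [{vspace V}]. *)
Definition lin_closed P := P 0 /\ forall a x y, P x -> P y -> P (a *: x + y).

Lemma lin_closed_sum P I (r : seq I) (Q : pred I) (F : I -> V) (a : I -> K) :
  lin_closed P -> (forall i, P (F i)) -> P (\sum_(i <- r | Q i) a i *: F i).
Proof.
move=> [P0 PD] PF; elim/big_rec: _ => // i x _ Px; exact: PD.
Qed.

Lemma span_ind P (s : seq V) : lin_closed P -> (forall x, x \in s -> P x) ->
  forall x, x \in <<s>>%VS -> P x.
Proof.
move=> Pl Ps x /(@coord_span _ _ _ (in_tuple s)) ->.
apply: lin_closed_sum => // i; apply: Ps; exact: mem_nth.
Qed.

Lemma codim_span_cons m (s : seq V) x : x \notin <<s>>%VS ->
  (dim V - \dim <<s>> <= m)%N -> (dim V - \dim <<x :: s>> < m)%N.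
Proof.
move=> xNs; apply: leq_trans; have lt_s : (\dim <<s>> < \dim <<x :: s>>)%N.
  rewrite span_cons ltn_neqAle dimvS ?addvSr // andbT; apply: contra xNs => /eqP eqd.
  have /eqP -> : (<<s>> == <[x]> + <<s>>)%VS by rewrite eqEdim addvSr eqd /=.
  exact: (subvP (addvSl _ _)) (memv_line x).
by apply: ltn_sub2l => //; apply: leq_trans lt_s _; rewrite -dimvf dimvS ?subvf.
Qed.

(** The specification of [lspan] only says that it is the least subspace containing [P]. A finite
    family in [P] that cannot be enlarged spans all of [P], so its span bounds [lspan P]; linear
    closure puts that span back inside [P]. *)
Lemma mem_lspan P : lin_closed P -> forall x, x \in lspan P -> P x.
Proof.
move=> Pl.
suff [s [sP maxs]] : exists s : seq V, (forall x, x \in s -> P x) /\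
    (forall x, P x -> x \in <<s>>%VS).
  move=> x xP; apply: (span_ind Pl sP).
  by move: x xP; apply/subvP; apply: lspan_subv.
have [m] := ubnP (dim V - \dim (<<[::] : seq V>>)%VS)%N.
have : forall x, x \in ([::] : seq V) -> P x by [].
move: [::] => s; elim: m s => // m IHm s sP /ltnSE les.
have [[x [Px xNs]]|noext] := pselect (exists x, P x /\ x \notin <<s>>%VS); last first.
  exists s; split=> // x Px; apply/negPn/negP => xNs.
  by apply: noext; exists x.
apply: (IHm (x :: s)) => [y|].
  by rewrite in_cons => /predU1P[->//|/sP].
exact: codim_span_cons.
Qed.

Lemma lin_closed_vs U : lin_closed (fun x => x \in U).
Proof. by split=> [|a x y xU yU]; rewrite ?mem0v// memvD ?memvZ. Qed.

Lemma lin_closedI P Q : lin_closed P -> lin_closed Q ->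
  lin_closed (fun x => P x /\ Q x).
Proof.
move=> [P0 PD] [Q0 QD]; split=> // a x y [Px Qx] [Py Qy].
by split; [apply: PD | apply: QD].
Qed.

Lemma lin_closedN P x : lin_closed P -> P x -> P (- x).
Proof. by move=> [P0 PD] Px; have := PD (-1) x 0 Px P0; rewrite scaleN1r addr0. Qed.

Lemma lin_closedD P x y : lin_closed P -> P x -> P y -> P (x + y).
Proof. by move=> [P0 PD] Px Py; have := PD 1 x y Px Py; rewrite scale1r. Qed.

Lemma lin_closedB P x y : lin_closed P -> P x -> P y -> P (x - y).
Proof. by move=> Pl Px Py; apply: lin_closedD => //; apply: lin_closedN. Qed.

Lemma lin_closedZ P a x : lin_closed P -> P x -> P (a *: x).
Proof. by move=> [P0 PD] Px; have := PD a x 0 Px P0; rewrite addr0. Qed.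

(* Linearity is a plain hypothesis so that the lemmas below apply directly to
   the unbundled brackets and forms of the statement. *)
Section LinearFun.
Variables (W : lmodType K) (f : V -> W).
Hypothesis fl : linear f.
Let fL : {linear V -> W} := HB.pack f (GRing.isLinear.Build _ _ _ _ f fl).

Lemma lfE0 : f 0 = 0. Proof. exact: (linear0 fL). Qed.
Lemma lfED : {morph f : x y / x + y}. Proof. exact: (linearD fL). Qed.
Lemma lfEN : {morph f : x / - x}. Proof. exact: (linearN fL). Qed.
Lemma lfEB : {morph f : x y / x - y}. Proof. exact: (linearB fL). Qed.
Lemma lfEZ a : {morph f : x / a *: x}. Proof. exact: (linearZZ fL). Qed.
Lemma lfE_sum I (r : seq I) (Q : pred I) F :
  f (\sum_(i <- r | Q i) F i) = \sum_(i <- r | Q i) f (F i).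
Proof. exact: (linear_sum fL). Qed.

End LinearFun.

Lemma eq_vtrace U (f g : V -> V) : {in U, f =1 g} -> vtrace U f = vtrace U g.
Proof.
move=> fg; apply: eq_bigr => i _; congr (coord _ _ _); apply: fg.
by apply: vbasis_mem; apply: mem_nth; rewrite size_tuple.
Qed.

Lemma vtraceD U (f g : V -> V) :
  vtrace U (fun x => f x + g x) = vtrace U f + vtrace U g.
Proof. by rewrite -big_split; apply: eq_bigr => i _; rewrite linearD. Qed.

Lemma vtraceZ U a (f : V -> V) : vtrace U (fun x => a *: f x) = a * vtrace U f.
Proof. by rewrite mulr_sumr; apply: eq_bigr => i _; rewrite linearZ. Qed.

Lemma vtrace_comp U (f g : V -> V) : linear f -> linear g ->
  {in U, forall x, f x \in U} -> {in U, forall x, g x \in U} ->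
  vtrace U (f \o g) = vtrace U (g \o f).
Proof.
move=> fl gl fU gU.
have bU i : (vbasis U)`_i \in U.
  have [lti|gei] := ltnP i (\dim U).
    by apply: vbasis_mem; apply: mem_nth; rewrite size_tuple.
  by rewrite nth_default ?mem0v ?size_tuple.
have E (h k : V -> V) : linear h -> linear k -> {in U, forall x, k x \in U} ->
    vtrace U (h \o k) = \sum_(i < \dim U) \sum_(j < \dim U)
      coord (vbasis U) j (k (vbasis U)`_i) * coord (vbasis U) i (h (vbasis U)`_j).
  move=> hl kl kU; apply: eq_bigr => i _ /=.
  rewrite {1}(coord_vbasis (kU _ (bU i))) (lfE_sum hl) linear_sum.
  by apply: eq_bigr => j _; rewrite (lfEZ hl) linearZ.
rewrite (E f g)// (E g f)// exchange_big /=.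
by apply: eq_bigr => i _; apply: eq_bigr => j _; rewrite mulrC.
Qed.

(** With [vtrace_sum], this turns the trace of a map written in an orthonormal family into a sum
    over that family. *)
Lemma vtrace_rank1 U (l : V -> K) v : scalar l -> v \in U ->
  vtrace U (fun x => l x *: v) = l v.
Proof.
move=> ll vU; rewrite [in RHS](coord_vbasis vU) (lfE_sum (W := K^o) ll).
by apply: eq_bigr => i _; rewrite linearZ (lfEZ (W := K^o) ll); exact: mulrC.
Qed.

Lemma vtrace_sum U I (r : seq I) (f : I -> V -> V) :
  vtrace U (fun x => \sum_(i <- r) f i x) = \sum_(i <- r) vtrace U (f i).
Proof. by rewrite exchange_big; apply: eq_bigr => i _; rewrite linear_sum. Qed.

End Traces.

(** * Bilinear maps and orthonormal families *)

Section Bilinear.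
Variables (K : fieldType) (E : vectType K).

Definition bilin (W : lmodType K) (f : E -> E -> W) :=
  (forall z, linear (f^~ z)) /\ (forall z, linear (f z)).

Section BilinearMaps.
Variables (W : lmodType K) (f : E -> E -> W).
Hypothesis fb : bilin f.

Lemma bDl x y z : f (x + y) z = f x z + f y z.
Proof. exact: (lfED (fb.1 z)). Qed.
Lemma bDr x y z : f z (x + y) = f z x + f z y.
Proof. exact: (lfED (fb.2 z)). Qed.
Lemma bNl x z : f (- x) z = - f x z. Proof. exact: (lfEN (fb.1 z)). Qed.
Lemma bNr x z : f z (- x) = - f z x. Proof. exact: (lfEN (fb.2 z)). Qed.
Lemma bBl x y z : f (x - y) z = f x z - f y z.
Proof. exact: (lfEB (fb.1 z)). Qed.
Lemma bBr x y z : f z (x - y) = f z x - f z y.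
Proof. exact: (lfEB (fb.2 z)). Qed.
Lemma b0l z : f 0 z = 0. Proof. exact: (lfE0 (fb.1 z)). Qed.
Lemma b0r z : f z 0 = 0. Proof. exact: (lfE0 (fb.2 z)). Qed.
Lemma bZl a x z : f (a *: x) z = a *: f x z.
Proof. exact: (lfEZ (fb.1 z)). Qed.
Lemma bZr a x z : f z (a *: x) = a *: f z x.
Proof. exact: (lfEZ (fb.2 z)). Qed.
Lemma b_suml I (r : seq I) (Q : pred I) F z :
  f (\sum_(i <- r | Q i) F i) z = \sum_(i <- r | Q i) f (F i) z.
Proof. exact: (lfE_sum (fb.1 z)). Qed.
Lemma b_sumr I (r : seq I) (Q : pred I) F z :
  f z (\sum_(i <- r | Q i) F i) = \sum_(i <- r | Q i) f z (F i).
Proof. exact: (lfE_sum (fb.2 z)). Qed.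
End BilinearMaps.

Definition bilform (f : E -> E -> K) := bilin (W := K^o) f.

Lemma fZl (f : E -> E -> K) a x z : bilform f -> f (a *: x) z = a * f x z.
Proof. by move=> fb; rewrite (bZl fb). Qed.
Lemma fZr (f : E -> E -> K) a x z : bilform f -> f z (a *: x) = a * f z x.
Proof. by move=> fb; rewrite (bZr fb). Qed.

Lemma big_delta_seq (W : lmodType K) (e : seq E) (F : E -> W) x :
  uniq e -> x \in e -> \sum_(w <- e) (x == w)%:R *: F w = F x.
Proof.
move=> ue xe; rewrite (bigD1_seq x)//= eqxx scale1r big1 ?addr0// => w /negPf.
by rewrite eq_sym => ->; rewrite scale0r.
Qed.

Definition orthonormal_seq (ip : E -> E -> K) (e : seq E) :=
  uniq e /\ {in e &, forall x y, ip x y = (x == y)%:R}.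

Lemma orthonormal_expand ip e X : bilform ip -> orthonormal_seq ip e ->
  X \in <<e>>%VS -> X = \sum_(w <- e) ip X w *: w.
Proof.
move=> ipb [ue oe]; move: X; apply: span_ind.
  split=> [|a x y xE yE].
    by rewrite big1// => w _; rewrite (b0l ipb) scale0r.
  rewrite {1}xE {1}yE scaler_sumr -big_split; apply: eq_bigr => w _ /=.
  by rewrite (bDl ipb) (fZl _ _ _ ipb) scalerDl scalerA.
move=> x xe; rewrite -[LHS](big_delta_seq id ue xe) !big_seq.
by apply: eq_bigr => w we; rewrite oe.
Qed.

Lemma parseval ip e X Y : bilform ip -> orthonormal_seq ip e ->
  X \in <<e>>%VS -> ip X Y = \sum_(w <- e) ip X w * ip w Y.
Proof.
move=> ipb oe Xe; rewrite {1}(orthonormal_expand ipb oe Xe) (b_suml ipb).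
by apply: eq_bigr => w _; rewrite (fZl _ _ _ ipb).
Qed.

Lemma orthonormal_eq ip e X Y : bilform ip -> orthonormal_seq ip e ->
  X \in <<e>>%VS -> Y \in <<e>>%VS ->
  (forall w, w \in e -> ip X w = ip Y w) -> X = Y.
Proof.
move=> ipb oe Xe Ye XY.
rewrite (orthonormal_expand ipb oe Xe) (orthonormal_expand ipb oe Ye) !big_seq.
by apply: eq_bigr => w we; rewrite XY.
Qed.

End Bilinear.

(** * Gram-Schmidt adapted to an orthogonal family of subspaces *)

Section GramSchmidt.
Variables (R : realType) (E : vectType R) (ip : E -> E -> R).
Variables (I : eqType) (U : I -> E -> Prop).

(** Subtracting from [x] in [U k] its projection on the vectors already found stays in [U k], since
    vectors of the other pieces get coefficient zero. Hence positivity and symmetry are only asked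
    on each piece. The index is a pair of weight and parity for g_+, and [unit] where no grading is
    involved. *)
Lemma graded_orthonormal_basis : bilform ip -> (forall k, lin_closed (U k)) ->
  (forall k x y, U k x -> U k y -> ip x y = ip y x) ->
  (forall k x, U k x -> x != 0 -> 0 < ip x x) ->
  (forall k l x y, k != l -> U k x -> U l y -> ip x y = 0) ->
  exists e : seq E, [/\ orthonormal_seq ip e, forall x, x \in e -> exists k, U k x &
    forall k x, U k x -> x \in <<e>>%VS].
Proof.
move=> ipb Ul ipC ip_gt0 ip_eq0.
suff: forall m (s : seq E), orthonormal_seq ip s ->
    (forall x, x \in s -> exists k, U k x) -> (dim E - \dim <<s>> < m)%N ->
    exists e : seq E, [/\ orthonormal_seq ip e, forall x, x \in e -> exists k, U k x &
      forall k x, U k x -> x \in <<e>>%VS].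
  by move/(_ (dim E).+1 [::]); apply=> //; rewrite ltnS leq_subr.
elim=> // m IHm s os sU /ltnSE les.
have [[k [x [Ux xNs]]]|noext] :=
    pselect (exists k x, U k x /\ x \notin <<s>>%VS); last first.
  exists s; split=> // k x Ux; apply/negPn/negP => xNs.
  by apply: noext; exists k, x.
pose y := x - \sum_(w <- s) ip x w *: w.
have sumS : \sum_(w <- s) ip x w *: w \in <<s>>%VS.
  by rewrite big_seq memv_suml// => w ws; rewrite memvZ// memv_span.
have Uy : U k y.
  apply: lin_closedB => //; rewrite big_seq_cond.
  elim/big_rec: _ => [|w z]; first exact: (Ul k).1.
  rewrite andbT => ws Uz; have [l Uw] := sU _ ws.
  have [kl|kl] := eqVneq k l; first by subst l; apply: (Ul k).2.
  by rewrite (ip_eq0 _ _ _ _ kl Ux Uw) scale0r add0r.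
have yNs : y \notin <<s>>%VS.
  by apply: contra xNs => ys; rewrite -(subrK (\sum_(w <- s) ip x w *: w) x) memvD.
have y0 : y != 0 by apply: contraNneq yNs => ->; rewrite mem0v.
have ys0 w : w \in s -> ip y w = 0.
  move=> ws; rewrite (bBl ipb) (b_suml ipb).
  rewrite [X in _ - X](_ : _ = ip x w) ?subrr//.
  rewrite -[RHS](big_delta_seq (W := R^o) (ip x) os.1 ws) !big_seq.
  apply: eq_bigr => v vs; rewrite (fZl _ _ _ ipb) (os.2 v w)// eq_sym; exact: mulrC.
have sy0 w : w \in s -> ip w y = 0.
  move=> ws; have [l Uw] := sU _ ws; have [kl|kl] := eqVneq k l.
    by subst l; rewrite (ipC k)// ys0.
  by rewrite (ip_eq0 l k)// eq_sym.
pose c := Num.sqrt (ip y y); pose u := c^-1 *: y.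
have cy : 0 < ip y y by apply: ip_gt0 Uy y0.
have c0 : c != 0 by rewrite gt_eqF// sqrtr_gt0.
have uu : ip u u = 1.
  rewrite (fZl _ _ _ ipb) (fZr _ _ _ ipb) -(sqr_sqrtr (ltW cy)) -/c.
  by field.
have uNs : u \notin <<s>>%VS.
  by apply: contra yNs => us; rewrite -[y](scalerKV c0) memvZ.
apply: (IHm (u :: s)).
- split=> /=; first by rewrite os.1 andbT; apply: contra uNs; apply: memv_span.
  move=> a b; rewrite !inE => /predU1P[->|as_] /predU1P[->|bs].
  + by rewrite eqxx.
  + rewrite (fZl _ _ _ ipb) ys0// mulr0; case: eqP => // ub.
    by move: uNs; rewrite ub memv_span.
  + rewrite (fZr _ _ _ ipb) sy0// mulr0; case: eqP => // ub.
    by move: uNs; rewrite -ub memv_span.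
  + exact: os.2.
- move=> a; rewrite inE => /predU1P[->|/sU//].
  by exists k; apply: lin_closedZ.
- exact: codim_span_cons.
Qed.

End GramSchmidt.

(** * Ricci curvature of a metric Lie algebra *)

Section RicciFormula.
Variables (R : realType) (E : vectType R).
Variables (br : E -> E -> E) (ip : E -> E -> R) (e : seq E).
Local Notation s := <<e>>%VS.
Hypotheses (brb : bilin br) (brC : forall X Y, br X Y = - br Y X).
Hypotheses (br_s : {in s &, forall X Y, br X Y \in s}).
Hypotheses (ipb : bilform ip) (ipC : {in s &, forall X Y, ip X Y = ip Y X}).
Hypothesis oe : orthonormal_seq ip e.

Let c X Y Z := ip (br X Y) Z.
(** The Koszul formula for <nabla_X Y, Z>; the derivative terms vanish on left-invariant fields. *)
Let G X Y Z := 2^-1 * (c X Y Z - c Y Z X + c Z X Y).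
Let nabla X Y := \sum_(w <- e) G X Y w *: w.

Let cC X Y Z : c X Y Z = - c Y X Z.
Proof. by rewrite /c brC (bNl ipb). Qed.

Let cXX X Z : c X X Z = 0.
Proof. by have := cC X X Z; lra. Qed.

Let c1 Y Z : scalar (fun X => c X Y Z).
Proof. by move=> a X X'; rewrite /c (bDl brb) (bZl brb) (bDl ipb) (fZl _ _ _ ipb). Qed.
Let c2 X Z : scalar (fun Y => c X Y Z).
Proof. by move=> a Y Y'; rewrite /c (bDr brb) (bZr brb) (bDl ipb) (fZl _ _ _ ipb). Qed.
Let c3 X Y : scalar (fun Z => c X Y Z).
Proof. by move=> a Z Z'; rewrite /c (bDr ipb) (fZr _ _ _ ipb). Qed.

Let G1 Y Z : scalar (fun X => G X Y Z).
Proof. by move=> a X X'; rewrite /G c1 c2 c3; ring. Qed.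
Let G2 X Z : scalar (fun Y => G X Y Z).
Proof. by move=> a Y Y'; rewrite /G c1 c2 c3; ring. Qed.
Let G3 X Y : scalar (fun Z => G X Y Z).
Proof. by move=> a Z Z'; rewrite /G c1 c2 c3; ring. Qed.

Let G_antisym X Y Z : G X Y Z = - G X Z Y.
Proof. by rewrite /G (cC X Z Y) (cC Z Y X) (cC Y X Z); ring. Qed.

Let es w : w \in e -> w \in s. Proof. exact: memv_span. Qed.

Let nabla_s X Y : nabla X Y \in s.
Proof. by rewrite /nabla big_seq memv_suml// => w we; rewrite memvZ// es. Qed.

Let nablab : bilin nabla.
Proof.
split=> Z a X Y; rewrite /nabla scaler_sumr -big_split; apply: eq_bigr => w _ /=.
  by rewrite G1 scalerDl scalerA.
by rewrite G2 scalerDl scalerA.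
Qed.

Let expand X : X \in s -> X = \sum_(w <- e) ip X w *: w.
Proof. exact: orthonormal_expand. Qed.

Let ip_nabla X Y W : W \in s -> ip (nabla X Y) W = G X Y W.
Proof.
move=> Ws; rewrite [in RHS](expand Ws) (lfE_sum (W := R^o) (G3 X Y)).
rewrite (b_suml ipb) !big_seq; apply: eq_bigr => w we.
rewrite (fZl _ _ _ ipb) (lfEZ (W := R^o) (G3 X Y)) (ipC (es we) Ws).
exact: mulrC.
Qed.

Lemma koszul_levi_civita : levi_civita br ip s nabla.
Proof.
split=> [X Y _ _ //|X Y Xs Ys|X Y Z Xs Ys Zs].
  apply: (orthonormal_eq ipb oe); rewrite ?memvB ?br_s// => w /es ws.
  rewrite (bBl ipb) !ip_nabla// -[ip _ _]/(c X Y w) /G.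
  by rewrite (cC Y X w) (cC X w Y) (cC w Y X); field.
by rewrite (ipC Ys (nabla_s _ _)) !ip_nabla// (G_antisym X Z Y) subrr.
Qed.

Lemma vtrace_orthonormal (f : E -> E) : linear f -> {in s, forall x, f x \in s} ->
  vtrace s f = \sum_(w <- e) ip (f w) w.
Proof.
move=> fl fs.
rewrite (eq_vtrace (g := fun x => \sum_(w <- e) ip (f x) w *: w)).
  rewrite vtrace_sum !big_seq; apply: eq_bigr => w we.
  rewrite (vtrace_rank1 (l := fun x => ip (f x) w)) ?es// => a x y.
  by rewrite fl (bDl ipb) (fZl _ _ _ ipb).
by move=> x xs; rewrite -expand ?fs.
Qed.

(** The first sum is <nabla_X Y, H> for the mean curvature vector H, determined by <H, m> = tr ad
    m. *)
Lemma ricci_formula X Y : X \in s -> Y \in s ->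
  ricci br s nabla X Y =
    - (\sum_(m <- e) G X Y m * \sum_(z <- e) c m z z)
    + \sum_(z <- e) \sum_(m <- e)
        (- 2^-1 * (c X z m * c Y z m) - 2^-1 * (c X z m * c Y m z)
         + 4^-1 * (c z m X * c z m Y)).
Proof.
move=> Xs Ys; have [_ _ compat] := koszul_levi_civita.
rewrite /ricci vtrace_orthonormal; last 2 first.
- move=> a Z Z'; rewrite /curvature !(bDl nablab, bZl nablab, bDr nablab, bZr nablab).
  rewrite (bDl brb) (bZl brb) (bDl nablab) (bZl nablab) !scalerBr !opprD.
  by rewrite [X in X + _ = _]addrACA [LHS]addrACA.
- by move=> Z Zs; rewrite /curvature !memvB.
(* By metric compatibility -<nabla_X nabla_z Y, z> is <nabla_z Y, nabla_X z>; this and the expansion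
   of [z, X] in [e] are collected in [F]. The remaining term <nabla_z nabla_X Y, z> is the mean
   curvature part. *)
pose F z m := G z Y m * G X z m - c z X m * G m Y z.
transitivity (\sum_(z <- e) (- c (nabla X Y) z z + \sum_(m <- e) F z m)).
  rewrite !big_seq; apply: eq_bigr => z /es zs.
  rewrite /curvature !(bBl ipb) ip_nabla// -addrA; congr (_ + _).
    by rewrite /G (cC z (nabla X Y) z) cXX; field.
  rewrite sumrB; congr (_ - _).
    have /eqP := compat X (nabla z Y) z Xs (nabla_s _ _) zs.
    rewrite addr_eq0 => /eqP ->; rewrite opprK (parseval _ ipb oe (nabla_s _ _)).
    rewrite !big_seq; apply: eq_bigr => m /es ms.
    by rewrite (ipC ms (nabla_s _ _)) !ip_nabla.
  rewrite ip_nabla// {1}(expand (br_s zs Xs)) (lfE_sum (W := R^o) (G1 Y z)).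
  by apply: eq_bigr => m _; rewrite (lfEZ (W := R^o) (G1 Y z)).
rewrite big_split; congr (_ + _).
  rewrite sumrN; congr (- _); under [RHS]eq_bigr => m _ do rewrite mulr_sumr.
  rewrite exchange_big /=; apply: eq_bigr => z _.
  rewrite (lfE_sum (W := R^o) (c1 z z)).
  by apply: eq_bigr => m _; rewrite (lfEZ (W := R^o) (c1 z z)).
(* The two summands differ by a part antisymmetric in [z] and [m], so they are compared only after
   symmetrisation. *)
have sym (H : E -> E -> R) : \sum_(z <- e) \sum_(m <- e) H z m =
    \sum_(z <- e) \sum_(m <- e) 2^-1 * (H z m + H m z).
  transitivity (2^-1 * (\sum_(z <- e) \sum_(m <- e) H z m +
                         \sum_(z <- e) \sum_(m <- e) H m z)).
    by rewrite [X in _ + X]exchange_big /=; field.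
  rewrite -big_split mulr_sumr; apply: eq_bigr => z _.
  by rewrite -big_split mulr_sumr.
rewrite sym [RHS]sym; apply: eq_bigr => z _; apply: eq_bigr => m _.
by rewrite /F /G (cC z X) (cC m X) (cC z Y) (cC m Y) (cC m z X) (cC m z Y); field.
Qed.

Let h m := \sum_(z <- e) c m z z.
Let T X Y z m := - 2^-1 * (c X z m * c Y z m) - 2^-1 * (c X z m * c Y m z)
                 + 4^-1 * (c z m X * c z m Y).
Let ric X Y := - (\sum_(m <- e) G X Y m * h m)
               + \sum_(z <- e) \sum_(m <- e) T X Y z m.

Let sum_lin (I : Type) (r : seq I) (F1 F2 F3 : I -> R) (a : R) :
  (forall i, F1 i = a * F2 i + F3 i) ->
  \sum_(i <- r) F1 i = a * (\sum_(i <- r) F2 i) + \sum_(i <- r) F3 i.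
Proof. by move=> F; rewrite mulr_sumr -big_split; apply: eq_bigr. Qed.

Let ric1 Y : scalar (fun X => ric X Y).
Proof.
move=> a X X'; rewrite /ric.
rewrite (@sum_lin _ _ _ (fun m => G X Y m * h m) (fun m => G X' Y m * h m) a);
  last by move=> m; rewrite G1; ring.
rewrite [X in _ + X = _](@sum_lin _ _ _ (fun z => \sum_(m <- e) T X Y z m)
  (fun z => \sum_(m <- e) T X' Y z m) a); first by ring.
by move=> z; apply: sum_lin => m; rewrite /T !c1 c3; ring.
Qed.

Let ric2 X : scalar (fun Y => ric X Y).
Proof.
move=> a Y Y'; rewrite /ric.
rewrite (@sum_lin _ _ _ (fun m => G X Y m * h m) (fun m => G X Y' m * h m) a);
  last by move=> m; rewrite G2; ring.
rewrite [X in _ + X = _](@sum_lin _ _ _ (fun z => \sum_(m <- e) T X Y z m)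
  (fun z => \sum_(m <- e) T X Y' z m) a); first by ring.
by move=> z; apply: sum_lin => m; rewrite /T !c1 c3; ring.
Qed.

Variables (f n : seq E) (w : E -> E -> R) (delta : E -> R).
Hypotheses (def_e : e = f ++ n).
Hypothesis br_ff : {in f &, forall A A', br A A' = 0}.
Hypothesis br_fn : {in f & n, forall A x, br A x = w A x *: x}.
Hypothesis c_nef : forall x z A, x \in n -> z \in e -> A \in f -> c x z A = 0.
(* So ad x is strictly triangular for x in n; this kills its trace and the
   products c x z m * c y m z. *)
Hypothesis c_raises : forall x z m,
  x \in n -> z \in e -> m \in e -> delta m <= delta z -> c x z m = 0.
Hypothesis tr_ff : {in f &, forall A A',
  \sum_(x <- n) w A x * w A' x = 4^-1 * (A == A')%:R}.
Hypothesis ric_nn : {in n &, forall x y,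
  \sum_(z <- n) \sum_(m <- n)
    (- 2^-1 * (c x z m * c y z m) + 4^-1 * (c z m x * c z m y))
  = (- 4^-1 + \sum_(A <- f) (\sum_(z <- n) w A z) * w A x) * (x == y)%:R}.

Let fe A : A \in f -> A \in e. Proof. by rewrite def_e mem_cat => ->. Qed.
Let ne x : x \in n -> x \in e. Proof. by rewrite def_e mem_cat orbC => ->. Qed.
Let fn A x : A \in f -> x \in n -> (A == x) = false.
Proof.
move=> Af xn; apply/eqP => Ax; have := oe.1; rewrite def_e cat_uniq.
by case/and3P=> _ /hasPn /(_ _ xn); rewrite -Ax Af.
Qed.

Let c_fne A x z : A \in f -> x \in n -> z \in e -> c A x z = w A x * (x == z)%:R.
Proof. by move=> Af xn ze; rewrite /c br_fn// (fZl _ _ _ ipb) oe.2// ne. Qed.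
Let c_ff A A' z : A \in f -> A' \in f -> c A A' z = 0.
Proof. by move=> Af A'f; rewrite /c br_ff// (b0l ipb). Qed.
Let c_eef z m A : z \in e -> m \in e -> A \in f -> c z m A = 0.
Proof.
move=> ze me Af; have := ze; rewrite def_e mem_cat => /orP[zf|zn]; last exact: c_nef.
have := me; rewrite def_e mem_cat => /orP[mf|mn]; first exact: c_ff.
by rewrite cC c_nef ?oppr0.
Qed.
Let c_nee x z : x \in n -> z \in e -> c x z z = 0.
Proof. by move=> xn ze; apply: c_raises. Qed.
Let c_nil x y z m : x \in n -> y \in n -> z \in e -> m \in e ->
  c x z m * c y m z = 0.
Proof.
move=> xn yn ze me; have [mz|/ltW zm] := leP (delta m) (delta z).
  by rewrite c_raises// mul0r.
by rewrite [c y m z]c_raises// mulr0.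
Qed.

Let un : uniq n. Proof. by have := oe.1; rewrite def_e cat_uniq => /and3P[]. Qed.
Let h_n x : x \in n -> h x = 0.
Proof. by move=> xn; rewrite /h big_seq big1// => z ze; apply: c_nee. Qed.
Let h_f A : A \in f -> h A = \sum_(x <- n) w A x.
Proof.
move=> Af; rewrite /h def_e big_cat /= big_seq big1 ?add0r => [|z zf].
  rewrite !big_seq; apply: eq_bigr => z zn.
  by rewrite c_fne ?ne// eqxx mulr1.
exact: c_ff.
Qed.

Let sum_ee (F : E -> E -> R) : \sum_(z <- e) \sum_(m <- e) F z m =
  \sum_(z <- f) \sum_(m <- f) F z m + \sum_(z <- f) \sum_(m <- n) (F z m + F m z)
  + \sum_(z <- n) \sum_(m <- n) F z m.
Proof.
have E1 r : \sum_(z <- r) \sum_(m <- e) F z m =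
    \sum_(z <- r) \sum_(m <- f) F z m + \sum_(z <- r) \sum_(m <- n) F z m.
  by rewrite -big_split; apply: eq_bigr => z _; rewrite def_e big_cat.
rewrite {1}def_e big_cat /= !E1 -!addrA; congr (_ + _); rewrite addrA; congr (_ + _).
rewrite [X in _ + X]exchange_big /= -big_split.
by apply: eq_bigr => z _; rewrite -big_split.
Qed.

Let sum2_0 (r1 r2 : seq E) (F : E -> E -> R) :
  (forall z m, z \in r1 -> m \in r2 -> F z m = 0) ->
  \sum_(z <- r1) \sum_(m <- r2) F z m = 0.
Proof.
move=> F0; rewrite big_seq big1// => z zr1; rewrite big_seq big1// => m mr2.
exact: F0.
Qed.

Let c_diag A z m : A \in f -> z \in e -> m \in e -> z != m -> c A z m = 0.
Proof.
move=> Af ze me /negPf zm; have := ze; rewrite {1}def_e mem_cat => /orP[zf|zn].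
  exact: c_ff.
by rewrite c_fne// zm mulr0.
Qed.

Let c_nf x A z m : x \in n -> A \in f -> z \in e -> m \in e ->
  c x z m * c A z m = 0 /\ c x z m * c A m z = 0.
Proof.
move=> xn Af ze me; have [->|zm] := eqVneq z m; first by rewrite c_nee// !mul0r.
have mz : m != z by rewrite eq_sym.
by rewrite (c_diag Af ze me zm) (c_diag Af me ze mz) !mulr0.
Qed.

(** Every product pairs a coefficient of ad x, which has zero diagonal, with one of ad A, which is
    diagonal. Both orders are computed because the first sum in [ric] is not visibly symmetric. *)
Let ric_mixed x A : x \in n -> A \in f -> ric x A = 0 /\ ric A x = 0.
Proof.
move=> xn Af; rewrite /ric !sum2_0 ?addr0.
- split; apply/eqP; rewrite oppr_eq0; apply/eqP; rewrite big_seq big1// => m.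
  + rewrite def_e mem_cat => /orP[mf|mn]; last by rewrite h_n// mulr0.
    rewrite /G (c_eef (ne xn) (fe Af) mf) (c_ff x Af mf) (c_fne mf xn (fe Af)).
    by rewrite (eq_sym x) fn// mulr0; ring.
  + rewrite def_e mem_cat => /orP[mf|mn]; last by rewrite h_n// mulr0.
    by rewrite /G (c_eef (fe Af) (ne xn) mf) (c_nef xn (fe mf) Af) (c_ff x mf Af); ring.
- move=> z m ze me; rewrite /T (c_eef ze me Af).
  have [E1 _] := c_nf xn Af ze me; have [_ E2] := c_nf xn Af me ze.
  by rewrite (mulrC (c A z m) (c x z m)) E1 (mulrC (c A z m) (c x m z)) E2; ring.
- move=> z m ze me; rewrite /T (c_eef ze me Af).
  by have [-> ->] := c_nf xn Af ze me; ring.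
Qed.

Let ric_ff A A' : A \in f -> A' \in f -> ric A A' = - 4^-1 * (A == A')%:R.
Proof.
move=> Af A'f; rewrite /ric.
rewrite big_seq big1 ?oppr0 ?add0r => [|m]; last first.
  rewrite def_e mem_cat => /orP[mf|mn]; last by rewrite h_n// mulr0.
  by rewrite /G !c_ff//; ring.
rewrite sum_ee [X in X + _ + _]sum2_0 ?add0r; last first.
  move=> z m zf mf; rewrite /T (c_eef (fe zf) (fe mf) Af).
  by rewrite (c_ff _ Af zf); ring.
rewrite [X in X + _]sum2_0 ?add0r; last first.
  move=> z m zf mn; have zm : z != m by rewrite fn.
  have mz : m != z by rewrite eq_sym.
  rewrite /T (c_eef (fe zf) (ne mn) Af) (c_eef (ne mn) (fe zf) Af).
  by rewrite (c_diag Af (fe zf) (ne mn) zm) (c_diag Af (ne mn) (fe zf) mz); ring.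
rewrite mulNr -tr_ff// -sumrN !big_seq; apply: eq_bigr => z zn.
rewrite (bigD1_seq z) ?un//= big_seq_cond big1 ?addr0 => [|m /andP[mn mz]].
  rewrite /T (c_eef (ne zn) (ne zn) Af) (c_fne Af zn (ne zn)) (c_fne A'f zn (ne zn)).
  by rewrite eqxx !mulr1; field.
rewrite eq_sym in mz; rewrite /T (c_eef (ne zn) (ne mn) Af).
by rewrite (c_diag Af (ne zn) (ne mn) mz); ring.
Qed.

Let ric_diag x y : x \in n -> y \in n -> ric x y = - 4^-1 * (x == y)%:R.
Proof.
move=> xn yn; rewrite /ric sum_ee sum2_0 ?add0r; last first.
  move=> z m zf mf; rewrite /T (c_nef xn (fe zf) mf) (c_ff x zf mf).
  by ring.
(* With one index in [f] and one in [n], the three surviving products all equal the squared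
   eigenvalue, with coefficients -1/2, 1/4 and 1/4, so they cancel. *)
rewrite [X in _ + (X + _)]sum2_0 ?add0r; last first.
  move=> z m zf mn; have [[ze me] [xe ye]] := ((fe zf, ne mn), (ne xn, ne yn)).
  rewrite /T (cC x z) (cC y z) (cC m z) (cC m z) !(c_fne zf)//.
  rewrite !(c_nef _ me zf)//.
  have [->|xm] := eqVneq m x; last by rewrite !mulr0n; ring.
  have [->|ym] := eqVneq x y; last by rewrite !mulr0n; ring.
  by rewrite !mulr1n; field.
(* The mean curvature vector is orthogonal to [n], so only <nabla_x y, A> with [A] in [f] counts,
   and this is [w A x] when [x = y] and 0 otherwise. *)
have -> : \sum_(m <- e) G x y m * h m =
    (\sum_(A <- f) (\sum_(z <- n) w A z) * w A x) * (x == y)%:R.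
  rewrite def_e big_cat /= [X in _ + X]big_seq [X in _ + X]big1 ?addr0; last first.
    by move=> z zn; rewrite h_n// mulr0.
  rewrite mulr_suml !big_seq; apply: eq_bigr => A Af.
  rewrite h_f// /G (c_eef (ne xn) (ne yn) Af) (cC y A) !(c_fne Af) ?ne//.
  have [->|xy] := eqVneq x y; rewrite ?eqxx ?mulr1n; first by field.
  by rewrite !mulr0n; ring.
have := ric_nn xn yn; rewrite mulrDl => E1.
suff -> : \sum_(z <- n) \sum_(m <- n) T x y z m = \sum_(z <- n)
  \sum_(m <- n) (- 2^-1 * (c x z m * c y z m) + 4^-1 * (c z m x * c z m y)).
  by rewrite E1; ring.
rewrite !big_seq; apply: eq_bigr => z zn; rewrite !big_seq; apply: eq_bigr => m mn.
by rewrite /T (c_nil xn yn) ?ne//; ring.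
Qed.

(** On [f] the curvature is minus the sum in [tr_ff]. On [n] the extra term on the right of [ric_nn]
    is exactly what the mean curvature term subtracts. Bilinearity extends the values from the basis
    to the span. *)
Lemma ricci_criterion : is_einstein br ip s.
Proof.
exists nabla; first exact: koszul_levi_civita.
exists (- 4^-1) => X Y Xs Ys; rewrite ricci_formula// -/(ric X Y).
have ric_ee x y : x \in e -> y \in e -> ric x y = - 4^-1 * ip x y.
  move=> xe ye; rewrite oe.2//.
  have := ye; rewrite {1}def_e mem_cat => /orP[yf|yn];
  have := xe; rewrite {1}def_e mem_cat => /orP[xf|xn].
  - exact: ric_ff.
  - by have [-> _] := ric_mixed xn yf; rewrite eq_sym fn// mulr0.
  - by have [_ ->] := ric_mixed yn xf; rewrite fn// mulr0.
  - exact: ric_diag.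
move: X Xs; apply: span_ind.
  split=> [|a x x' Ex Ex'].
    by rewrite (lfE0 (W := R^o) (ric1 Y)) (b0l ipb) mulr0.
  by rewrite ric1 Ex Ex' (bDl ipb) (fZl _ _ _ ipb); ring.
move=> x xe; move: Y Ys; apply: span_ind.
  split=> [|a y y' Ey Ey'].
    by rewrite (lfE0 (W := R^o) (ric2 x)) (b0r ipb) mulr0.
  by rewrite ric2 Ey Ey' (bDr ipb) (fZr _ _ _ ipb); ring.
by move=> y ye; apply: ric_ee.
Qed.

End RicciFormula.

(** * The Killing form of a Lie algebra with a grading *)

Section KillingForm.
Variables (R : realType) (V : vectType R) (br : V -> V -> V) (g : {vspace V}).
Variable sg : V -> V.
Hypotheses (brb : bilin br) (brC : forall X Y, br X Y = - br Y X).
Hypothesis jacobi : forall X Y Z, br (br X Y) Z = br X (br Y Z) - br Y (br X Z).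
Hypothesis br_g : {in g &, forall X Y, br X Y \in g}.
Hypotheses (sgl : linear sg) (sg_g : {in g, forall X, sg X \in g}).
Hypotheses (sgK : involutive sg) (sg_br : forall X Y, sg (br X Y) = br (sg X) (sg Y)).

Definition gkilling X Y := vtrace g (fun T => br X (br Y T)).
Definition gkilling_sg X Y := - gkilling X (sg Y).
Local Notation B := gkilling.

Lemma linear_ad X : linear (br X). Proof. exact: brb.2. Qed.
Lemma ad_g X : X \in g -> {in g, forall T, br X T \in g}.
Proof. by move=> Xg T; apply: br_g. Qed.

Lemma linear_comp (f h : V -> V) : linear f -> linear h -> linear (f \o h).
Proof. by move=> fl hl a x y; rewrite /= hl fl. Qed.

Lemma gkilling_form : bilform B.
Proof.
split=> Z a X Y; rewrite /gkilling -[RHS]/(a * _ + _) -vtraceZ -vtraceD.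
  by apply: eq_vtrace => T _; rewrite (bDl brb) (bZl brb).
by apply: eq_vtrace => T _; rewrite (bDl brb) (bZl brb) (bDr brb) (bZr brb).
Qed.

Lemma gkillingC : {in g &, forall X Y, B X Y = B Y X}.
Proof.
move=> X Y Xg Yg.
exact: vtrace_comp (linear_ad X) (linear_ad Y) (ad_g Xg) (ad_g Yg).
Qed.

Lemma gkilling_inv : {in g & &, forall X Y Z, B (br X Y) Z = B X (br Y Z)}.
Proof.
move=> X Y Z Xg Yg Zg.
transitivity (vtrace g (fun T => br X (br Y (br Z T))) -
              vtrace g (fun T => br Y (br X (br Z T)))).
  rewrite -mulN1r -vtraceZ -vtraceD; apply: eq_vtrace => T _.
  by rewrite jacobi scaleN1r.
have XZ_g : {in g, forall T, (br X \o br Z) T \in g}.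
  by move=> T Tg /=; rewrite !br_g.
rewrite (vtrace_comp (linear_ad Y) (linear_comp (linear_ad X) (linear_ad Z))
  (ad_g Yg) XZ_g).
rewrite -mulN1r -vtraceZ -vtraceD; apply: eq_vtrace => T _ /=.
by rewrite jacobi (bBr brb) scaleN1r.
Qed.

(** Conjugation by an involution preserving [g] does not change a trace. The lemma is used for the
    Cartan involution and again for the parity involution [tau]. *)
Lemma gkilling_sgsg : {in g &, forall X Y, B (sg X) (sg Y) = B X Y}.
Proof.
move=> X Y Xg Yg; rewrite /B.
rewrite (eq_vtrace (g := sg \o (br X \o br Y \o sg))) => [|T _ /=]; last first.
  by rewrite !sg_br sgK.
rewrite vtrace_comp //.
- by apply: eq_vtrace => T _ /=; rewrite sgK.
- by apply: linear_comp => //; apply: linear_comp; apply: linear_ad.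
- by move=> T Tg /=; rewrite !br_g ?sg_g.
Qed.

Lemma gkilling_sg_form : bilform gkilling_sg.
Proof.
have Bb := gkilling_form.
split=> Z a X Y; rewrite /gkilling_sg.
  rewrite (bDl Bb) (fZl _ _ _ Bb) opprD; congr (_ + _); exact/esym/mulrN.
rewrite sgl (bDr Bb) (fZr _ _ _ Bb) opprD; congr (_ + _); exact/esym/mulrN.
Qed.

Lemma gkilling_sgC : {in g &, forall X Y, gkilling_sg X Y = gkilling_sg Y X}.
Proof.
by move=> X Y Xg Yg; rewrite /gkilling_sg -gkilling_sgsg ?sg_g// sgK gkillingC ?sg_g.
Qed.

Lemma gkilling_sg_sgsg : {in g &, forall X Y, gkilling_sg (sg X) (sg Y) = gkilling_sg X Y}.
Proof. by move=> X Y Xg Yg; rewrite /gkilling_sg gkilling_sgsg ?sg_g. Qed.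

Lemma gkilling_sg_adj : {in g & &, forall X Y Z,
  gkilling_sg (br X Y) Z = - gkilling_sg Y (br (sg X) Z)}.
Proof.
move=> X Y Z Xg Yg Zg; have Bb := gkilling_form.
by rewrite /gkilling_sg brC (bNl Bb) gkilling_inv ?sg_g// sg_br sgK.
Qed.

Section Graded.
(* A variable, so that rewriting does not see through the form to a trace. *)
Variables (Bs : V -> V -> R) (Bs_def : Bs = gkilling_sg).
Variables (gp g0 : V -> Prop) (e : seq V).
Hypotheses (gp_lin : lin_closed gp) (gp_g : forall X, gp X -> X \in g).
Hypothesis g0_sg : forall X, g0 X -> g0 (sg X).
Hypothesis gp_br : forall X Y, gp X -> gp Y -> gp (br X Y).
Hypothesis gp_br0 : forall X Y, gp X -> g0 Y -> gp (br X Y).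
Hypothesis g_dec : forall T, T \in g -> exists Tp T0 Tm,
  [/\ gp Tp, g0 T0, gp (sg Tm) & T = Tp + T0 + Tm].
Hypothesis Bs_p0 : forall X Y, gp X -> g0 Y -> Bs X Y = 0.
Hypothesis Bs_pm : forall X Y, gp X -> gp (sg Y) -> Bs X Y = 0.
Hypotheses (oe : orthonormal_seq Bs e) (egp : forall x, x \in e -> gp x).
Hypothesis gpe : forall X, gp X -> X \in <<e>>%VS.

Let Bsb : bilform Bs. Proof. rewrite Bs_def; exact: gkilling_sg_form. Qed.
Let BsC : {in g &, forall X Y, Bs X Y = Bs Y X}.
Proof. rewrite Bs_def; exact: gkilling_sgC. Qed.
Let Bs_sgsg : {in g &, forall X Y, Bs (sg X) (sg Y) = Bs X Y}.
Proof. rewrite Bs_def; exact: gkilling_sg_sgsg. Qed.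
Let Bs_adj : {in g & &, forall X Y Z, Bs (br X Y) Z = - Bs Y (br (sg X) Z)}.
Proof. rewrite Bs_def; exact: gkilling_sg_adj. Qed.
Let eg x : x \in e -> x \in g. Proof. by move/egp/gp_g. Qed.

Let Pp T := \sum_(x <- e) Bs x T *: x.
Let Pm T := sg (Pp (sg T)).
Let P0 T := T - Pp T - Pm T.

Let Ppl : linear Pp.
Proof.
move=> a X Y; rewrite /Pp scaler_sumr -big_split; apply: eq_bigr => x _ /=.
by rewrite (bDr Bsb) (fZr _ _ _ Bsb) scalerDl scalerA.
Qed.
Let Pml : linear Pm. Proof. by move=> a X Y; rewrite /Pm sgl Ppl sgl. Qed.
Let P0l : linear P0.
Proof.
move=> a X Y; rewrite /P0 Ppl Pml !scalerBr !opprD.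
by rewrite [X in X + _ = _]addrACA [LHS]addrACA.
Qed.

Let Pp_gp T : gp (Pp T).
Proof.
rewrite /Pp big_seq; elim/big_rec: _ => [|x y xe py]; first exact: gp_lin.1.
by apply: gp_lin.2 => //; apply: egp.
Qed.
Let Pp_g T : Pp T \in g. Proof. exact/gp_g. Qed.
Let Pm_g T : Pm T \in g. Proof. by rewrite sg_g. Qed.
Let P0_g T : T \in g -> P0 T \in g. Proof. by move=> Tg; rewrite !memvB. Qed.

Let Pp_id T : gp T -> Pp T = T.
Proof.
move=> pT; rewrite [RHS](orthonormal_expand Bsb oe (gpe pT)) /Pp !big_seq.
by apply: eq_bigr => x xe; rewrite (BsC (eg xe) (gp_g pT)).
Qed.
Let Pp_0 T : (forall x, gp x -> Bs x T = 0) -> Pp T = 0.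
Proof. by move=> T0; rewrite /Pp big_seq big1// => x /egp/T0 ->; rewrite scale0r. Qed.

Let P0_g0 T : T \in g -> g0 (P0 T).
Proof.
move=> /g_dec[Tp [T0 [Tm [pTp zT0 pTm ->]]]]; rewrite /P0 /Pm.
rewrite !(lfED sgl) !(lfED Ppl) Pp_id// (Pp_id pTm).
rewrite [Pp T0]Pp_0; last by move=> x px; apply: Bs_p0.
rewrite [Pp Tm]Pp_0; last by move=> x px; apply: Bs_pm.
rewrite [Pp (sg Tp)]Pp_0; last by move=> x px; apply: Bs_pm => //; rewrite sgK.
rewrite [Pp (sg T0)]Pp_0; last by move=> x px; apply: Bs_p0 => //; apply: g0_sg.
by rewrite !addr0 !add0r sgK [X in g0 X]addrAC addrK addrAC subrr add0r.
Qed.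

Let Bs_sg x y : x \in g -> y \in g -> Bs x (sg y) = Bs (sg x) y.
Proof. by move=> xg yg; rewrite -[in RHS](sgK y) Bs_sgsg ?sg_g. Qed.

Let Bs_Pp X Y : X \in g -> Bs (Pp X) Y = \sum_(x <- e) Bs X x * Bs x Y.
Proof.
move=> Xg; rewrite /Pp (b_suml Bsb) !big_seq; apply: eq_bigr => x xe.
by rewrite (fZl _ _ _ Bsb) (BsC Xg) ?eg.
Qed.

Let tr_Pp (F : V -> V) : linear F ->
  vtrace g (Pp \o F) = \sum_(x <- e) Bs x (F x).
Proof.
move=> Fl; rewrite vtrace_sum !big_seq; apply: eq_bigr => x xe.
rewrite (vtrace_rank1 (l := fun T => Bs x (F T))) ?eg// => a T T'.
by rewrite Fl (bDr Bsb) (fZr _ _ _ Bsb).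
Qed.

Let tr_Pm (F : V -> V) : linear F -> {in g, forall T, F T \in g} ->
  vtrace g (Pm \o F) = \sum_(x <- e) Bs x (sg (F (sg x))).
Proof.
move=> Fl Fg; have sF : linear (sg \o F) := linear_comp sgl Fl.
rewrite -[LHS]/(vtrace g (sg \o (Pp \o (sg \o F)))).
rewrite (vtrace_comp sgl (linear_comp Ppl sF) sg_g); last by move=> T _; apply: Pp_g.
by rewrite -[LHS]/(vtrace g (Pp \o ((sg \o F) \o sg))) tr_Pp//; apply: linear_comp.
Qed.

Let tr_dec (F : V -> V) : linear F -> {in g, forall T, F T \in g} ->
  vtrace g F = \sum_(x <- e) Bs x (F x) + \sum_(x <- e) Bs x (sg (F (sg x)))
               + vtrace g (P0 \o F).
Proof.
move=> Fl Fg; rewrite -tr_Pp// -tr_Pm// -!vtraceD; apply: eq_vtrace => T Tg /=.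
by rewrite /P0 -[F T - _ - _]addrA -opprD [RHS]addrC subrK.
Qed.

(** The trace of the compression of ad Y to g_+. It is defined for all [Y] because the argument
    [sg Y, X] occurring later need not preserve g_+. *)
Definition trace_gp Y := \sum_(x <- e) Bs x (br Y x).
Local Notation chi := trace_gp.

Lemma trace_gp_form : scalar chi.
Proof.
move=> a X Y; rewrite /trace_gp mulr_sumr -big_split; apply: eq_bigr => x _ /=.
by rewrite (bDl brb) (bZl brb) (bDr Bsb) (fZr _ _ _ Bsb).
Qed.

Lemma Bs_ad x X Y : x \in g -> X \in g -> Y \in g ->
  Bs x (br X Y) = - Bs (br (sg X) x) Y.
Proof.
by move=> xg Xg Yg; rewrite Bs_adj ?sg_g// sgK opprK.
Qed.

Lemma trace_gp_sg Y : Y \in g -> chi (sg Y) = - chi Y.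
Proof.
move=> Yg; rewrite /trace_gp -sumrN !big_seq; apply: eq_bigr => x /eg xg.
by rewrite Bs_ad ?sg_g// sgK BsC ?br_g.
Qed.

Lemma trace_gp_br X Y : X \in g -> Y \in g -> chi (br X Y) =
  \sum_(x <- e) (Bs (br Y x) (br (sg X) x) * -1) + \sum_(x <- e) Bs (br (sg Y) x) (br X x).
Proof.
move=> Xg Yg; rewrite /trace_gp -big_split !big_seq; apply: eq_bigr => x /eg xg /=.
rewrite jacobi (bBr Bsb) (Bs_ad xg Xg (br_g Yg xg)) (Bs_ad xg Yg (br_g Xg xg)).
by rewrite opprK mulrN1 (BsC (br_g (sg_g Xg) xg) (br_g Yg xg)).
Qed.

(** Here chi is the trace of a commutator of endomorphisms of g_+. Concretely, ad X and ad(sg X) are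
    adjoint up to sign on g_+ and therefore have the same sum of squared coefficients. *)
Lemma trace_gp_br0 X : X \in g -> (forall Y, gp Y -> gp (br X Y)) ->
  (forall Y, gp Y -> gp (br (sg X) Y)) -> chi (br X (sg X)) = 0.
Proof.
move=> Xg pX psX; rewrite trace_gp_br ?sg_g// sgK -mulr_suml mulrN1.
apply/eqP; rewrite addrC subr_eq0; apply/eqP.
transitivity (\sum_(x <- e) \sum_(y <- e) Bs (br X x) y * Bs (br X x) y).
  rewrite !big_seq; apply: eq_bigr => x xe.
  rewrite (parseval _ Bsb oe (gpe (pX _ (egp xe)))) !big_seq; apply: eq_bigr => y ye.
  by rewrite (BsC (eg ye) (br_g Xg (eg xe))).
rewrite exchange_big !big_seq; apply: eq_bigr => y ye /=.
rewrite (parseval _ Bsb oe (gpe (psX _ (egp ye)))) !big_seq; apply: eq_bigr => x xe.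
have [xg yg] := (eg xe, eg ye).
rewrite (BsC xg (br_g (sg_g Xg) yg)) (Bs_adj (sg_g Xg) yg xg) sgK.
by rewrite (BsC yg (br_g Xg xg)) mulrNN.
Qed.

(* Transport by sg turns the trace over the negative part into one over the
   positive part. *)
Lemma gkilling_flat A A' : A \in g -> A' \in g -> sg A = - A -> sg A' = - A' ->
  (forall T, g0 T -> br A' T = 0) ->
  B A A' = 2 * \sum_(x <- e) Bs x (br A (br A' x)).
Proof.
move=> Ag A'g sA sA' A'0; rewrite /gkilling.
have Fl : linear (br A \o br A') := linear_comp (linear_ad A) (linear_ad A').
have Fg : {in g, forall T, (br A \o br A') T \in g}.
  by move=> T Tg /=; rewrite !br_g.
rewrite -/(br A \o br A') (tr_dec Fl Fg).
(* Cyclicity moves [P0] to the right of ad A', which annihilates g_0. *)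
rewrite (vtrace_comp P0l Fl P0_g Fg) [X in _ + X](_ : _ = 0) ?addr0.
  rewrite mulr2n mulrDl mul1r; congr (_ + _); apply: eq_bigr => x _ /=.
  by rewrite !sg_br sgK sA sA' (bNl brb) (bNl brb) (bNr brb) opprK.
rewrite (eq_vtrace (g := fun T => 0 *: T)) ?vtraceZ ?mul0r// => T Tg /=.
by rewrite (A'0 _ (P0_g0 Tg)) (b0r brb) scale0r.
Qed.

(** Three relations tie the sums together: chi([sg Y, X]) = W - U, W = U + K + a0 and Bs X Y = U + W
    + a0. Eliminating [W] and the g_0 contribution [a0] leaves -1/2 U + 1/4 K, the left-hand
    side. *)
Lemma ricci_gp X Y : gp X -> gp Y ->
  \sum_(z <- e) \sum_(m <- e)
    (- 2^-1 * (Bs (br X z) m * Bs (br Y z) m)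
     + 4^-1 * (Bs (br z m) X * Bs (br z m) Y))
  = - 4^-1 * Bs X Y + 2^-1 * chi (br (sg Y) X).
Proof.
move=> pX pY; have [Xg Yg] := (gp_g pX, gp_g pY).
pose U := \sum_(z <- e) Bs (br X z) (br Y z).
pose W := \sum_(z <- e) Bs (br (sg X) z) (br (sg Y) z).
pose K := \sum_(z <- e) \sum_(m <- e) Bs (br z m) X * Bs (br z m) Y.
pose a0 := \sum_(z <- e) Bs (br (sg X) z) (P0 (br (sg Y) z)).
have U_E : \sum_(z <- e) \sum_(m <- e) Bs (br X z) m * Bs (br Y z) m = U.
  rewrite /U !big_seq; apply: eq_bigr => z ze.
  rewrite (parseval _ Bsb oe (gpe (gp_br pX (egp ze)))) !big_seq; apply: eq_bigr => m me.
  by rewrite (BsC (eg me) (br_g Yg (eg ze))).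
have chi_E : chi (br (sg Y) X) = W - U.
  rewrite trace_gp_br ?sg_g// sgK -mulr_suml mulrN1 addrC; congr (_ - _).
(* Split [sg Y, z] into its three components. The g_+ part yields [U] after adjunction and exchange
   of the summations; the part in sigma(g_+) yields [K], because <[X, sg z], m> = <X, [z, m]>. *)
have W_E : W = U + K + a0.
  rewrite -U_E [X in X + _ + _]exchange_big -!big_split /W !big_seq.
  apply: eq_bigr => z ze /=; have zg := eg ze.
  have [TX TY] : br (sg X) z \in g /\ br (sg Y) z \in g by rewrite !br_g ?sg_g.
  set S := br (sg Y) z in TY *.
  have -> : Bs (br (sg X) z) S = Bs (br (sg X) z) (Pp S) + Bs (br (sg X) z) (Pm S)
      + Bs (br (sg X) z) (P0 S).
    by rewrite -!(bDr Bsb) /P0 -[S - _ - _]addrA -opprD [Pp S + _ + _]addrC subrK.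
  congr (_ + _).
  rewrite (BsC TX (Pp_g S)) Bs_Pp// Bs_sg// (BsC (sg_g TX) (Pp_g _)) Bs_Pp ?sg_g//.
  congr (_ + _); rewrite !big_seq; apply: eq_bigr => m me; have mg := eg me.
    rewrite (BsC mg TX) /S (Bs_adj (sg_g Xg) zg mg) (Bs_adj (sg_g Yg) zg mg) !sgK.
    by rewrite (BsC zg (br_g Xg mg)) (BsC zg (br_g Yg mg)) mulrC mulrNN.
  rewrite /S !sg_br !sgK (Bs_adj zg mg Xg) (Bs_adj zg mg Yg) (brC (sg z) X).
  rewrite (brC (sg z) Y) !(bNr Bsb) !opprK (BsC (br_g Yg (sg_g zg)) mg).
  exact: mulrC.
have B_E : Bs X Y = U + W + a0.
  rewrite Bs_def /gkilling_sg gkillingC ?sg_g// /gkilling.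
  have Fl : linear (br (sg Y) \o br X) := linear_comp (linear_ad _) (linear_ad _).
  have Fg : {in g, forall T, (br (sg Y) \o br X) T \in g}.
    by move=> T Tg /=; rewrite !br_g ?sg_g.
  rewrite -/(br (sg Y) \o br X) (tr_dec Fl Fg) !opprD; congr (_ + _ + _).
  - rewrite /U -sumrN !big_seq; apply: eq_bigr => z /eg zg /=.
    rewrite (Bs_ad zg (sg_g Yg) (br_g Xg zg)) sgK opprK.
    by rewrite (BsC (br_g Yg zg) (br_g Xg zg)).
  - rewrite /W -sumrN !big_seq; apply: eq_bigr => z /eg zg /=.
    rewrite !sg_br !sgK (Bs_ad zg Yg) ?br_g ?sg_g// opprK.
    by rewrite BsC ?br_g ?sg_g.
  (* Since [X, g_0] lies in g_+, [Pp] may be inserted in front of ad X; cyclicity then turns the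
     trace over g_0 into a sum over [e]. *)
  - have QXl : linear (Pp \o (br X \o P0)).
      exact: linear_comp Ppl (linear_comp (linear_ad _) P0l).
    have QXg : {in g, forall T, (Pp \o (br X \o P0)) T \in g}.
      by move=> T _ /=; apply: Pp_g.
    rewrite (vtrace_comp P0l Fl P0_g Fg).
    rewrite (eq_vtrace (g := br (sg Y) \o (Pp \o (br X \o P0)))); last first.
      by move=> T Tg /=; rewrite [Pp _]Pp_id//; apply: gp_br0 => //; apply: P0_g0.
    rewrite (vtrace_comp (linear_ad _) QXl (ad_g (sg_g Yg)) QXg).
    rewrite -[vtrace g _]/(vtrace g (Pp \o ((br X \o P0) \o br (sg Y)))).
    rewrite tr_Pp; last by apply: linear_comp (linear_comp _ P0l) _; apply: linear_ad.
    rewrite /a0 -sumrN !big_seq; apply: eq_bigr => z /eg zg /=.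
    by rewrite (Bs_ad zg Xg) ?opprK// P0_g ?br_g ?sg_g.
have -> : \sum_(z <- e) \sum_(m <- e)
    (- 2^-1 * (Bs (br X z) m * Bs (br Y z) m)
     + 4^-1 * (Bs (br z m) X * Bs (br z m) Y)) = - 2^-1 * U + 4^-1 * K.
  rewrite -U_E /K !mulr_sumr -big_split; apply: eq_bigr => z _.
  by rewrite !mulr_sumr -big_split.
by rewrite chi_E B_E W_E; field.
Qed.

End Graded.
End KillingForm.

(** * Quaternions, conjugate transpose and traces *)

Section QuaternionMatrices.
Variable R : realType.
Implicit Types (s : R) (x y : quat R).

Lemma quat_eq x y : q0 x = q0 y -> q1 x = q1 y -> q2 x = q2 y -> q3 x = q3 y -> x = y.
Proof. by case: x y => [? ? ? ?] [? ? ? ?] /= -> -> -> ->. Qed.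

Lemma q0D x y : q0 (x + y) = q0 x + q0 y. Proof. by []. Qed.
Lemma q0_sum I (t : seq I) (P : pred I) (f : I -> quat R) :
  q0 (\sum_(i <- t | P i) f i) = \sum_(i <- t | P i) q0 (f i).
Proof. by elim/big_rec2: _ => // i a b _ <-. Qed.
Lemma q0M x y : q0 (x * y) = q0 (y * x).
Proof. by rewrite /=; ring. Qed.

Lemma realq_zmod : zmod_morphism (@realq R).
Proof. by move=> s t; apply: quat_eq; rewrite /= ?oppr0 ?addr0. Qed.
Lemma realq_monoid : monoid_morphism (@realq R).
Proof. by split=> // s t; apply: quat_eq => /=; ring. Qed.
HB.instance Definition _ := GRing.isZmodMorphism.Build R (quat R) (@realq R) realq_zmod.
HB.instance Definition _ := GRing.isMonoidMorphism.Build R (quat R) (@realq R) realq_monoid.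

Lemma realqZ s x : realq s * x = s *: x.
Proof. by apply: quat_eq => /=; ring. Qed.
Lemma realqC s x : realq s * x = x * realq s.
Proof. by apply: quat_eq => /=; ring. Qed.

Lemma conjqK : involutive (@conjq R).
Proof. by move=> x; apply: quat_eq; rewrite /= ?opprK. Qed.
Lemma conjq_zmod : zmod_morphism (@conjq R).
Proof. by move=> x y; apply: quat_eq => /=; ring. Qed.
HB.instance Definition _ := GRing.isZmodMorphism.Build (quat R) (quat R) (@conjq R) conjq_zmod.
Lemma conjqD x y : conjq (x + y) = conjq x + conjq y. Proof. exact: raddfD. Qed.
Lemma conjqN x : conjq (- x) = - conjq x. Proof. exact: raddfN. Qed.
Lemma conjq0 : conjq 0 = 0 :> quat R. Proof. exact: raddf0. Qed.
Lemma conjq_sum I (t : seq I) (P : pred I) (f : I -> quat R) :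
  conjq (\sum_(i <- t | P i) f i) = \sum_(i <- t | P i) conjq (f i).
Proof. exact: raddf_sum. Qed.
Lemma conjqM x y : conjq (x * y) = conjq y * conjq x.
Proof. by apply: quat_eq => /=; ring. Qed.
Lemma conjqZ s x : conjq (s *: x) = s *: conjq x.
Proof. by apply: quat_eq => /=; ring. Qed.
Lemma conj_realq s : conjq (realq s) = realq s.
Proof. by apply: quat_eq => /=; ring. Qed.

Lemma normq_ge0 x : 0 <= q0 (x * conjq x).
Proof. by rewrite /=; nra. Qed.
Lemma normq_eq0 x : q0 (x * conjq x) = 0 -> x = 0.
Proof.
rewrite /= => n0; have sq (t : R) : 0 <= t * t by rewrite -expr2 sqr_ge0.
have sq0 (t : R) : t * t <= 0 -> t = 0.
  move=> t0; have : t * t == 0 by rewrite eq_le t0 sq.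
  by rewrite mulf_eq0 orbb => /eqP.
have := (sq (q0 x), sq (q1 x), sq (q2 x), sq (q3 x)) => -[[[s0 s1] s2] s3].
by apply: quat_eq; apply: sq0; lra.
Qed.

Variable F : base_field.
Lemma in_field0 : in_field F (0 : quat R). Proof. by case: F. Qed.
Lemma in_fieldD x y : in_field F x -> in_field F y -> in_field F (x + y).
Proof.
case: F => //=; first by case=> -> -> -> [-> -> ->]; rewrite addr0.
by case=> -> -> [-> ->]; rewrite addr0.
Qed.
Lemma in_fieldM x y : in_field F x -> in_field F y -> in_field F (x * y).
Proof.
case: F => //=; first by case=> -> -> -> [-> -> ->]; split; ring.
by case=> -> -> [-> ->]; split; ring.
Qed.
Lemma in_field_real s : in_field F (realq s). Proof. by case: F. Qed.
Lemma in_fieldZ s x : in_field F x -> in_field F (s *: x).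
Proof. by rewrite -realqZ; apply: in_fieldM; apply: in_field_real. Qed.
Lemma in_fieldN x : in_field F x -> in_field F (- x).
Proof. by rewrite -scaleN1r; apply: in_fieldZ. Qed.
Lemma in_field_conj x : in_field F x -> in_field F (conjq x).
Proof.
case: F => //=; first by case=> -> -> ->; rewrite oppr0.
by case=> -> ->; rewrite oppr0.
Qed.
Lemma in_field_comm x y : F = ComplexF -> in_field F x -> in_field F y -> x * y = y * x.
Proof.
move=> -> /= [x2 x3] [y2 y3]; apply: quat_eq; rewrite /= x2 x3 y2 y3; ring.
Qed.
Lemma in_field_sum I (t : seq I) (P : pred I) (f : I -> quat R) :
  (forall i, P i -> in_field F (f i)) -> in_field F (\sum_(i <- t | P i) f i).
Proof. by move=> Ff; elim/big_ind: _ => //; [exact: in_field0 | exact: in_fieldD]. Qed.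

Lemma mx_overM m n k (A : 'M[quat R]_(m, n)) (B : 'M_(n, k)) :
  mx_over F A -> mx_over F B -> mx_over F (A *m B).
Proof. by move=> FA FB i j; rewrite mxE; apply: in_field_sum => l _; apply: in_fieldM. Qed.

Lemma ctr_mul m n k (A : 'M[quat R]_(m, n)) (B : 'M_(n, k)) :
  ctr (A *m B) = ctr B *m ctr A.
Proof.
apply/matrixP=> i j; rewrite !mxE conjq_sum; apply: eq_bigr => l _.
by rewrite !mxE conjqM.
Qed.
Lemma ctrK m n : cancel (@ctr R m n) (@ctr R n m).
Proof. by move=> A; apply/matrixP=> i j; rewrite !mxE conjqK. Qed.

Lemma mxtrace_comm n (A B : 'M[quat R]_n) :
  (forall i j, A i j * B j i = B j i * A i j) -> \tr (A *m B) = \tr (B *m A).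
Proof.
move=> AB; rewrite /mxtrace; under eq_bigr do rewrite mxE.
rewrite exchange_big; apply: eq_bigr => i _; rewrite mxE.
by apply: eq_bigr => j _; rewrite AB.
Qed.
(** Over the quaternions the trace is not cyclic, but its real part is; this is why the comparison
    form below takes real parts. *)
Lemma q0_mxtraceC n (A B : 'M[quat R]_n) : q0 (\tr (A *m B)) = q0 (\tr (B *m A)).
Proof.
rewrite /mxtrace !q0_sum; under eq_bigr do rewrite mxE q0_sum.
rewrite exchange_big; apply: eq_bigr => i _; rewrite mxE q0_sum.
by apply: eq_bigr => j _; rewrite q0M.
Qed.

Lemma q0_mxtrace_comm n (A B C : 'M[quat R]_n) :
  q0 (\tr ((A *m B - B *m A) *m C)) = - q0 (\tr (B *m (A *m C - C *m A))).
Proof.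
have q0B (D E : 'M[quat R]_n) : q0 (\tr (D - E)) = q0 (\tr D) - q0 (\tr E).
  by rewrite (raddfB (@mxtrace _ n)).
rewrite mulmxBl mulmxBr 2!q0B opprB -2!mulmxA; congr (_ - _).
by rewrite (q0_mxtraceC A) -mulmxA.
Qed.

End QuaternionMatrices.

(** * The Lie algebra g and its restricted roots *)

Section WeightBasis.
Variables (R : realType) (p r : nat).
Local Notation n := (p + (p + r))%N.
Local Notation T := ('I_p + ('I_p + 'I_r))%type.
Local Notation V := (hmx R n).

(* An index set for the three diagonal blocks of sizes p, p, r. *)
Definition ix (t : T) : 'I_n :=
  match t with
  | inl i => lshift _ i
  | inr (inl i) => rshift p (lshift r i)
  | inr (inr j) => rshift p (rshift p j)
  end.

Definition xi (k : 'I_n) : T :=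
  match split k with
  | inl i => inl i
  | inr k' => match split k' with inl i => inr (inl i) | inr j => inr (inr j) end
  end.

Lemma ixK : cancel ix xi.
Proof.
case=> [i|[i|j]]; rewrite /xi /= -/(unsplit (inl _)) -/(unsplit (inr _)).
- by rewrite (unsplitK (inl i)).
- by rewrite (unsplitK (inr (lshift r i))) (unsplitK (inl i)).
- by rewrite (unsplitK (inr (rshift p j))) (unsplitK (inr j)).
Qed.

Lemma xiK : cancel xi ix.
Proof.
move=> k; rewrite /xi -[k in RHS]splitK; case: (split k) => //= k'.
by rewrite -[k' in RHS]splitK; case: (split k').
Qed.

(** In the eigenbasis of a this exchanges the weights omega_i and -omega_i and fixes the vectors of
    weight 0. *)
Definition bar (t : T) : T :=
  match t with
  | inl i => inr (inl i)
  | inr (inl i) => inl i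
  | inr (inr j) => inr (inr j)
  end.

Lemma barK : involutive bar. Proof. by case=> [i|[i|j]]. Qed.

(** In the eigenbasis the signature matrix pairs [t] with [bar t], with value [eps t]: p hyperbolic
    planes and a negative definite block. *)
Definition eps (t : T) : R := if t is inr (inr _) then -1 else 1.

Definition lam (t : T) : 'rV[R]_p :=
  match t with
  | inl i => omega R p i
  | inr (inl i) => - omega R p i
  | inr (inr _) => 0
  end.

Lemma lam_bar t : lam (bar t) = - lam t.
Proof. by case: t => [i|[i|j]] /=; rewrite ?opprK ?oppr0. Qed.

Lemma eps_bar t : eps (bar t) = eps t. Proof. by case: t => [i|[i|j]]. Qed.
Lemma eps_sq t : eps t * eps t = 1.
Proof. by case: t => [i|[i|j]]; rewrite /= ?mulr1 ?mulrNN ?mulr1. Qed.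

(** With c = 1/sqrt 2, the eigenvectors of a are c (e_i + e_(p+i)), c (e_i - e_(p+i)) and the last r
    basis vectors. [s0] is the diagonal coefficient and [s1] the one towards [bar t]. *)
Let c : R := (Num.sqrt 2)^-1.
Let cc : c * c = 2^-1.
Proof. by rewrite -invfM -expr2 sqr_sqrtr ?ler0n. Qed.

Let s0 (t : T) : R := match t with inl _ => c | inr (inl _) => - c | inr (inr _) => 1 end.
Let s1 (t : T) : R := if t is inr (inr _) then 0 else c.

Lemma sum_ix (W : nmodType) (G : 'I_n -> W) : \sum_k G k = \sum_(t : T) G (ix t).
Proof. by apply: reindex; exists xi => k _; [apply: ixK | apply: xiK]. Qed.

Lemma sum_delta (W : lmodType R) (G : T -> W) u : \sum_t (t == u)%:R *: G t = G u.
Proof.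
rewrite (bigD1 u)//= eqxx scale1r big1 ?addr0// => t /negPf ->.
by rewrite scale0r.
Qed.

Lemma eq_ix (K : Type) (A B : 'M[K]_n) :
  (forall u v, A (ix u) (ix v) = B (ix u) (ix v)) -> A = B.
Proof.
by move=> AB; apply/matrixP=> i j; rewrite -[i]xiK -[j]xiK.
Qed.

(* The symmetric orthogonal matrix diagonalising the elements of a. *)
Definition eigmx : 'M[quat R]_n := \matrix_(i, j)
  realq (s0 (xi i) * (xi j == xi i)%:R + s1 (xi i) * (xi j == bar (xi i))%:R).
Local Notation S := eigmx.

Lemma eigmxE u v :
  S (ix u) (ix v) = realq (s0 u * (v == u)%:R + s1 u * (v == bar u)%:R).
Proof. by rewrite mxE !ixK. Qed.

Lemma eigmx_real i j : S i j = realq (q0 (S i j)).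
Proof. by rewrite mxE. Qed.

Lemma mul_eigmx m (A : 'M[quat R]_(n, m)) u j : (S *m A) (ix u) j =
  s0 u *: A (ix u) j + s1 u *: A (ix (bar u)) j.
Proof.
rewrite mxE sum_ix.
under eq_bigr do rewrite eigmxE realqZ scalerDl -!scalerA.
by rewrite big_split /= -!scaler_sumr !sum_delta.
Qed.

Lemma eigmx_sym u v : S (ix u) (ix v) = S (ix v) (ix u).
Proof.
rewrite !eigmxE; congr realq; rewrite (eq_sym v u) (eq_sym v (bar u)) (can2_eq barK barK).
congr (_ + _); last first.
  by have [->|] := eqVneq u (bar v); rewrite ?mulr0//; case: v => [?|[?|?]].
by have [->|] := eqVneq u v; rewrite ?mulr0.
Qed.

Lemma mul_mx_eigmx m (A : 'M[quat R]_(m, n)) i v : (A *m S) i (ix v) =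
  s0 v *: A i (ix v) + s1 v *: A i (ix (bar v)).
Proof.
rewrite mxE sum_ix.
under eq_bigr do rewrite eigmx_sym eigmxE -realqC realqZ scalerDl -!scalerA.
by rewrite big_split /= -!scaler_sumr !sum_delta.
Qed.

Lemma eigmxK : S *m S = 1%:M.
Proof.
apply: eq_ix => u v; rewrite mul_eigmx !eigmxE mxE (inj_eq (can_inj ixK)).
rewrite barK -!realqZ -!rmorphM -rmorphD -(rmorph_nat (@realq R)); congr realq.
transitivity ((s0 u * s0 u + s1 u * s1 (bar u)) * (v == u)%:R +
              (s0 u * s1 u + s1 u * s0 (bar u)) * (v == bar u)%:R); first by ring.
have -> : s0 u * s0 u + s1 u * s1 (bar u) = 1.
  by case: u => [i|[i|i]] /=; rewrite ?mulrNN ?cc ?mul0r ?mulr1 ?addr0//; field.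
have -> : s0 u * s1 u + s1 u * s0 (bar u) = 0.
  by case: u => [i|[i|i]] /=; ring.
by rewrite mul0r addr0 mul1r eq_sym.
Qed.

Lemma ctr_eigmx : ctr S = S.
Proof. by apply: eq_ix => u v; rewrite /ctr 2!mxE eigmx_sym eigmxE conj_realq. Qed.

(* Entries in an eigenbasis of a, where (u, v) has weight lam u - lam v. Locked:
   unifying two entries must not compare the matrix products. *)
Definition ent : V -> T -> T -> quat R :=
  locked (fun X u v => (S *m (X : 'M_n) *m S) (ix u) (ix v)).
Definition unent (G : T -> T -> quat R) : V :=
  S *m (\matrix_(i, j) G (xi i) (xi j)) *m S.

Lemma ent_def X u v : ent X u v = (S *m (X : 'M_n) *m S) (ix u) (ix v).
Proof. by rewrite /ent -lock. Qed.

Lemma entE X u v : ent X u v =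
  s0 v *: (s0 u *: X (ix u) (ix v) + s1 u *: X (ix (bar u)) (ix v)) +
  s1 v *: (s0 u *: X (ix u) (ix (bar v)) + s1 u *: X (ix (bar u)) (ix (bar v))).
Proof. by rewrite ent_def mul_mx_eigmx !mul_eigmx. Qed.

Lemma unentK G u v : ent (unent G) u v = G u v.
Proof.
rewrite ent_def /unent !mulmxA eigmxK mul1mx -mulmxA eigmxK mulmx1.
by rewrite mxE !ixK.
Qed.

Lemma ent_inj X Y : (forall u v, ent X u v = ent Y u v) -> X = Y.
Proof.
move=> XY; have XYS : S *m (X : 'M_n) *m S = S *m (Y : 'M_n) *m S.
  by apply: eq_ix => u v; rewrite -!ent_def.
have K (Z : 'M_n) : S *m (S *m Z *m S) *m S = Z.
  by rewrite !mulmxA eigmxK mul1mx -mulmxA eigmxK mulmx1.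
by rewrite -(K X) XYS K.
Qed.

Lemma entD X Y u v : ent (X + Y) u v = ent X u v + ent Y u v.
Proof. by rewrite !ent_def mulmxDr mulmxDl mxE. Qed.
Lemma entN X u v : ent (- X) u v = - ent X u v.
Proof. by rewrite !ent_def mulmxN mulNmx mxE. Qed.
Lemma entZ a X u v : ent (a *: X) u v = a *: ent X u v.
Proof.
rewrite !entE !mxE; do ![rewrite scalerDr]; rewrite !scalerA.
by do !congr (_ + _); congr (_ *: _); ring.
Qed.
Lemma ent0 u v : ent 0 u v = 0.
Proof. by rewrite -(scale0r 0) entZ scale0r. Qed.
Lemma entB X Y u v : ent (X - Y) u v = ent X u v - ent Y u v.
Proof. by rewrite entD entN. Qed.
Lemma entM X Y u v : ent (X *m Y) u v = \sum_t ent X u t * ent Y t v.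
Proof.
have -> : ent (X *m Y) u v =
    ((S *m (X : 'M_n) *m S) *m (S *m (Y : 'M_n) *m S)) (ix u) (ix v).
  rewrite ent_def !mulmxA -[_ *m S *m S]mulmxA eigmxK mulmx1.
  by [].
rewrite mxE sum_ix; apply: eq_bigr => t _; by rewrite -!ent_def.
Qed.
Lemma ent_ctr X u v : ent (ctr X) u v = conjq (ent X v u).
Proof.
have -> : ent (ctr X) u v = ctr (S *m (X : 'M_n) *m S) (ix u) (ix v).
  by rewrite !ctr_mul !ctr_eigmx ent_def mulmxA.
by rewrite /ctr 2!mxE -ent_def.
Qed.

Lemma form_evalD (al be d : 'rV[R]_p) :
  form_eval (al + be) d = form_eval al d + form_eval be d.
Proof. by rewrite -big_split; apply: eq_bigr => i _; rewrite mxE mulrDl. Qed.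
Lemma form_evalN (al d : 'rV[R]_p) : form_eval (- al) d = - form_eval al d.
Proof. by rewrite -sumrN; apply: eq_bigr => i _; rewrite mxE mulNr. Qed.
Lemma form_evalB (al be d : 'rV[R]_p) :
  form_eval (al - be) d = form_eval al d - form_eval be d.
Proof. by rewrite form_evalD form_evalN. Qed.
Lemma form_eval0 (d : 'rV[R]_p) : form_eval 0 d = 0.
Proof. by rewrite /form_eval big1// => i _; rewrite mxE mul0r. Qed.
Lemma form_eval_omega (i : 'I_p) (d : 'rV[R]_p) : form_eval (omega R p i) d = d 0 i.
Proof.
rewrite /form_eval (bigD1 i)//= mxE eqxx mul1r big1 ?addr0// => j ji.
by rewrite mxE (inj_eq val_inj) (negPf ji) mul0r.
Qed.
Lemma form_eval_lin (al : 'rV[R]_p) : scalar (form_eval al).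
Proof.
move=> a d d'; rewrite /form_eval mulr_sumr -big_split; apply: eq_bigr => i _ /=.
by rewrite !mxE; ring.
Qed.

Let blockE := (block_mxEul, block_mxEur, block_mxEdl, block_mxEdr, col_mxEu,
  col_mxEd, row_mxEl, row_mxEr).

Let coor (d : 'rV[R]_p) (t : T) : R :=
  match t with inl i | inr (inl i) => d 0 i | inr (inr _) => 0 end.

Lemma amxE (d : 'rV[R]_p) u v : amx r d (ix u) (ix v) =
  (v == bar u)%:R *: realq (coor d u).
Proof.
rewrite /amx; case: u => [i|[i|i]]; case: v => [j|[j|j]];
  rewrite /ix /= !blockE ?mxE ?scale0r ?scaler0 //.
- rewrite -[inr _ == _]/(j == i) (eq_sym j).
  by case: eqVneq => _; rewrite ?scale1r ?scale0r.
- rewrite -[inl _ == _]/(j == i) (eq_sym j).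
  by case: eqVneq => _; rewrite ?scale1r ?scale0r.
Qed.

Lemma ent_amx (d : 'rV[R]_p) u v : ent (amx r d) u v = (u == v)%:R *: realq (form_eval (lam u) d).
Proof.
rewrite entE !amxE !barK -!realqZ -!(rmorphM, rmorphD).
congr realq.
rewrite (inj_eq (can_inj barK)) (can2_eq barK barK) (eq_sym u v).
have -> : coor d (bar u) = coor d u by case: (u) => [?|[?|?]].
transitivity ((s0 u * s1 v + s1 u * s0 v) * (v == u)%:R * coor d u +
              (s0 u * s0 v + s1 u * s1 v) * (v == bar u)%:R * coor d u); first by ring.
case: u => [i|[i|j]]; last by rewrite /= form_eval0; ring.
- have -> : (s0 (inl i) * s0 v + s1 (inl i) * s1 v) * (v == bar (inl i))%:R = 0.
    by case: eqVneq => [->|_] /=; ring.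
  have [->|_] := eqVneq v (inl i); last by rewrite /= mulr0n; ring.
  by rewrite /= form_eval_omega cc; field.
- have -> : (s0 (inr (inl i)) * s0 v + s1 (inr (inl i)) * s1 v) *
      (v == bar (inr (inl i)))%:R = 0 by case: eqVneq => [->|_] /=; ring.
  have [->|_] := eqVneq v (inr (inl i)); last by rewrite /= mulr0n; ring.
  by rewrite /= form_evalN form_eval_omega mulrN mulNr cc; field.
Qed.

(** The constant is 2/sqrt 2. In the eigenbasis only the entries of weight omega_i survive, one for
    [C] and one for its conjugate. *)
Lemma ent_wmx : exists2 k : R, k != 0 & forall (C : 'M[quat R]_(p, r)) u v,
  ent (wmx C) u v = match u, v with
  | inl i, inr (inr j) => k *: C i j
  | inr (inr j), inr (inl i) => k *: conjq (C i j)
  | _, _ => 0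
  end.
Proof.
exists (2 * c); first by rewrite mulf_neq0 ?pnatr_eq0// invr_neq0// gt_eqF// sqrtr_gt0 ltr0n.
move=> C u v; have W (s t : T) : wmx C (ix s) (ix t) = match s, t with
  | inl i, inr (inr j) | inr (inl i), inr (inr j) => C i j
  | inr (inr j), inl i => conjq (C i j)
  | inr (inr j), inr (inl i) => - conjq (C i j)
  | _, _ => 0
  end.
  by rewrite /wmx; case: s => [i|[i|i]]; case: t => [j|[j|j]];
    rewrite /ix !blockE ?mxE.
rewrite entE !W; case: u => [i|[i|i]]; case: v => [j|[j|j]] /=;
  rewrite ?(scaler0, scale0r, addr0, add0r, scale1r, scalerN, scaleNr, opprK, subrr, addNr)//;
  by rewrite mulrDl mul1r scalerDl.
Qed.

Let mu (t : T) : R := if t is inl _ then 1 else -1.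

Lemma signature_mxE u v :
  signature_mx R p r (ix u) (ix v) = (v == u)%:R *: realq (mu u).
Proof.
have rqb (b : bool) : b%:R = realq b%:R :> quat R by rewrite rmorph_nat.
rewrite /signature_mx; case: u => [i|i]; case: v => [j|j];
  rewrite ?[_ == _ :> T]/(j == i) ?[_ == _ :> T]/false ?scale0r.
- by rewrite /ix block_mxEul mxE eq_sym rqb -realqZ -rmorphM mulr1.
- by case: j => j; rewrite /ix block_mxEur mxE.
- by case: i => i; rewrite /ix block_mxEdl mxE.
- have E (k l : 'I_(p + r)) :
      (block_mx 1%:M 0 0 (- 1%:M) : 'M[quat R]_n) (rshift p k) (rshift p l) =
      realq (- (k == l)%:R).
    by rewrite block_mxEdr !mxE rqb -rmorphN.
  rewrite -realqZ -rmorphM mulrN1.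
  case: i j => i [] j; rewrite [LHS]E ?eq_lshift ?eq_rshift ?eq_lrshift ?eq_rlshift;
    by rewrite 1?eq_sym.
Qed.

Lemma ent_signature u v :
  ent (signature_mx R p r) u v = (v == bar u)%:R *: realq (eps u).
Proof.
rewrite entE !signature_mxE -!realqZ -!(rmorphM, rmorphD); congr realq.
rewrite (inj_eq (can_inj barK)) (can2_eq barK barK).
case: u => [i|[i|j]]; last first.
- by rewrite /=; case: eqVneq => [->|_] /=; ring.
- have [->|_] := eqVneq v (inr (inl i)); first by rewrite /=; ring.
  have [->|_] := eqVneq v (bar (inr (inl i))); last by rewrite /= !mulr0n; ring.
  by transitivity (2 * (c * c)); [rewrite /=; ring | rewrite cc /=; field].
- have [->|_] := eqVneq v (inl i); first by rewrite /=; ring.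
  have [->|_] := eqVneq v (bar (inl i)); last by rewrite /= !mulr0n; ring.
  by transitivity (2 * (c * c)); [rewrite /=; ring | rewrite cc /=; field].
Qed.

Variable F : base_field.

(** The conditions defining g, read in the eigenbasis. As the signature matrix pairs [t] with
    [bar t] there, A M = -M A^* becomes a symmetry under (u, v) -> (bar v, bar u). *)
Definition ent_g (X : V) := [/\ forall u v, in_field F (ent X u v),
  forall u v, ent X u v = - (eps u * eps v) *: conjq (ent X (bar v) (bar u)) &
  F = ComplexF -> \sum_u ent X u u = 0].

Lemma lin_closed_ent_g : lin_closed ent_g.
Proof.
split=> [|a X Y [FX sX tX] [FY sY tY]]; split.
- by move=> u v; rewrite ent0; apply: in_field0.
- by move=> u v; rewrite !ent0 conjq0 scaler0.
- by move=> _; rewrite big1// => u _; rewrite ent0.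
- by move=> u v; rewrite entD entZ; apply: in_fieldD => //; apply: in_fieldZ.
- move=> u v; rewrite !entD !entZ [in LHS]sX [in LHS]sY conjqD conjqZ scalerDr.
  by rewrite !scalerA (mulrC a).
- move=> FC; under eq_bigr do rewrite entD entZ.
  by rewrite big_split -scaler_sumr /= tX// tY// scaler0 addr0.
Qed.

(** Conjugation can change a quaternionic trace; the matrix [S] is real, so its entries commute with
    all others. *)
Lemma mxtrace_ent X : \tr (X : 'M_n) = \sum_u ent X u u.
Proof.
under eq_bigr do rewrite ent_def.
rewrite -(sum_ix (fun k => (S *m (X : 'M_n) *m S) k k)) -/(\tr _) mxtrace_comm.
  by rewrite mulmxA eigmxK mul1mx.
by move=> i j; rewrite [S j i]eigmx_real realqC.
Qed.

Lemma mx_over_ent X : mx_over F (X : 'M_n) <-> forall u v, in_field F (ent X u v).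
Proof.
have FS : mx_over F S by move=> i j; rewrite eigmx_real; apply: in_field_real.
split=> [FX u v|FX]; first by rewrite ent_def; apply: mx_overM => //; apply: mx_overM.
have -> : (X : 'M_n) = S *m (S *m (X : 'M_n) *m S) *m S.
  by rewrite !mulmxA eigmxK mul1mx -mulmxA eigmxK mulmx1.
apply: mx_overM => //; apply: mx_overM => // i j.
by rewrite -[i]xiK -[j]xiK -ent_def; apply: FX.
Qed.

Lemma signature_ent X :
  (X : 'M_n) *m signature_mx R p r = - (signature_mx R p r *m ctr X) <->
  forall u v, ent X u v = - (eps u * eps v) *: conjq (ent X (bar v) (bar u)).
Proof.
have EL u v : ent (X *m signature_mx R p r) u (bar v) = eps v *: ent X u v.
  rewrite entM -[RHS](sum_delta (fun t => eps v *: ent X u t)).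
  apply: eq_bigr => t _; rewrite ent_signature (inj_eq (can_inj barK)) eq_sym.
  have [->|_] := eqVneq t v; last by rewrite !scale0r mulr0.
  by rewrite !scale1r -realqC realqZ.
have ER u v : ent (signature_mx R p r *m ctr X) u (bar v) =
    eps u *: conjq (ent X (bar v) (bar u)).
  rewrite entM -[RHS](sum_delta (fun t => eps u *: conjq (ent X (bar v) t))).
  apply: eq_bigr => t _; rewrite ent_signature ent_ctr.
  by rewrite -scalerAl realqZ.
split=> [XM u v|sX].
  have := congr1 (fun Y : V => eps v *: ent Y u (bar v)) XM.
  rewrite EL scalerA eps_sq scale1r => ->.
  rewrite [ent _ _ _]entN ER scalerN scalerA scaleNr.
  by rewrite mulrC.
apply: ent_inj => u v; rewrite -[v]barK EL [in RHS]entN ER sX scalerA.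
by rewrite mulrN scaleNr mulrCA eps_sq mulr1.
Qed.

Lemma mem_g X : X \in g_ R F p r <-> ent_g X.
Proof.
have E Y : [/\ mx_over F (Y : 'M_n), (Y : 'M_n) *m signature_mx R p r =
      - (signature_mx R p r *m ctr Y) & F = ComplexF -> \tr (Y : 'M_n) = 0] <-> ent_g Y.
  by split=> -[FY /signature_ent sY]; rewrite mxtrace_ent => tY; split=> //;
    apply/mx_over_ent.
have Pl : lin_closed (fun Y : V => [/\ mx_over F (Y : 'M_n), (Y : 'M_n) *m signature_mx R p r =
      - (signature_mx R p r *m ctr Y) & F = ComplexF -> \tr (Y : 'M_n) = 0]).
  split=> [|a Y Z /E EY /E EZ]; apply/E; first exact: lin_closed_ent_g.1.
  exact: lin_closed_ent_g.2.
by rewrite -E; split=> [/(mem_lspan Pl)//|]; apply: memv_lspan.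
Qed.

End WeightBasis.

Lemma zmod_jacobi (W : zmodType) (a b c d e f : W) :
  a - b - (c - d) = a - e - (f - d) - (b - f - (e - c)).
Proof.
have E (x y z : W) : x - y + (y - z) = x - z by rewrite addrA subrK.
rewrite !opprB [RHS]addrACA !E [LHS]addrACA [RHS]addrACA.
by rewrite (addrC (- b)).
Qed.

(** * The bracket and the Cartan involution on g *)

Section LieAlgebra.
Variables (R : realType) (F : base_field) (p r : nat).
Local Notation n := (p + (p + r))%N.
Local Notation T := ('I_p + ('I_p + 'I_r))%type.
Local Notation V := (hmx R n).
Local Notation br := (@comm_br R p r).
Local Notation sg := (@cartan_inv R p r).
Local Notation g := (g_ R F p r).
Implicit Types X Y Z : V.

Lemma hmx_mulZl a X Y : (a *: X) *m (Y : 'M_n) = (a *: ((X *m Y) : V)) :> 'M_n.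
Proof.
apply/matrixP=> i j; rewrite !mxE scaler_sumr; apply: eq_bigr => k _.
by rewrite mxE scalerAl.
Qed.
Lemma hmx_mulZr a X Y : (X : 'M_n) *m (a *: Y) = (a *: ((X *m Y) : V)) :> 'M_n.
Proof.
apply/matrixP=> i j; rewrite !mxE scaler_sumr; apply: eq_bigr => k _.
by rewrite mxE scalerAr.
Qed.

Lemma comm_br_antisym X Y : br X Y = - br Y X.
Proof. by rewrite /comm_br opprB. Qed.

Lemma comm_br_linl Z : linear (br^~ Z).
Proof.
move=> a X Y; rewrite /comm_br mulmxDl mulmxDr hmx_mulZl hmx_mulZr scalerBr opprD.
exact: addrACA.
Qed.

Lemma comm_br_bilin : bilin br.
Proof.
split=> [|Z a X Y]; first exact: comm_br_linl.
rewrite (comm_br_antisym Z (_ + _)) comm_br_linl.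
by rewrite (comm_br_antisym Z X) (comm_br_antisym Z Y) scalerN opprD.
Qed.

Lemma comm_br_jacobi X Y Z : br (br X Y) Z = br X (br Y Z) - br Y (br X Z).
Proof.
rewrite /comm_br !mulmxBl !mulmxBr !mulmxA.
set a := X *m Y *m Z; set b := Y *m X *m Z; set c := Z *m X *m Y; set d := Z *m Y *m X.
set e := X *m Z *m Y; set f := Y *m Z *m X.
exact: (zmod_jacobi (a : V) b c d e f).
Qed.

Lemma ent_br X Y u v : ent (br X Y) u v =
  \sum_t ent X u t * ent Y t v - \sum_t ent Y u t * ent X t v.
Proof. by rewrite /comm_br -!entM -entB. Qed.

Lemma cartan_inv_lin : linear sg.
Proof. by move=> a X Y; apply: ent_inj => u v; rewrite !(entD, entZ, entN, ent_ctr) conjqD conjqZ opprD scalerN. Qed.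

Lemma cartan_invK : involutive sg.
Proof. by move=> X; rewrite /cartan_inv; apply: ent_inj => u v; rewrite !(entN, ent_ctr) conjqN opprK conjqK. Qed.

Lemma ent_sg X u v : ent (sg X) u v = - conjq (ent X v u).
Proof. by rewrite entN ent_ctr. Qed.

Lemma cartan_inv_br X Y : sg (br X Y) = br (sg X) (sg Y).
Proof.
apply: ent_inj => u v; rewrite ent_sg !ent_br conjqD conjqN opprB.
have E (A B : V) : \sum_t ent (sg A) u t * ent (sg B) t v = conjq (\sum_t ent B v t * ent A t u).
  rewrite conjq_sum; apply: eq_bigr => t _.
  by rewrite !ent_sg mulrNN conjqM.
by congr (_ - _); symmetry; apply: E.
Qed.

Lemma sum_bar (W : nmodType) (G : T -> W) : \sum_t G t = \sum_t G (bar t).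
Proof. by apply: reindex_inj; apply: inv_inj; apply: barK. Qed.

Lemma comm_br_g : {in g &, forall X Y, br X Y \in g}.
Proof.
move=> X Y /mem_g gX /mem_g gY; have [FX sX _] := gX; have [FY sY _] := gY.
apply/mem_g; split.
- move=> u v; rewrite ent_br; apply: in_fieldD; last apply: in_fieldN;
    by apply: in_field_sum => t _; apply: in_fieldM.
- have E (A B : V) : (forall u v, ent A u v = - (eps R u * eps R v) *: conjq (ent A (bar v) (bar u))) ->
      (forall u v, ent B u v = - (eps R u * eps R v) *: conjq (ent B (bar v) (bar u))) ->
      forall u v, (eps R u * eps R v) *: conjq (\sum_t ent A (bar v) t * ent B t (bar u)) =
      \sum_t ent B u t * ent A t v.
    move=> sA sB u v; rewrite conjq_sum scaler_sumr.
    rewrite [LHS]sum_bar; apply: eq_bigr => t _.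
    rewrite conjqM (sB u t) (sA t v) -scalerAl -scalerAr scalerA; congr (_ *: _).
    have := eps_sq R t; set x := eps _ t => xx.
    by rewrite -[LHS]mulr1 -xx; ring.
  move=> u v; rewrite !ent_br conjqD conjqN scalerDr scaleNr !E// scalerN scaleNr E//.
  by rewrite opprK addrC.
- move=> FC; rewrite -mxtrace_ent /comm_br raddfB /= mxtrace_comm ?subrr// => i j.
  by apply: (in_field_comm FC); [exact: ((mx_over_ent F X).2 FX) | exact: ((mx_over_ent F Y).2 FY)].
Qed.

Lemma cartan_inv_g : {in g, forall X, sg X \in g}.
Proof.
move=> X /mem_g[FX sX tX]; apply/mem_g; split.
- by move=> u v; rewrite ent_sg; apply/in_fieldN/in_field_conj.
- move=> u v; rewrite !ent_sg (sX v u) conjqZ conjqK conjqN conjqK.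
  by rewrite !scaleNr scalerN !opprK mulrC.
- move=> FC; under eq_bigr do rewrite ent_sg -conjqN.
  by rewrite -conjq_sum sumrN tX// oppr0 conjq0.
Qed.

End LieAlgebra.

(** * Positivity of B_sigma, and supports of matrices in the eigenbasis *)

Section RootDecomposition.
Variables (R : realType) (F : base_field) (p r : nat).
Local Notation n := (p + (p + r))%N.
Local Notation T := ('I_p + ('I_p + 'I_r))%type.
Local Notation V := (hmx R n).
Local Notation br := (@comm_br R p r).
Local Notation sg := (@cartan_inv R p r).
Local Notation g := (g_ R F p r).
Local Notation B := (@killing R F p r).
Local Notation Bs := (@killing_sigma R F p r).
Implicit Types X Y Z : V.

Let brb := @comm_br_bilin R p r.

Lemma killing_sigmaE : Bs = gkilling_sg br g sg. Proof. by []. Qed.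

Lemma killing_form : bilform B. Proof. exact: gkilling_form brb. Qed.
Lemma killing_inv : {in g & &, forall X Y Z, B (br X Y) Z = B X (br Y Z)}.
Proof. exact: (gkilling_inv brb (@comm_br_jacobi R p r) (@comm_br_g R F p r)). Qed.
Lemma killing_sigma_form : bilform Bs.
Proof. exact: (gkilling_sg_form g brb (@cartan_inv_lin R p r)). Qed.
Lemma killing_sigmaC : {in g &, forall X Y, Bs X Y = Bs Y X}.
Proof.
exact: (gkilling_sgC brb (@comm_br_g R F p r) (@cartan_inv_lin R p r)
  (@cartan_inv_g R F p r) (@cartan_invK R p r) (@cartan_inv_br R p r)).
Qed.

(* The form Re tr (X Y^* ), for which ad (sg X) is minus the adjoint of ad X. *)
Definition trace_form X Y : R := q0 (\tr ((X : 'M_n) *m ctr Y)).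

Lemma trace_form_bilin : bilform trace_form.
Proof.
have q0Z a (x : quat R) : q0 (a *: x) = a * q0 x by [].
have trZ a X : \tr (a *: X : 'M_n) = a *: \tr (X : 'M_n).
  by rewrite /mxtrace scaler_sumr; apply: eq_bigr => i _; rewrite mxE.
split=> Z a X Y; rewrite /trace_form.
  by rewrite mulmxDl hmx_mulZl mxtraceD trZ q0D q0Z.
have -> : ctr (a *: X + Y : V) = a *: (ctr X : V) + ctr Y.
  by apply: ent_inj => u v; rewrite !(ent_ctr, entD, entZ) conjqD conjqZ.
by rewrite mulmxDr hmx_mulZr mxtraceD trZ q0D q0Z.
Qed.

Lemma trace_formC X Y : trace_form X Y = trace_form Y X.
Proof.
have q0_conj (x : quat R) : q0 (conjq x) = q0 x by [].
rewrite /trace_form -[in LHS](ctrK X) -ctr_mul -q0_conj /mxtrace conjq_sum.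
by congr q0; apply: eq_bigr => i _; rewrite !mxE conjqK.
Qed.

Lemma trace_form_gt0 X : X != 0 -> 0 < trace_form X X.
Proof.
have E : trace_form X X = \sum_i \sum_j q0 (X i j * conjq (X i j)).
  rewrite /trace_form /mxtrace q0_sum; apply: eq_bigr => i _.
  by rewrite mxE q0_sum; apply: eq_bigr => j _; rewrite !mxE.
have ge0 i : 0 <= \sum_j q0 (X i j * conjq (X i j)).
  by apply: sumr_ge0 => j _; apply: normq_ge0.
move=> X0; rewrite lt_neqAle E sumr_ge0 ?andbT//; apply: contra X0 => /eqP/esym X0.
apply/eqP/matrixP => i j; rewrite [RHS]mxE; apply: normq_eq0.
have X0i := psumr_eq0P (fun i _ => ge0 i) X0 (i := i) isT.
exact: (psumr_eq0P (fun j _ => normq_ge0 (X i j)) X0i (i := j) isT).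
Qed.

Lemma trace_form_adj X Y Z : trace_form (br X Y) Z = - trace_form Y (br (sg X) Z).
Proof.
have cl : ctr (br (sg X) Z : 'M_n) = br X (ctr Z) :> 'M_n.
  rewrite -[LHS]opprK -[- ctr _]/(sg (br (sg X) Z)) cartan_inv_br cartan_invK.
  by rewrite /cartan_inv (bNr brb) opprK.
rewrite /trace_form cl.
exact: (q0_mxtrace_comm (X : 'M_n) Y (ctr Z)).
Qed.

(** The trace of ad X ad(sg X) is taken in a basis of g orthonormal for [trace_form], where the
    adjunction rule turns it into a sum of squares. *)
Lemma killing_sigma_sum X : X \in g -> exists e : seq V,
  (<<e>> = g)%VS /\ Bs X X = \sum_(u <- e) trace_form (br (sg X) u) (br (sg X) u).
Proof.
move=> Xg.
have [e [oe eU Ue]] : exists e : seq V, [/\ orthonormal_seq trace_form e,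
    forall x, x \in e -> exists k : unit, x \in g &
    forall (k : unit) x, x \in g -> x \in <<e>>%VS].
  apply: (@graded_orthonormal_basis _ _ _ unit (fun _ x => x \in g)).
  - exact: trace_form_bilin.
  - by move=> _; apply: lin_closed_vs.
  - by move=> _ x y _ _; apply: trace_formC.
  - by move=> _ x _; apply: trace_form_gt0.
  - by case=> [] [].
have eg : (<<e>> = g)%VS.
  apply/eqP; rewrite eqEsubv; apply/andP; split.
    by apply/span_subvP => x /eU[].
  by apply/subvP => x; apply: Ue tt x.
exists e; split=> //.
rewrite killing_sigmaE /gkilling_sg /gkilling -eg.
rewrite (vtrace_orthonormal trace_form_bilin oe); last 2 first.
- by apply: (@linear_comp _ _ (br X) (br (sg X))) => a Y Z; rewrite brb.2.
- by move=> Y; rewrite eg => Yg; rewrite !comm_br_g ?cartan_inv_g.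
by rewrite -sumrN; apply: eq_bigr => u _; rewrite trace_form_adj opprK.
Qed.

(** This takes the place of semisimplicity: [Y] witnesses that [X] is not central. If the sum of
    squares vanished, ad(sg X) would be zero on g, hence [sg X, sg Y] = sg [X, Y] would be zero. *)
Lemma killing_sigma_gt0 X Y : X \in g -> Y \in g -> br X Y != 0 -> 0 < Bs X X.
Proof.
move=> Xg Yg XY0; have [e [eg ->]] := killing_sigma_sum Xg.
have tf_ge0 Z : 0 <= trace_form Z Z.
  have [->|Z0] := eqVneq Z 0; first by rewrite (b0l trace_form_bilin).
  by rewrite ltW// trace_form_gt0.
rewrite lt_neqAle sumr_ge0 ?andbT => [|u _]; last exact: tf_ge0.
apply: contra XY0 => /eqP/esym S0.
have e0 u : u \in e -> br (sg X) u = 0.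
  move=> ue; apply/eqP; apply: contraT => /trace_form_gt0 u0.
  move: S0; rewrite (big_rem u)//= => S0.
  have : 0 <= \sum_(y <- rem u e) trace_form (br (sg X) y) (br (sg X) y).
    by apply: sumr_ge0 => y _; apply: tf_ge0.
  by lra.
suff H : br (sg X) (sg Y) = 0.
  by rewrite -[br X Y](@cartan_invK R p r) cartan_inv_br H (lfE0 (@cartan_inv_lin R p r)).
have : sg Y \in <<e>>%VS by rewrite eg cartan_inv_g.
move: (sg Y); apply: span_ind => //.
by split=> [|a Z W Z0 W0]; rewrite ?(b0r brb)// (bDr brb) (bZr brb) Z0 W0 scaler0 addr0.
Qed.

(** Weights, the grading by Z and parity are all conditions on the positions of the nonzero entries
    in the eigenbasis, and brackets compose positions. *)
Definition supp (P : T -> T -> Prop) X := forall u v, ent X u v != 0 -> P u v.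

Lemma lin_closed_supp P : lin_closed (supp P).
Proof.
split=> [|a X Y sX sY] u v; first by rewrite ent0 eqxx.
rewrite entD entZ => nz; have [X0|] := eqVneq (ent X u v) 0; last exact: sX.
by apply: sY; move: nz; rewrite X0 scaler0 add0r.
Qed.

Lemma supp_br (P Q S : T -> T -> Prop) X Y : supp P X -> supp Q Y ->
  (forall u t v, P u t -> Q t v -> S u v) -> (forall u t v, Q u t -> P t v -> S u v) ->
  supp S (br X Y).
Proof.
move=> sX sY PQ QP u v; rewrite ent_br.
have mul0 A C (P1 Q1 : T -> T -> Prop) : supp P1 A -> supp Q1 C ->
    (forall u t v, P1 u t -> Q1 t v -> S u v) -> ~ S u v ->
    \sum_t ent A u t * ent C t v = 0.
  move=> sA sC PQ1 nS; rewrite big1// => t _.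
  have [->|/sA Put] := eqVneq (ent A u t) 0; first by rewrite mul0r.
  have [->|/sC Qtv] := eqVneq (ent C t v) 0; first by rewrite mulr0.
  by case: nS; apply: PQ1 Put Qtv.
by apply: contra_neqP => nS; rewrite (mul0 X Y P Q)// (mul0 Y X Q P)// subrr.
Qed.

Lemma supp_sg P X : supp P X -> supp (fun u v => P v u) (sg X).
Proof.
move=> sX u v; rewrite ent_sg oppr_eq0 => nz; apply: sX; apply: contra nz => /eqP ->.
by rewrite conjq0.
Qed.

Lemma supp_ent0 P X : supp P X -> (forall u v, ~ P u v) -> X = 0.
Proof.
move=> sX nP; apply: ent_inj => u v; rewrite ent0; apply/eqP; apply: contraT => /sX.
by move/nP.
Qed.

Definition cutoff (Q : T -> T -> bool) X : V :=
  unent (fun u v => if Q u v then ent X u v else 0).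

Lemma ent_cutoff Q X u v : ent (cutoff Q X) u v = if Q u v then ent X u v else 0.
Proof. exact: unentK. Qed.

(** [Q] has to respect the symmetry (u, v) -> (bar v, bar u) of g, and to keep or drop the diagonal
    as a whole so that the trace stays zero. *)
Lemma cutoff_g Q X : (forall u v, Q (bar v) (bar u) = Q u v) ->
  (forall u v, Q u u = Q v v) -> X \in g -> cutoff Q X \in g.
Proof.
move=> Qbar Qdiag /mem_g[FX sX tX]; apply/mem_g; split.
- by move=> u v; rewrite ent_cutoff; case: ifP => // _; apply: in_field0.
- move=> u v; rewrite !ent_cutoff Qbar; case: ifP => // _.
  by rewrite conjq0 scaler0.
- move=> /tX X0; have [t Qt|nQ] := pickP (fun t => Q t t).
    rewrite -[RHS]X0; apply: eq_bigr => u _; by rewrite ent_cutoff (Qdiag u t) Qt.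
  by rewrite big1// => u _; rewrite ent_cutoff nQ.
Qed.

Lemma cutoff_lin Q : linear (cutoff Q).
Proof.
move=> a X Y; apply: ent_inj => u v; rewrite !(entD, entZ, ent_cutoff).
by case: ifP => //; rewrite scaler0 addr0.
Qed.

Lemma cutoff_supp (Q : T -> T -> bool) X : supp Q X -> cutoff Q X = X.
Proof.
move=> sX; apply: ent_inj => u v; rewrite ent_cutoff; case: ifPn => // nQ.
by apply/esym/eqP; apply: contraNT nQ => /sX.
Qed.

Lemma supp_cutoff (Q : T -> T -> bool) X : supp Q (cutoff Q X).
Proof. by move=> u v; rewrite ent_cutoff; case: ifP => //; rewrite eqxx. Qed.

Lemma supp_cutoff2 P Q X : supp P X -> supp P (cutoff Q X).
Proof. by move=> sX u v; rewrite ent_cutoff; case: ifP => [_ /sX|]//; rewrite eqxx. Qed.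

End RootDecomposition.

(** * Weight components and the parity involution *)

Section Weights.
Variables (R : realType) (F : base_field) (p r : nat).
Local Notation n := (p + (p + r))%N.
Local Notation T := ('I_p + ('I_p + 'I_r))%type.
Local Notation V := (hmx R n).
Local Notation br := (@comm_br R p r).
Local Notation sg := (@cartan_inv R p r).
Local Notation g := (g_ R F p r).
Local Notation Bs := (@killing_sigma R F p r).
Local Notation lam := (@lam R p r).
Local Notation eps := (@eps R p r).
Implicit Types (X Y Z : V) (al be d : 'rV[R]_p).

Let brb := @comm_br_bilin R p r.
Let brC := @comm_br_antisym R p r.

Definition wt al X := supp (fun u v => lam u - lam v = al) X.

Lemma ent_br_amx d X u v :
  ent (br (amx r d) X) u v = form_eval (lam u - lam v) d *: ent X u v.
Proof.
rewrite ent_br form_evalB scalerBl; congr (_ - _).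
  rewrite -[RHS](sum_delta (fun t => form_eval (lam u) d *: ent X t v)).
  apply: eq_bigr => t _; rewrite ent_amx eq_sym.
  by rewrite -scalerAl realqZ; case: eqVneq => // _; rewrite !scale0r.
rewrite -[RHS](sum_delta (fun t => form_eval (lam v) d *: ent X u t)).
apply: eq_bigr => t _; rewrite ent_amx.
rewrite -scalerAr -realqC realqZ; case: eqVneq => [->//|_]; by rewrite !scale0r.
Qed.

Lemma wt_br al X d : wt al X -> br (amx r d) X = form_eval al d *: X.
Proof.
move=> wX; apply: ent_inj => u v; rewrite ent_br_amx entZ.
by have [->|/wX ->//] := eqVneq (ent X u v) 0; rewrite !scaler0.
Qed.

Lemma br_wt al X : (forall d, br (amx r d) X = form_eval al d *: X) -> wt al X.
Proof.
move=> brX u v nz; apply/rowP => i.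
have := congr1 (fun Y => ent Y u v) (brX (delta_mx 0 i)).
rewrite ent_br_amx entZ => /eqP; rewrite -subr_eq0 -scalerBl scaler_eq0 (negPf nz) orbF.
have E be : form_eval be (delta_mx 0 i) = be 0 i.
  rewrite /form_eval (bigD1 i)//= big1 ?addr0 => [|j /negPf ji]; rewrite mxE ?eqxx ?mulr1//.
  by rewrite ji mulr0.
by rewrite !E subr_eq0 => /eqP.
Qed.

Lemma amx_g d : amx r d \in g.
Proof.
apply/mem_g; split.
- by move=> u v; rewrite ent_amx; apply/in_fieldZ/in_field_real.
- move=> u v; rewrite !ent_amx conjqZ conj_realq (inj_eq (inv_inj (@barK p r))).
  rewrite lam_bar form_evalN rmorphN [v == u]eq_sym.
  have [->|_] := eqVneq u v; last by rewrite !scale0r scaler0.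
  by rewrite eps_sq !scale1r scaleN1r opprK.
- move=> _; under eq_bigr do rewrite ent_amx eqxx scale1r.
  rewrite -(rmorph_sum (@realq R)) !big_sumType /= -(rmorph0 (@realq R)); congr realq.
  rewrite [X in _ + (_ + X)]big1 => [|j _]; last by rewrite form_eval0.
  by rewrite addr0 -big_split big1// => i _; rewrite /= form_evalN subrr.
Qed.

Lemma amx_lin : linear (@amx R p r).
Proof.
move=> a d d'; apply: ent_inj => u v; rewrite entD entZ !ent_amx.
rewrite form_eval_lin rmorphD rmorphM scalerDr -!realqZ; congr (_ + _).
by rewrite realqC -mulrA -realqC mulrA.
Qed.

Lemma amx_sg d : sg (amx r d) = - amx r d.
Proof.
apply: ent_inj => u v; rewrite ent_sg entN !ent_amx conjqZ conj_realq eq_sym.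
by case: eqVneq => [->|]// _; rewrite !scale0r.
Qed.

Lemma br_amx d d' : br (amx r d) (amx r d') = 0.
Proof.
apply: ent_inj => u v; rewrite ent_br_amx ent_amx ent0.
by case: eqVneq => [->|_]; rewrite ?subrr ?form_eval0 scale0r ?scaler0.
Qed.

Lemma form_eval_neq al be : al != be -> exists d, form_eval al d != form_eval be d.
Proof.
move=> ab; apply: contrapT => /forallNP H; move/eqP: ab; apply.
apply/rowP => i; have /negP := H (delta_mx 0 i); rewrite negbK => /eqP.
have E ga : form_eval ga (delta_mx 0 i) = ga 0 i.
  rewrite /form_eval (bigD1 i)//= big1 ?addr0 => [|j /negPf ji]; rewrite mxE ?eqxx ?mulr1//.
  by rewrite ji mulr0.
by rewrite !E.
Qed.

Lemma killing_sigma_adj :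
  {in g & &, forall X Y Z, Bs (br X Y) Z = - Bs Y (br (sg X) Z)}.
Proof.
exact: (gkilling_sg_adj brb brC (@comm_br_jacobi R p r) (@comm_br_g R F p r)
  (@cartan_inv_g R F p r) (@cartan_invK R p r) (@cartan_inv_br R p r)).
Qed.

(** Elements of a act by self-adjoint operators for [Bs], and some [d] gives the two weights
    different eigenvalues. *)
Lemma killing_sigma_wt al be X Y : X \in g -> Y \in g -> wt al X -> wt be Y ->
  al != be -> Bs X Y = 0.
Proof.
move=> Xg Yg wX wY /form_eval_neq[d]; have Bb := @killing_sigma_form R F p r.
have := killing_sigma_adj (amx_g d) Xg Yg.
rewrite amx_sg (bNl brb) (wt_br d wX) (wt_br d wY) (bNr Bb).
rewrite (fZl _ _ _ Bb) (fZr _ _ _ Bb); move: (Bs X Y) => S; rewrite opprK => /eqP.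
by rewrite -subr_eq0 -mulrBl mulf_eq0 subr_eq0 => /orP[/eqP->|/eqP//]; rewrite eqxx.
Qed.

Definition weights : seq 'rV[R]_p := undup [seq lam uv.1 - lam uv.2 | uv <- enum {: T * T}].
Definition proj al X := cutoff (fun u v => lam u - lam v == al) X.

Lemma proj_g al X : X \in g -> proj al X \in g.
Proof.
apply: cutoff_g => [u v|u v]; last by rewrite !subrr.
by rewrite !lam_bar opprK addrC.
Qed.

Lemma proj_wt al X : wt al (proj al X).
Proof. by move=> u v /(@supp_cutoff _ _ _ (fun u v => lam u - lam v == al)) /eqP. Qed.

Lemma supp_proj P al X : supp P X -> supp P (proj al X).
Proof. exact: supp_cutoff2. Qed.

Lemma sum_proj X : X = \sum_(al <- weights) proj al X.
Proof.
apply: ent_inj => u v.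
have -> : ent (\sum_(al <- weights) proj al X) u v =
    \sum_(al <- weights) ent (proj al X) u v.
  by apply: (big_morph (fun Y => ent Y u v)) => [Y Z|]; rewrite ?entD ?ent0.
rewrite (bigD1_seq (lam u - lam v)) ?undup_uniq//=; last first.
  by rewrite mem_undup; apply/mapP; exists (u, v); rewrite ?mem_enum.
rewrite ent_cutoff eqxx big1 ?addr0// => al /negPf ne.
by rewrite ent_cutoff eq_sym ne.
Qed.

(* The last b columns of the block C have odd parity, so that W_b is odd. *)
Definition par (a : nat) (t : T) : bool := if t is inr (inr j) then (a <= j)%N else false.
Definition evn a X := cutoff (fun u v => par a u == par a v) X.
Definition odn a X := cutoff (fun u v => par a u != par a v) X.

Lemma supp_evn P a X : supp P X -> supp P (evn a X).
Proof. exact: supp_cutoff2. Qed.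
Lemma supp_odn P a X : supp P X -> supp P (odn a X).
Proof. exact: supp_cutoff2. Qed.
Lemma evn_supp a X : supp (fun u v => par a u == par a v) (evn a X).
Proof. exact: supp_cutoff. Qed.
Lemma odn_supp a X : supp (fun u v => par a u != par a v) (odn a X).
Proof. exact: supp_cutoff. Qed.

Lemma par_bar a t : par a (bar t) = par a t. Proof. by case: t => [i|[i|j]]. Qed.

Lemma evn_g a X : X \in g -> evn a X \in g.
Proof. by apply: cutoff_g => [u v|u v]; rewrite ?eqxx// !par_bar eq_sym. Qed.
Lemma odn_g a X : X \in g -> odn a X \in g.
Proof. by apply: cutoff_g => [u v|u v]; rewrite ?eqxx// !par_bar eq_sym. Qed.
Lemma evn_odn a X : X = evn a X + odn a X.
Proof.
apply: ent_inj => u v; rewrite entD !ent_cutoff.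
by case: (par a u == par a v); rewrite ?addr0 ?add0r.
Qed.

Definition is_evn a X := supp (fun u v => par a u == par a v) X.
Definition is_odn a X := supp (fun u v => par a u != par a v) X.

Let sgp a t : R := (-1) ^+ par a t.
Let sgp_sq a t : sgp a t * sgp a t = 1. Proof. by rewrite -expr2 sqrr_sign. Qed.
(** Conjugation by a diagonal matrix of signs: an automorphism equal to 1 on even and -1 on odd
    elements. Its invariance of [Bs] makes the two parities orthogonal. *)
Definition tau a X : V := unent (fun u v => (sgp a u * sgp a v) *: ent X u v).

Lemma ent_tau a X u v :
  ent (tau a X) u v = (-1) ^+ (par a u != par a v) *: ent X u v.
Proof.
rewrite unentK /sgp -signr_addb; congr (_ ^+ _ *: _).
by case: (par a u); case: (par a v).
Qed.

Let ent_tau' a X u v : ent (tau a X) u v = (sgp a u * sgp a v) *: ent X u v.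
Proof. exact: unentK. Qed.

Lemma tau_lin a : linear (tau a).
Proof.
move=> c X Y; apply: ent_inj => u v; rewrite !(entD, entZ, ent_tau) scalerDr !scalerA.
by rewrite mulrC.
Qed.
Lemma tauK a : involutive (tau a).
Proof.
by move=> X; apply: ent_inj => u v; rewrite !ent_tau scalerA -expr2 sqrr_sign scale1r.
Qed.
Lemma tau_br a X Y : tau a (br X Y) = br (tau a X) (tau a Y).
Proof.
apply: ent_inj => u v; rewrite ent_tau' !ent_br scalerBr !scaler_sumr.
have E t : sgp a u * sgp a v = sgp a u * sgp a t * (sgp a t * sgp a v).
  by rewrite mulrA -(mulrA (sgp a u)) sgp_sq mulr1.
congr (_ - _); apply: eq_bigr => t _.
  by rewrite (ent_tau' a X) (ent_tau' a Y) -scalerAl -scalerAr scalerA -E.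
by rewrite (ent_tau' a X) (ent_tau' a Y) -scalerAl -scalerAr scalerA -E.
Qed.
Lemma tau_sg a X : tau a (sg X) = sg (tau a X).
Proof.
apply: ent_inj => u v; rewrite !(ent_tau', ent_sg) conjqZ scalerN.
by rewrite mulrC.
Qed.
Lemma tau_evn a X : is_evn a X -> tau a X = X.
Proof.
move=> eX; apply: ent_inj => u v; rewrite ent_tau.
by have [->|/eX ->] := eqVneq (ent X u v) 0; rewrite ?scaler0 ?scale1r.
Qed.
Lemma tau_odn a X : is_odn a X -> tau a X = - X.
Proof.
move=> oX; apply: ent_inj => u v; rewrite ent_tau entN.
by have [->|/oX ->] := eqVneq (ent X u v) 0; rewrite ?scaler0 ?oppr0 ?scaleN1r.
Qed.
Lemma tau_g a : {in g, forall X, tau a X \in g}.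
Proof.
move=> X Xg; rewrite (evn_odn a X) (lfED (@tau_lin a)).
rewrite tau_evn; last exact: supp_cutoff.
rewrite tau_odn; last exact: supp_cutoff.
by apply: memvB; [exact: evn_g | exact: odn_g].
Qed.
Lemma killing_sigma_tau a : {in g &, forall X Y, Bs (tau a X) (tau a Y) = Bs X Y}.
Proof.
move=> X Y Xg Yg; apply: (congr1 -%R); rewrite -tau_sg.
apply: (gkilling_sgsg brb (@comm_br_g R F p r) (@tau_lin a) (@tau_g a) (@tauK a)
  (@tau_br a)) => //.
exact: cartan_inv_g.
Qed.

Lemma killing_sigma_parity a X Y : X \in g -> Y \in g -> is_evn a X -> is_odn a Y ->
  Bs X Y = 0.
Proof.
move=> Xg Yg eX oY; have := killing_sigma_tau a Xg Yg.
rewrite (tau_evn eX) (tau_odn oY) (bNr (@killing_sigma_form R F p r)).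
by move: (Bs X Y) => S; lra.
Qed.

End Weights.

(** * Restricted roots and root vectors *)

Section Roots.
Variables (R : realType) (F : base_field) (p r : nat).
Local Notation n := (p + (p + r))%N.
Local Notation T := ('I_p + ('I_p + 'I_r))%type.
Local Notation V := (hmx R n).
Local Notation sg := (@cartan_inv R p r).
Local Notation g := (g_ R F p r).
Local Notation lam := (@lam R p r).
Local Notation eps := (@eps R p r).
Implicit Types (X Y : V) (al be d : 'rV[R]_p).

Lemma form_eval_lam d (t : T) : form_eval (lam t) d =
  match t with inl i => d 0 i | inr (inl i) => - d 0 i | inr (inr _) => 0 end.
Proof.
by case: t => [i|[i|j]]; rewrite /= ?form_evalN ?form_eval_omega ?form_eval0.
Qed.

Lemma mem_pos_roots al : al \in pos_roots R F p ->
  [\/ exists2 i : 'I_p, al = omega R p i & True,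
      exists i j : 'I_p, (i < j)%N /\
        (al = omega R p j + omega R p i \/ al = omega R p j - omega R p i) |
      exists2 i : 'I_p, al = omega R p i *+ 2 & F <> RealF].
Proof.
rewrite /pos_roots !mem_cat => /or4P[/mapP[i]|||].
- rewrite mem_iota /= => ip ->; apply: Or31; by exists (Ordinal ip).
- move=> /allpairsPdep[j [i [jp ij ->]]]; move: jp ij; rewrite !mem_iota /= => jp ij.
  apply: Or32; exists (Ordinal (ltn_trans ij jp)), (Ordinal jp); split=> //.
  by left.
- move=> /allpairsPdep[j [i [jp ij ->]]]; move: jp ij; rewrite !mem_iota /= => jp ij.
  apply: Or32; exists (Ordinal (ltn_trans ij jp)), (Ordinal jp); split=> //.
  by right.
- case: F => // /mapP[i]; rewrite mem_iota /= => ip ->; apply: Or33;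
    by exists (Ordinal ip).
Qed.

Lemma omega_pos_root (i : 'I_p) : omega R p i \in pos_roots R F p.
Proof. by rewrite /pos_roots mem_cat map_f ?mem_iota /=. Qed.

Lemma omegaD_pos_root (i j : 'I_p) : (i < j)%N ->
  omega R p j + omega R p i \in pos_roots R F p.
Proof.
move=> ij; rewrite /pos_roots !mem_cat; apply/or4P/Or42/allpairsPdep.
by exists (j : nat), (i : nat); rewrite !mem_iota /=; split.
Qed.

Lemma omegaB_pos_root (i j : 'I_p) : (i < j)%N ->
  omega R p j - omega R p i \in pos_roots R F p.
Proof.
move=> ij; rewrite /pos_roots !mem_cat; apply/or4P/Or43/allpairsPdep.
by exists (j : nat), (i : nat); rewrite !mem_iota /=; split.
Qed.

Lemma omega2_pos_root (i : 'I_p) : F <> RealF -> omega R p i *+ 2 \in pos_roots R F p.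
Proof.
move=> nF; rewrite /pos_roots !mem_cat; apply/or4P/Or44; case: F nF => // _;
  by apply: (map_f (fun k => omega R p k *+ 2)); rewrite mem_iota /=.
Qed.

(** A case analysis on the blocks of [u] and [v]; dominance of [Z] excludes the negative roots. In
    the weight 2 omega_i the symmetry of g makes the entry purely imaginary, so it vanishes over the
    reals. *)
Lemma root_mem (Z : 'rV[R]_p) X (u v : T) : (forall i, 0 <= Z 0 i) ->
  (forall i j : 'I_p, (i <= j)%N -> Z 0 i <= Z 0 j) ->
  X \in g -> ent X u v != 0 -> form_eval (lam v) Z < form_eval (lam u) Z ->
  lam u - lam v \in pos_roots R F p.
Proof.
move=> Z0 Zm /mem_g[FX sX _] nz; rewrite !form_eval_lam.
have lt_Z i j : Z 0 i < Z 0 j -> (i < j)%N.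
  by move=> ij; rewrite ltnNge; apply/negP => /Zm; lra.
case: u nz => [i|[i|i]]; case: v => [j|[j|j]] /= nz.
- by move=> /lt_Z ji; apply: omegaB_pos_root.
- move=> _; rewrite opprK; have [ij|ji|ij] := ltngtP i j.
  + by rewrite addrC; apply: omegaD_pos_root.
  + exact: omegaD_pos_root.
  + have {ij} ij : i = j by apply: val_inj.
    subst j; rewrite -mulr2n; apply: omega2_pos_root => FR.
    move: nz; have := sX (inl i) (inr (inl i)); have := FX (inl i) (inr (inl i)).
    rewrite FR /=; case: (ent _ _ _) => x0 x1 x2 x3 /= [-> -> ->].
    rewrite mulr1 scaleN1r => -[x0E _ _ _] /eqP[]; apply: quat_eq => //=.
    by lra.
- by move=> _; rewrite subr0; apply: omega_pos_root.
- by have := Z0 i; have := Z0 j; lra.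
- rewrite opprK addrC ltrN2 => /lt_Z ij; exact: omegaB_pos_root.
- by have := Z0 i; lra.
- by have := Z0 j; lra.
- by move=> _; rewrite sub0r opprK; apply: omega_pos_root.
- by rewrite ltxx.
Qed.

(** Not the half sum of positive roots, but the element of a on which every simple root takes the
    value 1; it separates positive roots from zero and negative ones. *)
Definition rho : 'rV[R]_p := \row_k k.+1%:R.

Lemma pos_root_rho al : al \in pos_roots R F p -> 0 < form_eval al rho.
Proof.
move=> /mem_pos_roots[[i -> _]|[i [j [ij [->|->]]]]|[i -> _]].
- by rewrite form_eval_omega mxE ltr0n.
- by rewrite form_evalD !form_eval_omega !mxE addr_gt0 ?ltr0n.
- by rewrite form_evalB !form_eval_omega !mxE subr_gt0 ltr_nat ltnS.
- by rewrite mulr2n form_evalD !form_eval_omega !mxE addr_gt0 ?ltr0n.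
Qed.

(** An entry that changes parity has at least one index in the third block, so its weight is 0 or
    plus or minus some omega_i. Positivity at [rho] leaves only omega_i, which is excluded. *)
Lemma wt_evn a al X : al \in pos_roots R F p -> al \notin omegas R p ->
  wt al X -> is_evn a X.
Proof.
move=> /pos_root_rho al0 nal wX u v /wX {}wX; apply/eqP; subst al.
have om (i : 'I_p) : omega R p i \in omegas R p by rewrite map_f ?mem_iota /=.
move: al0 nal; rewrite form_evalB !form_eval_lam.
case: u v => [i|[i|i]] [j|[j|j]] //=.
- by rewrite !subr0 om.
- by rewrite !mxE !subr0 oppr_gt0 ltrn0.
- by rewrite !mxE !sub0r oppr_gt0 ltrn0.
- by rewrite !sub0r !opprK om.
- by rewrite subrr ltxx.
Qed.

Lemma wmx_g (C : 'M[quat R]_(p, r)) : mx_over F C -> wmx C \in g.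
Proof.
move=> FC; have [k _ W] := ent_wmx R p r; apply/mem_g; split.
- move=> u v; rewrite W; case: u v => [i|[i|i]] [j|[j|j]];
    do ?[exact: in_field0]; apply: in_fieldZ => //; exact: in_field_conj.
- move=> u v; rewrite !W; case: u v => [i|[i|i]] [j|[j|j]] /=;
    rewrite ?conjq0 ?scaler0 // conjqZ ?conjqK scalerA; congr (_ *: _); ring.
- by move=> _; rewrite big1// => -[i|[i|i]] _; rewrite W.
Qed.

Lemma omega_wmx (i : 'I_p) X : X \in g -> wt (omega R p i) X ->
  exists2 C, mx_over F C & X = wmx C.
Proof.
move=> /mem_g[FX sX _] wX; have [k k0 W] := ent_wmx R p r.
exists (\matrix_(s, j) (k^-1 *: ent X (inl s) (inr (inr j)))).
  by move=> s j; rewrite mxE; apply/in_fieldZ/FX.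
(* On [one] the three blocks have weights 1, -1 and 0, so the difference 1 occurs only in the two
   positions filled by [wmx]. *)
pose one : 'rV[R]_p := const_mx 1.
have om (j : 'I_p) : form_eval (omega R p j) one = 1 by rewrite form_eval_omega mxE.
have X0 u v : form_eval (lam u) one - form_eval (lam v) one != 1 -> ent X u v = 0.
  by apply: contra_neq_eq => /wX/(congr1 (fun al => form_eval al one));
    rewrite form_evalB om.
apply: ent_inj => u v; rewrite W.
case: u v => [s|[s|s]] [t|[t|t]]; rewrite ?mxE ?conjqZ ?(scalerKV k0) //;
  try (by apply: X0; rewrite !form_eval_lam ?mxE; apply/eqP => ?; lra).
by rewrite sX /= mulN1r opprK scale1r.
Qed.

(** The centraliser of a in the (-1)-eigenspace of [sg] is a itself. Equal weights force [u = v]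
    outside the third block, and inside it the Hermitian symmetry from [sg] contradicts the skew one
    from g unless the entry is 0. *)
Lemma weight0_amx X : X \in g -> wt 0 X -> sg X = - X -> exists d, X = amx r d.
Proof.
move=> /mem_g[FX sX _] wX sgX.
have herm u v : conjq (ent X v u) = ent X u v.
  have := congr1 (fun Y => ent Y u v) sgX; rewrite ent_sg entN.
  by move/oppr_inj.
exists (\row_i q0 (ent X (inl i) (inl i))); apply: ent_inj => u v; rewrite ent_amx.
have real_q (x : quat R) : conjq x = x -> x = realq (q0 x).
  case: x => x0 x1 x2 x3 [] /= e1 e2 e3; apply: quat_eq => /=; lra.
have [e|ne] := eqVneq (lam u) (lam v); last first.
  have -> : (u == v) = false by apply: contraNF ne => /eqP ->.
  rewrite scale0r; apply/eqP; apply: contraNT ne => /wX /eqP.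
  by rewrite subr_eq0.
have {}e (d : 'rV[R]_p) : form_eval (lam u) d = form_eval (lam v) d by rewrite e.
have om_inj (i j : 'I_p) : (forall d : 'rV[R]_p, d 0 i = d 0 j) -> i = j.
  move=> /(_ (delta_mx 0 j)); rewrite !mxE !eqxx /=; case: eqVneq => // _ /eqP.
  by rewrite eq_sym oner_eq0.
rewrite form_eval_lam.
case: u v e => [i|[i|i]] [j|[j|j]] e; move: (e rho); rewrite !form_eval_lam.
- move=> _; have -> : j = i by apply: om_inj => d; have := e d; rewrite !form_eval_lam.
  by rewrite eqxx scale1r mxE; apply: real_q; apply: herm.
- rewrite !mxE => ee; exfalso; by have := ltr0Sn R i; have := ltr0Sn R j; lra.
- rewrite !mxE => ee; exfalso; by have := ltr0Sn R i; lra.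
- rewrite !mxE => ee; exfalso; by have := ltr0Sn R i; have := ltr0Sn R j; lra.
- move=> _; have -> : j = i by apply: om_inj => d; have := e d; rewrite !form_eval_lam; lra.
  rewrite eqxx scale1r mxE sX /= mulr1 scaleN1r herm.
  by rewrite {1}(real_q _ (herm (inl i) (inl i))) rmorphN.
- rewrite !mxE => ee; exfalso; by have := ltr0Sn R i; lra.
- rewrite !mxE => ee; exfalso; by have := ltr0Sn R j; lra.
- rewrite !mxE => ee; exfalso; by have := ltr0Sn R j; lra.
- move=> _; rewrite rmorph0 scaler0.
  have := sX (inr (inr i)) (inr (inr j)); rewrite herm /= mulrNN mulr1 scaleN1r.
  by move/eqP; rewrite -addr_eq0 -mulr2n -scaler_nat scaler_eq0 pnatr_eq0 /= => /eqP.
Qed.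

(** The elementary matrix at (u, v) with the companion term demanded by the symmetry of g. For
    [v = bar u] the two would be the same matrix and cancel. *)
Lemma root_vector (u v : T) : u != v -> v != bar u ->
  exists X, [/\ X \in g, wt (lam u - lam v) X & X != 0].
Proof.
move=> uv vbu.
pose X : V := unent (fun s t => realq ((s == u)%:R * (t == v)%:R
  - eps u * eps v * ((s == bar v)%:R * (t == bar u)%:R))).
have EX s t : ent X s t = realq ((s == u)%:R * (t == v)%:R
  - eps u * eps v * ((s == bar v)%:R * (t == bar u)%:R)) by exact: unentK.
exists X; split.
- apply/mem_g; split.
  + by move=> s t; rewrite EX; apply: in_field_real.
  + move=> s t; rewrite !EX conj_realq.
    have realqM (a b : R) : a *: realq b = realq (a * b).
      by apply: quat_eq => /=; ring.
    rewrite realqM; congr realq.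
    rewrite !(inj_eq (inv_inj (@barK p r))) !(can2_eq (@barK p r) (@barK p r)).
    have E1 : eps s * eps t * (eps u * eps v) * ((s == u)%:R * (t == v)%:R) =
        (s == u)%:R * (t == v)%:R.
      case: eqVneq => [->|_]; last by rewrite mul0r mulr0.
      case: eqVneq => [->|_]; last by rewrite !mulr0.
      by rewrite [X in X * _]mulrACA !eps_sq !mul1r.
    have E2 : eps s * eps t * ((s == bar v)%:R * (t == bar u)%:R) =
        eps u * eps v * ((s == bar v)%:R * (t == bar u)%:R).
      case: eqVneq => [->|_]; last by rewrite mul0r !mulr0.
      by case: eqVneq => [->|_]; rewrite ?mulr0// !eps_bar (mulrC (eps v)).
    by rewrite -E1 -E2; ring.
  + move=> _; rewrite big1// => s _; rewrite EX.
    have [->|_] := eqVneq s u; first by rewrite (negPf uv) [u == bar v]eq_sym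
      (can2_eq (@barK p r) (@barK p r)) (negPf vbu) mulr0 mul0r mulr0 subrr.
    have [sv|_] := eqVneq s (bar v); last by rewrite !mul0r mulr0 subrr.
    rewrite sv (inj_eq (inv_inj (@barK p r))) (eq_sym v) (negPf uv) !mul0r !mulr0 subrr.
    by [].
- move=> s t; rewrite EX.
  have [->|_] := eqVneq s u; last first.
    have [->|_] := eqVneq s (bar v); last by rewrite !mul0r mulr0 subrr eqxx.
    have [->|_] := eqVneq t (bar u); last by rewrite mul0r !mulr0 subrr eqxx.
    by move=> _; rewrite !lam_bar opprK addrC.
  have [->//|_] := eqVneq t v; rewrite [u == bar v]eq_sym.
  by rewrite (can2_eq (@barK p r) (@barK p r)) (negPf vbu) mulr0 mul0r mulr0 subrr eqxx.
- apply/eqP => X0.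
  have := congr1 (fun Y => q0 (ent Y u v)) X0; rewrite EX ent0 /= !eqxx.
  rewrite [u == bar v]eq_sym (can2_eq (@barK p r) (@barK p r)) (negPf vbu).
  by rewrite mul0r mulr0 subr0 mulr1 => /eqP; rewrite oner_eq0.
Qed.

Lemma simple_root_vector (k : 'I_p) : (0 < r)%N ->
  exists X, [/\ X \in g, wt (simple_root R p k) X & X != 0].
Proof.
move=> r0; case: k => -[|k] kp.
  have := @root_vector (inl (Ordinal kp)) (inr (inr (Ordinal r0))).
  by rewrite /= subr0; apply.
have kp' : (k < p)%N by apply: ltnW.
have ne : Ordinal kp != Ordinal kp' by rewrite -(inj_eq val_inj) /= neq_ltn ltnSn orbT.
exact: (@root_vector (inl (Ordinal kp)) (inl (Ordinal kp')) ne).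
Qed.

Lemma omega_vector (k : 'I_p) : (0 < r)%N ->
  exists X, [/\ X \in g, wt (omega R p k) X & X != 0].
Proof.
move=> r0; have := @root_vector (inl k) (inr (inr (Ordinal r0))).
by rewrite /= subr0; apply.
Qed.

End Roots.

(** * The grading of g by ad Z *)

Section Parabolic.
Variables (R : realType) (F : base_field) (p r : nat).
Local Notation n := (p + (p + r))%N.
Local Notation T := ('I_p + ('I_p + 'I_r))%type.
Local Notation V := (hmx R n).
Local Notation br := (@comm_br R p r).
Local Notation sg := (@cartan_inv R p r).
Local Notation g := (g_ R F p r).
Local Notation lam := (@lam R p r).
Implicit Types (X Y : V) (al be d : 'rV[R]_p).

(* Variables, so that rewriting does not see through the forms to traces. *)
Variables (B Bs : V -> V -> R).
Hypotheses (B_def : B = @killing R F p r) (Bs_def : Bs = @killing_sigma R F p r).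
Variables (Z : 'rV[R]_p) (a : nat).
Hypothesis r_gt0 : (0 < r)%N.
Hypothesis Z_simple : forall k : 'I_p, 0 <= form_eval (simple_root R p k) Z.

Let brb := @comm_br_bilin R p r.
Let brC := @comm_br_antisym R p r.
Let br_g := @comm_br_g R F p r.
Let jacobi := @comm_br_jacobi R p r.
Let sgl := @cartan_inv_lin R p r.
Let sg_g := @cartan_inv_g R F p r.
Let sgK := @cartan_invK R p r.
Let sg_br := @cartan_inv_br R p r.
Let amxg := @amx_g R F p r.

Let Bsb : bilform Bs. Proof. by rewrite Bs_def; apply: killing_sigma_form. Qed.
Let Bb : bilform B. Proof. by rewrite B_def; apply: killing_form. Qed.
Let BsC : {in g &, forall X Y, Bs X Y = Bs Y X}.
Proof. rewrite Bs_def; exact: killing_sigmaC. Qed.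
Let Bs_E X Y : Bs X Y = - B X (sg Y). Proof. by rewrite Bs_def B_def. Qed.
Let B_inv : {in g & &, forall X Y W, B (br X Y) W = B X (br Y W)}.
Proof. rewrite B_def; exact: killing_inv. Qed.
Let B_sg : {in g &, forall X Y, B (sg X) (sg Y) = B X Y}.
Proof. rewrite B_def; exact: (gkilling_sgsg brb br_g sgl sg_g sgK sg_br). Qed.
Let Bs_gt0 X Y : X \in g -> Y \in g -> br X Y != 0 -> 0 < Bs X X.
Proof. rewrite Bs_def; exact: killing_sigma_gt0. Qed.
Let Bs_wt al be X Y : X \in g -> Y \in g -> wt al X -> wt be Y -> al != be ->
  Bs X Y = 0.
Proof. rewrite Bs_def; exact: killing_sigma_wt. Qed.
Let Bs_par X Y : X \in g -> Y \in g -> is_evn a X -> is_odn a Y -> Bs X Y = 0.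
Proof. rewrite Bs_def; exact: killing_sigma_parity. Qed.

Lemma simple_root0 d (p0 : (0 < p)%N) :
  form_eval (simple_root R p 0) d = d 0 (Ordinal p0).
Proof. exact: (form_eval_omega (Ordinal p0)). Qed.
Lemma simple_rootS d k (kp : (k.+1 < p)%N) (kp' : (k < p)%N) :
  form_eval (simple_root R p k.+1) d = d 0 (Ordinal kp) - d 0 (Ordinal kp').
Proof.
by rewrite form_evalB (form_eval_omega (Ordinal kp)) (form_eval_omega (Ordinal kp')).
Qed.

Let zt (t : T) := form_eval (lam t) Z.
Let zt_bar t : zt (bar t) = - zt t. Proof. by rewrite /zt lam_bar form_evalN. Qed.

Let Z_mono (i j : 'I_p) : (i <= j)%N -> Z 0 i <= Z 0 j.
Proof.
case: i j => i ip [j jp] /=; elim: j jp => [|j IH] jp.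
  by rewrite leqn0 => /eqP i0; subst i; rewrite (bool_irrelevance ip jp).
rewrite leq_eqVlt => /predU1P[ij|ij]; first by subst i; rewrite (bool_irrelevance ip jp).
apply: le_trans (IH (ltnW jp) ij) _.
by have := Z_simple (Ordinal jp); rewrite /= (simple_rootS _ jp (ltnW jp)) subr_ge0.
Qed.

Let Z_ge0 (i : 'I_p) : 0 <= Z 0 i.
Proof.
have p0 : (0 < p)%N by apply: leq_ltn_trans (ltn_ord i).
apply: le_trans (Z_mono (i := Ordinal p0) (leq0n i)).
by have := Z_simple (Ordinal p0); rewrite /= simple_root0.
Qed.

(* The elements of a on which every root vanishing on Z vanishes. *)
Definition flat d := forall u v : T, zt u = zt v ->
  form_eval (lam u) d = form_eval (lam v) d.

(** The coordinates of [Z] are nonnegative and nondecreasing. Two equal ones are therefore linked by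
    a chain of simple roots vanishing on [Z], and a relation between opposite coordinates forces
    both to be 0. *)
Lemma flatP d : flat d <-> forall k : 'I_p, form_eval (simple_root R p k) Z = 0 ->
  form_eval (simple_root R p k) d = 0.
Proof.
split=> [fd [k kp]|sd].
  case: k kp => [|k] kp /=; rewrite ?simple_root0 ?(simple_rootS _ kp (ltnW kp)) => Zk.
    have := fd (inl (Ordinal kp)) (inr (inr (Ordinal r_gt0))).
    by rewrite /zt !form_eval_lam; apply.
  apply/eqP; rewrite subr_eq0; apply/eqP; move/eqP: Zk; rewrite subr_eq0 => /eqP Zk.
  have := fd (inl (Ordinal kp)) (inl (Ordinal (ltnW kp))).
  by rewrite /zt !form_eval_lam; apply.
have eq_d (i j : 'I_p) : (i <= j)%N -> Z 0 i = Z 0 j -> d 0 i = d 0 j.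
  case: i j => i ip [j jp] /=; elim: j jp => [|j IH] jp.
    by rewrite leqn0 => /eqP i0; subst i; rewrite (bool_irrelevance ip jp).
  rewrite leq_eqVlt => /predU1P[ij|ij]; first by subst i; rewrite (bool_irrelevance ip jp).
  move=> Zij; have jp' := ltnW jp.
  have Zj : Z 0 (Ordinal jp') = Z 0 (Ordinal jp).
    apply/eqP; rewrite eq_le (@Z_mono (Ordinal jp') (Ordinal jp)) //= -Zij.
    exact: (@Z_mono (Ordinal ip) (Ordinal jp')).
  rewrite (IH jp' ij) ?Zj//.
  have := sd (Ordinal jp); rewrite /= !(simple_rootS _ jp jp') Zj subrr => /(_ erefl).
  by move/eqP; rewrite subr_eq0 => /eqP.
have {}eq_d (i j : 'I_p) : Z 0 i = Z 0 j -> d 0 i = d 0 j.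
  by case: (leqP i j) => [/eq_d//|/ltnW/eq_d H] /esym/H.
have d0 (i : 'I_p) : Z 0 i = 0 -> d 0 i = 0.
  move=> Zi; have p0 : (0 < p)%N by apply: leq_ltn_trans (ltn_ord i).
  have Z00 : Z 0 (Ordinal p0) = 0.
    apply/eqP; rewrite eq_le Z_ge0 andbT -Zi; exact: (@Z_mono (Ordinal p0)).
  rewrite (eq_d i (Ordinal p0)) ?Zi ?Z00//.
  by have := sd (Ordinal p0); rewrite /= !simple_root0; apply.
have opp0 (i j : 'I_p) : Z 0 i = - Z 0 j -> d 0 i = 0 /\ d 0 j = 0.
  by move=> Zij; have := Z_ge0 i; have := Z_ge0 j => ? ?; split; apply: d0; lra.
move=> u v; rewrite /zt !form_eval_lam.
case: u v => [i|[i|i]] [j|[j|j]] //.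
- exact: eq_d.
- by move/opp0 => [-> ->]; rewrite oppr0.
- exact: d0.
- by move/esym/opp0 => [-> ->]; rewrite oppr0.
- by move/oppr_inj/eq_d->.
- by move/eqP; rewrite oppr_eq0 => /eqP/d0->; rewrite oppr0.
- by move/esym/d0.
- by move/esym/eqP; rewrite oppr_eq0 => /eqP/d0->; rewrite oppr0.
Qed.

Definition gpos X := X \in g /\ supp (fun u v => zt v < zt u) X.
Definition gzero X := X \in g /\ supp (fun u v => zt u = zt v) X.

Lemma gpos_lin : lin_closed gpos.
Proof. by apply: lin_closedI; [apply: lin_closed_vs | apply: lin_closed_supp]. Qed.

Lemma gzero_sg X : gzero X -> gzero (sg X).
Proof.
by move=> [Xg sX]; split; [exact: sg_g | move=> u v /(supp_sg sX)].
Qed.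

Lemma gpos_br X Y : gpos X -> gpos Y -> gpos (br X Y).
Proof.
move=> [Xg sX] [Yg sY]; split; first exact: br_g.
by apply: (supp_br sX sY) => u t v ut tv; apply: lt_trans tv ut.
Qed.

Lemma gpos_br0 X Y : gpos X -> gzero Y -> gpos (br X Y).
Proof.
move=> [Xg sX] [Yg sY]; split; first exact: br_g.
by apply: (supp_br sX sY) => u t v; [move=> ? <- | move=> -> ].
Qed.

Lemma g_triangular X : X \in g -> exists Xp X0 Xm,
  [/\ gpos Xp, gzero X0, gpos (sg Xm) & X = Xp + X0 + Xm].
Proof.
move=> Xg; exists (cutoff (fun u v => zt v < zt u) X),
  (cutoff (fun u v => zt u == zt v) X), (cutoff (fun u v => zt u < zt v) X); split.
- split; last exact: supp_cutoff.
  by apply: cutoff_g => // [u v|u v]; rewrite ?ltxx// !zt_bar ltrN2.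
- split; last by move=> u v /(@supp_cutoff _ _ _ (fun u v => zt u == zt v)) /eqP.
  by apply: cutoff_g => // [u v|u v]; rewrite ?eqxx// !zt_bar eqr_opp eq_sym.
- split.
    apply: sg_g; apply: cutoff_g => // [u v|u v]; rewrite ?ltxx//.
    by rewrite !zt_bar ltrN2.
  exact: (supp_sg (@supp_cutoff _ _ _ (fun u v => zt u < zt v) X)).
- apply: ent_inj => u v; rewrite !entD !ent_cutoff.
  by case: (ltgtP (zt u) (zt v)) => _; rewrite ?addr0 ?add0r.
Qed.

(** Compared weight by weight, so that one statement separates g_+ both from g_0 and from
    sigma(g_+). *)
Lemma Bs_disjoint (P Q : pred R) X Y : X \in g -> Y \in g ->
  supp (fun u v => P (zt u - zt v)) X -> supp (fun u v => Q (zt u - zt v)) Y ->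
  (forall x, P x -> ~~ Q x) -> Bs X Y = 0.
Proof.
move=> Xg Yg sX sY PQ.
rewrite (sum_proj X) (b_suml Bsb) big1// => al _.
rewrite (sum_proj Y) (b_sumr Bsb) big1// => be _.
have [albe|nab] := eqVneq al be; last first.
  exact: (Bs_wt (proj_g al Xg) (proj_g be Yg) (@proj_wt _ _ _ al X) (@proj_wt _ _ _ be Y) nab).
subst be; have [Pal|nPal] := boolP (P (form_eval al Z)).
  rewrite [proj al Y](_ : _ = 0) ?(b0r Bsb)//.
  apply: (@supp_ent0 _ _ _ (fun u v => Q (zt u - zt v) /\ lam u - lam v = al)) => [u v nz|u v].
    by split; [exact: (@supp_proj _ _ _ _ al Y sY u v nz) | exact: (@proj_wt _ _ _ al Y u v nz)].
  by move=> [QZ E]; move: QZ; rewrite -form_evalB E (negPf (PQ _ Pal)).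
rewrite [proj al X](_ : _ = 0) ?(b0l Bsb)//.
apply: (@supp_ent0 _ _ _ (fun u v => P (zt u - zt v) /\ lam u - lam v = al)) => [u v nz|u v].
  by split; [exact: (@supp_proj _ _ _ _ al X sX u v nz) | exact: (@proj_wt _ _ _ al X u v nz)].
by move=> [QZ E]; move: QZ; rewrite -form_evalB E (negPf nPal).
Qed.

Lemma Bs_pos_zero X Y : gpos X -> gzero Y -> Bs X Y = 0.
Proof.
move=> [Xg sX] [Yg sY].
apply: (@Bs_disjoint (fun x => 0 < x) (fun x => x == 0)) => //.
- by move=> u v /sX; rewrite subr_gt0.
- by move=> u v /sY ->; rewrite subrr.
- by move=> x /lt0r_neq0.
Qed.

Lemma Bs_pos_neg X Y : gpos X -> gpos (sg Y) -> Bs X Y = 0.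
Proof.
move=> [Xg sX] [sYg sY]; have Yg : Y \in g by rewrite -[Y]sgK; apply: sg_g.
apply: (@Bs_disjoint (fun x => 0 < x) (fun x => x < 0)) => //.
- by move=> u v /sX; rewrite subr_gt0.
- by move=> u v; rewrite subr_lt0 -[Y]sgK => /(supp_sg sY).
- by move=> x x0; rewrite -leNgt ltW.
Qed.

(** [amx r Z] itself witnesses that [X] is not central, all eigenvalues of ad Z on g_+ being
    positive. *)
Lemma gpos_gt0 X : gpos X -> X != 0 -> 0 < Bs X X.
Proof.
move=> [Xg sX] X0; apply: (Bs_gt0 Xg (amxg Z)).
rewrite brC oppr_eq0; apply: contra X0 => /eqP bX; apply/eqP.
apply: (supp_ent0 (P := fun _ _ => False)) => [u v nz|u v []].
have := congr1 (fun Y => ent Y u v) bX; rewrite ent_br_amx ent0 => /eqP.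
rewrite scaler_eq0 (negPf nz) orbF form_evalB subr_eq0 => /eqP E.
by have := sX u v nz; rewrite /zt E ltxx.
Qed.

Lemma amx_gt0 d : amx r d != 0 -> 0 < Bs (amx r d) (amx r d).
Proof.
move=> d0; have [k dk] : exists k, d 0 k != 0.
  apply: contrapT => nk; case/eqP: d0.
  have -> : d = 0.
    apply/rowP => k; rewrite mxE; apply/eqP; apply: contraT => dk.
    by case: nk; exists k.
  exact: (lfE0 (@amx_lin R p r)).
have [X [Xg wX X0]] := @omega_vector R F p r k r_gt0.
apply: (Bs_gt0 (amxg d) Xg); rewrite (wt_br d wX) form_eval_omega.
by rewrite scaler_eq0 negb_or dk.
Qed.

Lemma wt_brD al be X Y : wt al X -> wt be Y -> wt (al + be) (br X Y).
Proof.
move=> wX wY; apply: (supp_br wX wY) => u t v <- <-; last rewrite [RHS]addrC.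
  by rewrite addrA subrK.
by rewrite addrA subrK.
Qed.

Lemma wt_sg al X : wt al X -> wt (- al) (sg X).
Proof. by move=> wX u v /(supp_sg wX) <-; rewrite opprB. Qed.

Lemma wt_amx d : wt 0 (amx r d).
Proof.
move=> u v; rewrite ent_amx; case: (eqVneq u v) => [-> _|_]; first by rewrite subrr.
by rewrite scale0r eqxx.
Qed.

Lemma gpos_basis : exists e : seq V, [/\ orthonormal_seq Bs e,
  forall x, x \in e -> exists al,
    [/\ wt al x, al \in pos_roots R F p & 0 < form_eval al Z],
  forall x, x \in e -> gpos x,
  forall x, x \in e -> is_evn a x \/ is_odn a x &
  forall X, gpos X -> X \in <<e>>%VS].
Proof.
pose U (k : 'rV[R]_p * bool) X :=
  gpos X /\ (wt k.1 X /\ supp (fun u v => (par a u != par a v) = k.2) X).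
have [|k|k x y [px _] [py _]|k x [px _]|[al b] [be c] x y|e [oe eU Ue]] :=
    @graded_orthonormal_basis _ _ Bs _ U.
- exact: Bsb.
- apply: lin_closedI; first exact: gpos_lin.
  by apply: lin_closedI; apply: lin_closed_supp.
- exact: BsC px.1 py.1.
- exact: gpos_gt0.
- rewrite /U /= => ne [[xg _] [wx cx]] [[yg _] [wy cy]].
  have [albe|nab] := eqVneq al be; last exact: (Bs_wt xg yg wx wy nab).
  subst be; move: ne; rewrite xpair_eqE eqxx /=.
  case: b cx => cx; case: c cy => cy // _.
    by rewrite (BsC xg yg); apply: Bs_par => // u v nz; move: (cy _ _ nz) => /negbFE.
  by apply: Bs_par => // u v nz; move: (cx _ _ nz) => /negbFE.
exists e; split=> //.
- move=> x xe; have [[al b] [[xg sx] [wx _]]] := eU x xe; exists al.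
  have [u [v nz]] : exists u v, ent x u v != 0.
    apply: contrapT => nE; have : x = 0.
      apply: (supp_ent0 (P := fun _ _ => False)) => [u v nz|u v []].
      by case: nE; exists u, v.
    move=> x0; have := oe.2 x x xe xe; rewrite eqxx x0 (b0l Bsb) => /eqP.
    by rewrite eq_sym oner_eq0.
  have al_E : lam u - lam v = al := wx u v nz; have lt_uv := sx u v nz; split=> //; rewrite -al_E.
    exact: (root_mem Z_ge0 (@Z_mono) xg nz lt_uv).
  by rewrite form_evalB subr_gt0.
- by move=> x /eU[k []].
- move=> x /eU[[al b] [_ [_ cx]]]; case: b cx => cx; [right|left] => u v /cx //.
  by move/negbFE.
- move=> X pX; rewrite (sum_proj X); apply: memv_suml => al _.
  have pP : gpos (proj al X).
    by split; [apply: proj_g pX.1 | apply: supp_proj pX.2].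
  rewrite (evn_odn a (proj al X)); apply: memvD.
    apply: (Ue (al, false)); split; last split.
    + by split; [exact: evn_g pP.1 | apply: supp_evn pP.2].
    + exact: supp_evn (@proj_wt _ _ _ al X).
    + by move=> u v /evn_supp ->.
  apply: (Ue (al, true)); split; last split.
  + by split; [exact: odn_g pP.1 | apply: supp_odn pP.2].
  + exact: supp_odn (@proj_wt _ _ _ al X).
  + by move=> u v /odn_supp ->.
Qed.

(* The inner product of s on a. *)
Definition Bs2 X Y := 2 * Bs X Y.

Lemma Bs2_form : bilform Bs2.
Proof.
split=> W c X Y; rewrite /Bs2.
  by rewrite (bDl Bsb) (fZl _ _ _ Bsb) mulrDr -[RHS]/(c * _ + _); ring.
by rewrite (bDr Bsb) (fZr _ _ _ Bsb) mulrDr -[RHS]/(c * _ + _); ring.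
Qed.

(** Applied to the flat elements for a basis of a_Lambda', and to the constant predicate for a basis
    of all of a. *)
Lemma amx_basis (P : 'rV[R]_p -> Prop) :
  (P 0 /\ forall c d d', P d -> P d' -> P (c *: d + d')) ->
  exists f : seq V, [/\ orthonormal_seq Bs2 f,
    forall A, A \in f -> exists2 d, P d & A = amx r d &
    forall d, P d -> amx r d \in <<f>>%VS].
Proof.
move=> [P0 PD].
have [|k|k x y [d _ ->] [d' _ ->]|k x [d _ ->] d0|[] []//|f [of_ fU Uf]] :=
    @graded_orthonormal_basis _ _ Bs2 unit (fun _ X => exists2 d, P d & X = amx r d).
- exact: Bs2_form.
- split=> [|c X Y [d Pd ->] [d' Pd' ->]].
    by exists 0 => //; rewrite (lfE0 (@amx_lin R p r)).
  by exists (c *: d + d'); [exact: PD | rewrite amx_lin].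
- by rewrite /Bs2 (BsC (amxg d) (amxg d')).
- by rewrite /Bs2 mulr_gt0 ?amx_gt0.
exists f; split=> // [A /fU[_]//|d Pd].
by apply: (Uf tt); exists d.
Qed.

Section TraceForm.
Variables (e f : seq V).
Hypothesis oe : orthonormal_seq Bs e.
Hypothesis e_wt : forall x, x \in e -> exists al,
  [/\ wt al x, al \in pos_roots R F p & 0 < form_eval al Z].
Hypothesis e_pos : forall x, x \in e -> gpos x.
Hypothesis pos_e : forall X, gpos X -> X \in <<e>>%VS.
Hypothesis of_ : orthonormal_seq Bs2 f.
Hypothesis f_flat : forall A, A \in f -> exists2 d, flat d & A = amx r d.
Hypothesis flat_f : forall d, flat d -> amx r d \in <<f>>%VS.

Let eg x : x \in e -> x \in g. Proof. by move/e_pos => -[]. Qed.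
Let gpos_g X : gpos X -> X \in g. Proof. by case. Qed.
Let Bs_gk : Bs = gkilling_sg br g sg. Proof. by rewrite Bs_def. Qed.

Let chi := trace_gp br Bs e.
Let chi_lin : scalar chi := trace_gp_form brb sgl Bs_gk e.

Let B_Bs d X : B X (amx r d) = Bs X (amx r d).
Proof. by rewrite Bs_E amx_sg (bNr Bb) opprK. Qed.

Lemma trace_gp_wt al X : X \in g -> wt al X -> al != 0 -> chi X = 0.
Proof.
move=> Xg wX al0; rewrite /chi /trace_gp big_seq big1// => x xe.
have [be [wx _ _]] := e_wt xe.
apply: (Bs_wt (eg xe) (br_g Xg (eg xe)) wx (wt_brD wX wx)).
by rewrite eq_sym -subr_eq0 addrK.
Qed.

(** The element A0 representing chi exists in a by duality. That it is flat is the step that allows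
    an arbitrary Lambda'. *)
Lemma trace_gp_dual : exists2 d0, flat d0 &
  forall Y, Y \in g -> chi Y = B Y (amx r d0).
Proof.
have [f0 [of0 f0_amx amx_f0]] := @amx_basis (fun _ => True) (conj I (fun _ _ _ _ _ => I)).
(* The factor 2 compensates for expanding in a basis orthonormal for 2 B_sigma while representing
   chi by B. *)
have [d0 A0_E] : exists d0, \sum_(A <- f0) (2 * chi A) *: A = amx r d0.
  rewrite big_seq; elim/big_rec: _ => [|A X Af [d ->]].
    by exists 0; rewrite (lfE0 (@amx_lin R p r)).
  have [d' _ ->] := f0_amx A Af.
  by exists ((2 * chi (amx r d')) *: d' + d); rewrite amx_lin.
have chi_amx d : chi (amx r d) = B (amx r d) (amx r d0).
  rewrite B_Bs -A0_E (b_sumr Bsb) [in LHS](orthonormal_expand Bs2_form of0 (amx_f0 d I)).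
  rewrite (lfE_sum (W := R^o) chi_lin); apply: eq_bigr => A _.
  rewrite (lfEZ (W := R^o) chi_lin) (fZr _ _ _ Bsb) /Bs2.
  by rewrite -[_ *: _]/(2 * Bs (amx r d) A * chi A); ring.
(* Both sides vanish on nonzero weights. On weight 0 both are odd under [sg], so they are determined
   by [Y0 - sg Y0], which lies in a. *)
have chi_B Y : Y \in g -> chi Y = B Y (amx r d0).
  move=> Yg; rewrite [in LHS](sum_proj Y) [in RHS](sum_proj Y) (lfE_sum (W := R^o) chi_lin) (b_suml Bb).
  apply: eq_bigr => al _; have Pg := proj_g al Yg; have wP := @proj_wt _ _ _ al Y.
  have [al0|al0] := eqVneq al 0; last first.
    rewrite (trace_gp_wt Pg wP al0) B_Bs.
    by rewrite (Bs_wt Pg (amxg d0) wP (@wt_amx d0) al0).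
  subst al; set Y0 := proj 0 Y in Pg wP *.
  have sYg := sg_g Pg.
  have wsY : wt 0 (sg Y0) by rewrite -[X in wt X]oppr0; apply: wt_sg.
  have chi_sg X : X \in g -> chi (sg X) = - chi X.
    exact: (trace_gp_sg brb brC jacobi br_g sgl sg_g sgK sg_br Bs_gk gpos_g e_pos).
  have B_sgA X : X \in g -> B (sg X) (amx r d0) = - B X (amx r d0).
    move=> Xg; rewrite -(B_sg Xg (amxg d0)) amx_sg (bNr Bb) opprK.
    by [].
  have [d Y0d] : exists d, Y0 - sg Y0 = amx r d.
    apply: (@weight0_amx R F); first exact: (lin_closedB (lin_closed_vs g) Pg sYg).
    - exact: (lin_closedB (@lin_closed_supp R p r (fun u v => lam u - lam v = 0)) wP wsY).
    - by rewrite (lfEB sgl) sgK opprB.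
  have := chi_amx d; rewrite -Y0d (lfEB (W := R^o) chi_lin) (bBl Bb) B_sgA// chi_sg//.
  by lra.
(* A root vector X for a simple root vanishing on [Z] lies in g_0, so 0 = chi([X, sg X]) is the
   value of that root at A0 times the nonzero number B(X, sg X), up to sign. *)
exists d0 => //; apply/flatP => k Zk.
have [X [Xg wX X0]] := @simple_root_vector R F p r k r_gt0.
have zX : gzero X.
  split=> // u v /wX E; apply/eqP; rewrite -subr_eq0 /zt -form_evalB E.
  by rewrite Zk.
have pos_ad W : gzero W -> forall Y, gpos Y -> gpos (br W Y).
  move=> zW Y pY; rewrite brC; apply: lin_closedN; first exact: gpos_lin.
  exact: gpos_br0.
have chi0 : chi (br X (sg X)) = 0.
  exact: (trace_gp_br0 brb brC jacobi br_g sgl sg_g sgK sg_br Bs_gk gpos_g oe e_pos pos_e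
    Xg (pos_ad X zX) (pos_ad _ (gzero_sg zX))).
have sXg := sg_g Xg.
move: chi0; rewrite chi_B ?br_g// (B_inv Xg sXg (amxg d0)) brC (wt_br d0 (wt_sg wX)).
rewrite form_evalN scaleNr opprK (fZr _ _ _ Bb) => /eqP; rewrite mulf_eq0 => /orP[/eqP//|].
have : 0 < Bs X X.
  apply: (Bs_gt0 Xg (amxg (rho R p))); rewrite brC oppr_eq0 (wt_br _ wX).
  rewrite scaler_eq0 negb_or X0 andbT gt_eqF//.
  case: (k) => -[|j] jp /=; first by rewrite simple_root0 mxE ltr0Sn.
  by rewrite (simple_rootS _ jp (ltnW jp)) !mxE subr_gt0 ltr_nat.
by rewrite Bs_E oppr_gt0 => /lt_eqF ->.
Qed.

Definition ad_eigenvalue A x := Bs (br A x) x.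
Local Notation w := ad_eigenvalue.

Lemma br_amx_e d x : x \in e -> br (amx r d) x = w (amx r d) x *: x.
Proof.
move=> xe; have [al [wx _ _]] := e_wt xe.
by rewrite /w (wt_br d wx) (fZl _ _ _ Bsb) oe.2// eqxx mulr1.
Qed.

Lemma sum_ad_eigenvalue : {in f &, forall A A',
  \sum_(x <- e) w A x * w A' x = 4^-1 * (A == A')%:R}.
Proof.
move=> A A' Af A'f; have [d _ AE] := f_flat Af; have [d' fd' A'E] := f_flat A'f.
have := of_.2 A A' Af A'f; rewrite /Bs2 => <-.
have flat0 W : gzero W -> br (amx r d') W = 0.
  move=> [_ zW]; apply: ent_inj => u v; rewrite ent_br_amx ent0.
  have [->|/zW/fd' E] := eqVneq (ent W u v) 0; first by rewrite scaler0.
  by rewrite form_evalB E subrr scale0r.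
have := gkilling_flat brb br_g sgl sg_g sgK sg_br Bs_gk gpos_lin gpos_g gzero_sg
  g_triangular Bs_pos_zero Bs_pos_neg oe e_pos pos_e (amxg d) (amxg d') (amx_sg r d)
  (amx_sg r d') flat0.
rewrite -[gkilling _ _ _ _]/(@killing R F p r _ _) -B_def B_Bs -AE -A'E => ->.
(* One factor 2 comes from the metric on a, the other from the two halves g_+ and sigma(g_+). *)
rewrite (_ : 4^-1 * (2 * (2 * _)) = \sum_(x <- e) Bs x (br A (br A' x))); last by field.
rewrite !big_seq; apply: eq_bigr => x xe; rewrite AE A'E.
rewrite (br_amx_e d' xe) (bZr brb) (br_amx_e d xe) !(fZr _ _ _ Bsb) oe.2// eqxx.
by apply: etrans (mulrC _ _) _; congr (_ * _); apply/esym/mulr1.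
Qed.

Lemma ricci_gpos : {in e &, forall x y,
  \sum_(z <- e) \sum_(m <- e)
    (- 2^-1 * (Bs (br x z) m * Bs (br y z) m) + 4^-1 * (Bs (br z m) x * Bs (br z m) y))
  = (- 4^-1 + \sum_(A <- f) (\sum_(z <- e) w A z) * w A x) * (x == y)%:R}.
Proof.
move=> x y xe ye; have [d0 fd0 chiB] := trace_gp_dual.
have [xg yg] := (eg xe, eg ye); have syg := sg_g yg.
rewrite (ricci_gp brb brC jacobi br_g sgl sg_g sgK sg_br Bs_gk gpos_lin gpos_g
  gzero_sg gpos_br gpos_br0 g_triangular Bs_pos_zero Bs_pos_neg oe e_pos pos_e
  (e_pos xe) (e_pos ye)).
(* By duality chi([sg y, x]) = B([sg y, x], A0), and invariance moves the bracket onto A0 and [x], a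
   root vector. *)
have -> : trace_gp br Bs e (br (sg y) x) = w (amx r d0) x * Bs x y.
  rewrite -/(chi _) chiB ?br_g// (B_inv syg xg (amxg d0)) brC (br_amx_e d0 xe).
  rewrite (bNr Bb) (fZr _ _ _ Bb) Bs_E mulrN; congr (- (_ * _)).
  by rewrite B_def; apply: (gkillingC brb br_g).
(* The coefficient of A0 along [A] is 2 Bs(A0, A), that is, twice the trace of ad A on g_+. This
   factor absorbs the 1/2 in front of chi. *)
have -> : w (amx r d0) x = 2 * \sum_(A <- f) (\sum_(z <- e) w A z) * w A x.
  rewrite /w [in LHS](orthonormal_expand Bs2_form of_ (flat_f fd0)) (b_suml brb) (b_suml Bsb).
  rewrite mulr_sumr !big_seq; apply: eq_bigr => A Af; have [d _ AE] := f_flat Af.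
  rewrite (bZl brb) (fZl _ _ _ Bsb) /Bs2 -mulrA; congr (_ * (_ * _)).
  rewrite (BsC (amxg d0)) AE ?amxg// -B_Bs -chiB ?amxg//.
  rewrite /chi /trace_gp !big_seq; apply: eq_bigr => z ze.
  by rewrite (BsC (eg ze)) ?br_g ?amxg ?eg.
by rewrite oe.2//; field.
Qed.

End TraceForm.

End Parabolic.

(** * Membership in spans and sums; forms admitting an orthonormal family *)

Section VectorSpaceFacts.
Variables (R : realType) (E : vectType R).

Lemma lspan_ind (G P : E -> Prop) : lin_closed P -> (forall x, G x -> P x) ->
  forall x, x \in lspan G -> P x.
Proof.
move=> Pl GP x xG; apply: (mem_lspan Pl); move: x xG; apply/subvP.
by apply: lspan_subv => x /GP Px; apply: memv_lspan.
Qed.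

Lemma memv_big_sum (I : eqType) (s : seq I) (Q : pred I) (U : I -> {vspace E}) i x :
  i \in s -> Q i -> x \in U i -> x \in (\sum_(j <- s | Q j) U j)%VS.
Proof.
move=> + Qi xi; elim: s => // j s IH; rewrite inE big_cons => /predU1P[<-|/IH xs].
  by rewrite Qi; apply: (subvP (addvSl _ _)).
by case: ifP => // _; apply: (subvP (addvSr _ _)).
Qed.

Lemma big_sum_ind (I : Type) (s : seq I) (Q : pred I) (U : I -> {vspace E}) (P : E -> Prop) :
  lin_closed P -> (forall i x, Q i -> x \in U i -> P x) ->
  forall x, x \in (\sum_(j <- s | Q j) U j)%VS -> P x.
Proof.
move=> Pl UP; elim/big_rec: _ => [|i V Qi IH] x; first by rewrite memv0 => /eqP->; apply: Pl.1.
by move=> /memv_addP[y yi [z zV ->]]; apply: lin_closedD => //; [apply: UP yi | apply: IH].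
Qed.

Variables (ip : E -> E -> R) (e : seq E).
Hypotheses (ipb : bilform ip) (oe : orthonormal_seq ip e).

(** A form is determined on the span by its values on an orthonormal family. This yields symmetry of
    [ip_sa] on the attached algebra, and [orthonormal_gt0] its positivity. *)
Lemma orthonormal_sym : {in <<e>>%VS &, forall X Y, ip X Y = ip Y X}.
Proof.
move=> X Y Xe Ye; rewrite (parseval _ ipb oe Xe) [RHS](parseval _ ipb oe Ye).
have E1 U W : U \in <<e>>%VS -> W \in e -> ip W U = ip U W.
  move=> + We; move: U; apply: span_ind => [|v ve]; last by rewrite !oe.2// eq_sym.
  split=> [|c v v' Ev Ev']; first by rewrite (b0l ipb) (b0r ipb).
  by rewrite (bDl ipb) (bDr ipb) (fZl _ _ _ ipb) (fZr _ _ _ ipb) Ev Ev'.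
rewrite !big_seq; apply: eq_bigr => W We.
by rewrite (E1 Y) ?(E1 X)// mulrC.
Qed.

Lemma orthonormal_gt0 X : X \in <<e>>%VS -> X != 0 -> 0 < ip X X.
Proof.
move=> Xe X0; have E1 : ip X X = \sum_(W <- e) ip X W ^+ 2.
  rewrite (parseval _ ipb oe Xe) !big_seq; apply: eq_bigr => W We.
  by rewrite (orthonormal_sym (memv_span We) Xe) expr2.
rewrite lt_neqAle E1 sumr_ge0 ?andbT => [|W _]; last exact: sqr_ge0.
apply: contra X0 => /eqP/esym S0; rewrite (orthonormal_expand ipb oe Xe).
rewrite big_seq big1// => W We.
have : \sum_(W <- e | W \in e) ip X W ^+ 2 == 0 by rewrite -big_seq S0.
rewrite psumr_eq0 => [/allP /(_ W We)|V _]; last exact: sqr_ge0.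
by rewrite We sqrf_eq0 => /eqP ->; rewrite scale0r.
Qed.

End VectorSpaceFacts.

Definition jacobiator (K : fieldType) (E : vectType K) (f : E -> E -> E) X Y W :=
  f X (f Y W) + f Y (f W X) + f W (f X Y).

Lemma jacobiator_cyc (K : fieldType) (E : vectType K) (f : E -> E -> E) X Y W :
  jacobiator f X Y W = jacobiator f Y W X.
Proof. by rewrite /jacobiator -[LHS]addrA [LHS]addrC. Qed.

Lemma jacobiatorD (K : fieldType) (E : vectType K) (f : E -> E -> E) X X' Y W :
  bilin f -> jacobiator f (X + X') Y W = jacobiator f X Y W + jacobiator f X' Y W.
Proof.
move=> fb; rewrite /jacobiator !(bDl fb, bDr fb).
by rewrite [X in X + _ = _]addrACA [LHS]addrACA.
Qed.

(** * The attached subalgebras of s_a *)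

Section Complexification.
Variables (R : realType) (p r a : nat).
Local Notation n := (p + (p + r))%N.
Local Notation T := ('I_p + ('I_p + 'I_r))%type.
Local Notation V := (hmx R n).
Local Notation VC := (V * V)%type.
Local Notation br := (@comm_br R p r).
Local Notation brC := (@comm_brC R p r).
Implicit Types (X Y W : V) (U : VC).

Let brb := @comm_br_bilin R p r.

(* On s this is the isometry onto s_a: W_b is the odd part of n. *)
Definition phi X : VC := (evn a X, odn a X).
Definition iota_C (b : bool) X : VC := if b then tensor_sqrtm1 X else tensor1 X.
Definition of_parity (b : bool) X := supp (fun u v => (par a u != par a v) = b) X.

Lemma phi_lin : linear phi.
Proof. by move=> c X Y; rewrite /phi /evn /odn !cutoff_lin. Qed.

Lemma to_s_phi X : to_s (phi X) = X.
Proof. exact/esym/evn_odn. Qed.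

Lemma phi_span (t : seq V) X : X \in <<t>>%VS -> phi X \in <<map phi t>>%VS.
Proof.
move: X; apply: span_ind => [|x xt]; last exact/memv_span/map_f.
split=> [|k x y xt yt]; first by rewrite (lfE0 phi_lin) mem0v.
by rewrite phi_lin; apply: memvD yt; apply: memvZ.
Qed.

Lemma amx_parity d : of_parity false (amx r d).
Proof.
move=> u v; rewrite ent_amx; case: (eqVneq u v) => [->|_]; first by rewrite eqxx.
by rewrite scale0r eqxx.
Qed.

Lemma exists_parity X : is_evn a X \/ is_odn a X -> exists b, of_parity b X.
Proof. by case=> pX; [exists false | exists true] => u v /pX // ->. Qed.

Lemma phi_of_parity b X : of_parity b X -> phi X = iota_C b X.
Proof.
have cut0 (Q : T -> T -> bool) : supp (fun u v => ~~ Q u v) X -> cutoff Q X = 0.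
  move=> sX; apply: ent_inj => u v; rewrite ent_cutoff ent0; case: ifP => // Quv.
  by apply/eqP; apply: contraT => /sX; rewrite Quv.
rewrite /phi /iota_C; case: b => hX; congr pair.
- by apply: cut0 => u v /hX.
- by apply: cutoff_supp => u v /hX.
- by apply: cutoff_supp => u v /hX /negbFE.
- by apply: cut0 => u v /hX ->.
Qed.

Lemma of_parity_br b c X Y : of_parity b X -> of_parity c Y -> of_parity (b (+) c) (br X Y).
Proof.
move=> hX hY; apply: (supp_br hX hY) => u t v <- <-;
  by case: (par a u); case: (par a t); case: (par a v).
Qed.

Lemma comm_brC_lin_l U' : linear (brC^~ U').
Proof.
move=> c X Y; rewrite /comm_brC /=; congr pair; rewrite !(bDl brb, bZl brb).
  by rewrite opprD addrACA -scalerBr.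
by rewrite addrACA -scalerDr.
Qed.

Lemma comm_brC_antisym U U' : brC U U' = - brC U' U.
Proof.
rewrite /comm_brC -[RHS]/(- _, - _); congr pair; rewrite [RHS]opprD.
  by rewrite (comm_br_antisym U.1 U'.1) (comm_br_antisym U.2 U'.2).
by rewrite (comm_br_antisym U.1 U'.2) (comm_br_antisym U.2 U'.1); apply: addrC.
Qed.

Lemma comm_brC_bilin : bilin brC.
Proof.
split=> [|U c X Y]; first exact: comm_brC_lin_l.
rewrite (comm_brC_antisym U (_ + _)) comm_brC_lin_l.
by rewrite (comm_brC_antisym U X) (comm_brC_antisym U Y) scalerN opprD.
Qed.
Let brCb := comm_brC_bilin.

(** Two odd factors multiply [sqrt(-1)] by itself; this is the only source of the signs. *)
Lemma comm_brC_iota b c X Y :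
  brC (iota_C b X) (iota_C c Y) = (-1) ^+ (b && c) *: iota_C (b (+) c) (br X Y).
Proof.
rewrite /iota_C /tensor1 /tensor_sqrtm1 /comm_brC; case: b; case: c => /=;
  by rewrite !(b0l brb, b0r brb) ?expr1 ?expr0 ?scale1r ?scaleN1r ?subr0 ?addr0 ?add0r ?sub0r
     //; congr pair; rewrite oppr0.
Qed.

Lemma comm_brC_phi b c X Y : of_parity b X -> of_parity c Y ->
  brC (phi X) (phi Y) = (-1) ^+ (b && c) *: phi (br X Y).
Proof.
move=> hX hY; rewrite (phi_of_parity hX) (phi_of_parity hY) (phi_of_parity (of_parity_br hX hY)).
exact: comm_brC_iota.
Qed.

Lemma iota_lin b : linear (iota_C b).
Proof.
by move=> c X Y; rewrite /iota_C; case: b; congr pair;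
  rewrite -[RHS]/(c *: (0 : V) + 0) scaler0 addr0.
Qed.

Lemma iota_split U : U = iota_C false U.1 + iota_C true U.2.
Proof. by case: U => X Y; congr pair; rewrite /= ?addr0 ?add0r. Qed.

Lemma comm_brC_jacobi U1 U2 U3 :
  brC U1 (brC U2 U3) + brC U2 (brC U3 U1) + brC U3 (brC U1 U2) = 0.
Proof.
pose J := jacobiator brC; rewrite -[LHS]/(J U1 U2 U3).
have JD (X X' Y W : VC) : J X Y W = 0 -> J X' Y W = 0 -> J (X + X') Y W = 0.
  by move=> J0 J0'; rewrite /J (jacobiatorD X X' Y W brCb) -/J J0 J0' addr0.
have J_cyc (X Y W : VC) : J X Y W = J Y W X by apply: jacobiator_cyc.
(* For pure elements the three terms carry the same sign: its exponent is bc + cd + bd modulo 2, a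
   symmetric expression. The identity then reduces to the one for [br]. *)
have J_pure b c d (X Y W : V) : J (iota_C b X) (iota_C c Y) (iota_C d W) = 0.
  have E b1 b2 b3 (X1 X2 X3 : V) : brC (iota_C b1 X1) (brC (iota_C b2 X2) (iota_C b3 X3)) =
      (-1) ^+ ((b2 && b3) (+) b1 && (b2 (+) b3)) *:
      iota_C (b1 (+) (b2 (+) b3)) (br X1 (br X2 X3)).
    by rewrite comm_brC_iota (bZr brCb) comm_brC_iota scalerA -signr_addb.
  rewrite /J /jacobiator !E.
  have -> : d (+) (b (+) c) = b (+) (c (+) d) by case: b c d => [] [] [].
  have -> : c (+) (d (+) b) = b (+) (c (+) d) by case: b c d => [] [] [].
  have -> : (d && b) (+) c && (d (+) b) = (c && d) (+) b && (c (+) d).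
    by case: b c d => [] [] [].
  have -> : (b && c) (+) d && (b (+) c) = (c && d) (+) b && (c (+) d).
    by case: b c d => [] [] [].
  rewrite -!scalerDr -!(lfED (@iota_lin _)).
  rewrite (_ : _ + _ + _ = 0) ?(lfE0 (@iota_lin _)) ?scaler0//.
  rewrite (comm_br_antisym W (br X Y)) comm_br_jacobi (comm_br_antisym W X) (bNr brb).
  exact: subrr.
rewrite (iota_split U1) (iota_split U2) (iota_split U3).
by apply: (JD); rewrite (J_cyc); apply: (JD); rewrite (J_cyc); apply: (JD);
  rewrite (J_cyc); apply: (J_pure).
Qed.

End Complexification.

(** * The inner product of s on a and on n *)

Section InnerProduct.
Variables (R : realType) (F : base_field) (p r : nat).
Local Notation n := (p + (p + r))%N.
Local Notation V := (hmx R n).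
Local Notation br := (@comm_br R p r).
Local Notation g := (g_ R F p r).
Local Notation lam := (@lam R p r).
Local Notation nn := (n_ R F p r).
Local Notation aa := (a_ R p r).
Implicit Types (X Y : V) (al d : 'rV[R]_p).

Lemma mem_root_space al X : X \in root_space F r al <-> X \in g /\ wt al X.
Proof.
have E Y : (Y \in g /\ forall d, br (amx r d) Y = form_eval al d *: Y) <-> Y \in g /\ wt al Y.
  split=> -[Yg wY]; split=> //; first exact: br_wt.
  by move=> d; apply: wt_br.
split=> [|/E]; last exact: memv_lspan.
move: X; apply: lspan_ind => [|X /E//].
by apply: lin_closedI; [apply: lin_closed_vs | apply: lin_closed_supp].
Qed.

Lemma mem_a X : X \in aa <-> exists d, X = amx r d.
Proof.
split=> [|[d ->]]; last by apply: memv_lspan; exists d.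
move: X; apply: lspan_ind => [|X [d _ <-]]; last by exists d.
split=> [|c X Y [d ->] [d' ->]]; first by exists 0; rewrite (lfE0 (@amx_lin R p r)).
by exists (c *: d + d'); rewrite amx_lin.
Qed.

Lemma n_supp X : X \in nn -> X \in g /\
  supp (fun u v => form_eval (lam v) (rho R p) < form_eval (lam u) (rho R p)) X.
Proof.
rewrite /n_ big_seq; move: X; apply: big_sum_ind => [|al X alp /mem_root_space[Xg wX]].
  by apply: lin_closedI; [apply: lin_closed_vs | apply: lin_closed_supp].
split=> // u v /wX E; rewrite -subr_gt0 -form_evalB E.
exact: pos_root_rho alp.
Qed.

Lemma root_space_n al X : al \in pos_roots R F p -> X \in g -> wt al X -> X \in nn.
Proof.
move=> alp Xg wX; rewrite /n_; apply: (memv_big_sum alp) => //.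
exact/mem_root_space.
Qed.

(** In the eigenbasis a is diagonal and n strictly triangular with respect to [rho]. The projections
    [daddv_pi] in [ip_s] behave as expected because of this. *)
Lemma capv_an : (aa :&: nn = 0)%VS.
Proof.
apply/eqP; rewrite -subv0; apply/subvP => X; rewrite memv_cap memv0.
move=> /andP[/mem_a[d ->] /n_supp[_ sX]]; apply/eqP.
apply: (supp_ent0 (P := fun _ _ => False)) => [u v nz|u v []].
have := sX u v nz; move: nz; rewrite ent_amx; case: (eqVneq u v) => [->|_].
  by rewrite ltxx.
by rewrite scale0r eqxx.
Qed.

Variable Bs : V -> V -> R.
Hypothesis Bs_def : Bs = @killing_sigma R F p r.
Let Bsb : bilform Bs. Proof. by rewrite Bs_def; apply: killing_sigma_form. Qed.

Lemma ip_s_form : bilform (@ip_s R F p r).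
Proof.
split=> W c X Y; rewrite /ip_s -Bs_def; set pa := daddv_pi aa nn; set pn := daddv_pi nn aa.
  rewrite (linearP pa) (linearP pn) !(bDl Bsb) !(fZl _ _ _ Bsb) -[c *: _]/(c * _).
  by ring.
rewrite (linearP pa) (linearP pn) !(bDr Bsb) !(fZr _ _ _ Bsb) -[c *: _]/(c * _).
by ring.
Qed.

Lemma ip_s_aa : {in aa &, forall X Y, ip_s F X Y = 2 * Bs X Y}.
Proof.
have E X : X \in aa -> daddv_pi aa nn X = X /\ daddv_pi nn aa X = 0.
  move=> Xa; have X1 := daddv_pi_id capv_an Xa; split=> //.
  have := daddv_pi_add capv_an (subvP (addvSl aa nn) _ Xa); rewrite X1.
  by move/eqP; rewrite addrC -subr_eq0 addrK => /eqP.
move=> X Y /E[X1 X2] /E[Y1 Y2]; rewrite /ip_s -Bs_def X1 X2 Y1 Y2.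
by rewrite (b0l Bsb) addr0.
Qed.

Let n_pi X : X \in nn -> daddv_pi aa nn X = 0 /\ daddv_pi nn aa X = X.
Proof.
move=> Xn; have X1 : daddv_pi nn aa X = X by apply: daddv_pi_id; rewrite // capvC capv_an.
split=> //; have := daddv_pi_add capv_an (subvP (addvSr aa nn) _ Xn); rewrite X1.
by move/eqP; rewrite -subr_eq0 addrK => /eqP.
Qed.

Lemma ip_s_nn : {in nn &, forall X Y, ip_s F X Y = Bs X Y}.
Proof.
move=> X Y /n_pi[X1 X2] /n_pi[Y1 Y2]; rewrite /ip_s -Bs_def X1 X2 Y1 Y2.
by rewrite (b0l Bsb) mulr0 add0r.
Qed.

Lemma ip_s_an : {in aa & nn, forall X Y, ip_s F X Y = 0 /\ ip_s F Y X = 0}.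
Proof.
move=> X Y Xa /n_pi[Y1 Y2].
have X1 := daddv_pi_id capv_an Xa.
have X2 : daddv_pi nn aa X = 0.
  have := daddv_pi_add capv_an (subvP (addvSl aa nn) _ Xa); rewrite X1.
  by move/eqP; rewrite addrC -subr_eq0 addrK => /eqP.
rewrite /ip_s -Bs_def X1 X2 Y1 Y2.
by rewrite !(b0l Bsb) !(b0r Bsb) mulr0 addr0.
Qed.

End InnerProduct.

(** * The attached subalgebra as the span of transported root vectors *)

Section AttachedSolvmanifold.
Variables (R : realType) (F : base_field) (p r a b : nat).
Local Notation n := (p + (p + r))%N.
Local Notation T := ('I_p + ('I_p + 'I_r))%type.
Local Notation V := (hmx R n).
Local Notation VC := (V * V)%type.
Local Notation br := (@comm_br R p r).
Local Notation g := (g_ R F p r).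
Local Notation lam := (@lam R p r).
Local Notation phi := (@phi R p r a).
Implicit Types (X Y : V) (al d : 'rV[R]_p) (U : VC).

Hypotheses (r_gt0 : (0 < r)%N) (ar : (a <= r)%N) (hb : b = (r - a)%N).
Variables (H : 'I_p -> 'rV[R]_p) (I : {set 'I_p}) (c : 'I_p -> nat) (Z : 'rV[R]_p).
Hypothesis hH : forall i j : 'I_p, form_eval (simple_root R p i) (H j) = (i == j)%:R.
Hypothesis hc : forall i, i \in I -> (0 < c i)%N.
Hypothesis hZ : Z = \sum_(i in I) (c i)%:R *: H i.

Let brb := @comm_br_bilin R p r.

Lemma simple_root_characteristic (k : 'I_p) : form_eval (simple_root R p k) Z = (if k \in I then c k else 0%N)%:R.
Proof.
rewrite hZ (lfE_sum (W := R^o) (@form_eval_lin _ _ _)).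
under eq_bigr do rewrite (lfEZ (W := R^o) (@form_eval_lin _ _ _)) hH.
case: ifP => kI.
  rewrite (bigD1 k)//= eqxx big1 ?addr0 => [|i /andP[_ /negPf ik]]; first exact: mulr1.
  by rewrite eq_sym ik; apply: mulr0.
rewrite big1// => i iI; case: eqVneq => [ki|_]; last exact: mulr0.
by rewrite ki iI in kI.
Qed.

Lemma characteristic_ge0 (k : 'I_p) : 0 <= form_eval (simple_root R p k) Z.
Proof. by rewrite simple_root_characteristic ler0n. Qed.

Let zt (t : T) := form_eval (lam t) Z.
Local Notation flat := (@flat R p r Z).
Local Notation gpos := (@gpos R F p r Z).

Let Z_nat (i : 'I_p) : exists k : nat, Z 0 i = k%:R.
Proof.
case: i => i; elim: i => [|i IH] ip.
  have := simple_root_characteristic (Ordinal ip); rewrite /= simple_root0 => ->; by eexists.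
have [k Zk] := IH (ltnW ip); have := simple_root_characteristic (Ordinal ip).
rewrite /= (simple_rootS _ ip (ltnW ip)) Zk => /eqP; rewrite subr_eq -natrD => /eqP ->.
by eexists.
Qed.

Let zt_int t : exists k : int, zt t = k%:~R.
Proof.
rewrite /zt form_eval_lam; case: t => [i|[i|j]]; last by exists 0.
  by have [k ->] := Z_nat i; exists k%:Z.
by have [k ->] := Z_nat i; exists (- k%:Z); rewrite mulrNz.
Qed.

(** The coordinates of [Z] are partial sums of natural numbers, so ad Z has integer eigenvalues. The
    uniform gap drives the filtration used for solvability. *)
Lemma characteristic_gap (u v : T) : form_eval (lam v) Z < form_eval (lam u) Z ->
  1 <= form_eval (lam u) Z - form_eval (lam v) Z.
Proof.
rewrite -!/(zt _); have [k ->] := zt_int u; have [l ->] := zt_int v.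
by rewrite ltr_int -intrB -[1]/(1%:~R) ler_int lerBrDr lez1D.
Qed.

Lemma flat_span d : flat d -> d = \sum_(i in I) form_eval (simple_root R p i) d *: H i.
Proof.
move=> /(flatP r_gt0 characteristic_ge0) sd; pose d' := d - \sum_(i in I) form_eval (simple_root R p i) d *: H i.
have d'0 (k : 'I_p) : form_eval (simple_root R p k) d' = 0.
  rewrite (lfEB (W := R^o) (@form_eval_lin _ _ _)) (lfE_sum (W := R^o) (@form_eval_lin _ _ _)).
  under eq_bigr do rewrite (lfEZ (W := R^o) (@form_eval_lin _ _ _)) hH.
  have [kI|kI] := boolP (k \in I).
    rewrite (bigD1 k)//= eqxx big1 ?addr0 => [|i /andP[_ /negPf ik]].
      by rewrite -[_ *: _]/(_ * _) mulr1 subrr.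
    by rewrite eq_sym ik; apply: mulr0.
  rewrite sd ?simple_root_characteristic ?(negPf kI)// sub0r big1 ?oppr0// => i iI.
  by case: eqVneq => [ki|_]; [rewrite ki iI in kI | apply: mulr0].
have {}d'0 k (kp : (k < p)%N) : d' 0 (Ordinal kp) = 0.
  elim: k kp => [|k IH] kp; have := d'0 (Ordinal kp); rewrite /= ?simple_root0//.
  by rewrite (simple_rootS _ kp (ltnW kp)) IH subr0.
apply/eqP; rewrite -subr_eq0 -/d'; apply/eqP/rowP => -[k kp].
by rewrite d'0 mxE.
Qed.

Lemma flat_H i : i \in I -> flat (H i).
Proof.
move=> iI; apply/(flatP r_gt0 characteristic_ge0) => k; rewrite simple_root_characteristic hH.
case: ifP => [kI /eqP|kI _]; first by rewrite pnatr_eq0 eqn0Ngt hc.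
by case: eqVneq => // ki; rewrite ki iI in kI.
Qed.

Lemma flat_lin : flat 0 /\ forall k d d', flat d -> flat d' -> flat (k *: d + d').
Proof.
split=> [u v _|k d d' fd fd' u v uv].
  by rewrite !(lfE0 (W := R^o) (@form_eval_lin _ _ _)).
by rewrite !form_eval_lin (fd u v uv) (fd' u v uv).
Qed.

Variables (e f : seq V).
Hypothesis e_wt : forall x, x \in e -> exists al,
  [/\ wt al x, al \in pos_roots R F p & 0 < form_eval al Z].
Hypothesis e_pos : forall x, x \in e -> gpos x.
Hypothesis e_par : forall x, x \in e -> is_evn a x \/ is_odn a x.
Hypothesis pos_e : forall X, gpos X -> X \in <<e>>%VS.
Hypothesis f_flat : forall A, A \in f -> exists2 d, flat d & A = amx r d.
Hypothesis flat_f : forall d, flat d -> amx r d \in <<f>>%VS.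

Let E : seq VC := map phi (f ++ e).
Local Notation s := (attached_s F r a b H I Z).

Let E_span (t : seq V) X : {subset t <= f ++ e} -> X \in <<t>>%VS -> phi X \in <<E>>%VS.
Proof.
move=> te Xt; apply: (subvP (sub_span _) _ (phi_span a Xt)) => U /mapP[x /te xfe ->].
exact: map_f.
Qed.

Lemma na_parity U : U \in na_ R F p r a b ->
  [/\ U.1 \in g, is_evn a U.1, U.2 \in g & is_odn a U.2].
Proof.
pose P U := (U.1 \in g /\ is_evn a U.1) /\ (U.2 \in g /\ is_odn a U.2).
suff : U \in na_ R F p r a b -> P U by move=> H' /H'[[? ?] [? ?]].
have Pl : lin_closed P.
  have Q1 := lin_closedI (lin_closed_vs g) (@lin_closed_supp R p r (fun u v => par a u == par a v)).
  have Q2 := lin_closedI (lin_closed_vs g) (@lin_closed_supp R p r (fun u v => par a u != par a v)).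
  split=> [|k X Y [X1 X2] [Y1 Y2]]; first by split; [exact: Q1.1 | exact: Q2.1].
  by split; [exact: Q1.2 _ _ _ X1 Y1 | exact: Q2.2 _ _ _ X2 Y2].
have zero_in (c0 : T -> T -> Prop) : (0 : V) \in g /\ supp c0 (0 : V).
  by split; [exact: mem0v | exact: (@lin_closed_supp R p r c0).1].
move=> /memv_addP[U12 /memv_addP[U1 U1n [U2 U2n ->]] [U3 U3n ->]].
apply: lin_closedD => //; first apply: lin_closedD => //.
- move: U1 U1n; apply: lspan_ind => // _ [X Xn <-]; split; last exact: zero_in.
  move: X Xn; rewrite /= big_seq_cond; apply: big_sum_ind => [|al X /andP[alp aln]].
    by apply: lin_closedI; [apply: lin_closed_vs | apply: lin_closed_supp].
  by move=> /mem_root_space[Xg wX]; split=> //; apply: wt_evn alp aln wX.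
- move: U2 U2n; apply: lspan_ind => // _ [X Xn <-]; split; last exact: zero_in.
  move: X Xn; apply: lspan_ind => [|_ [C [FC C0] <-]].
    by apply: lin_closedI; [apply: lin_closed_vs | apply: lin_closed_supp].
  split; first exact: wmx_g.
  have [k _ W] := ent_wmx R p r.
  (* As [b = r - a] with [a <= r], the bound [r - b] on the columns is [a]. *)
  have Ca i (j : 'I_r) : (a <= j)%N -> C i j = 0.
    by move=> aj; apply: C0; rewrite hb subKn.
  move=> u v; rewrite W; case: u v => [i|[i|i]] [j|[j|j]] //=; rewrite ?eqxx//.
    by case: (leqP a j) => // ja; rewrite Ca// scaler0 !eqxx.
  by case: (leqP a i) => // ja; rewrite Ca// conjq0 scaler0 !eqxx.
- move: U3 U3n; apply: lspan_ind => // _ [X Xn <-]; split; first exact: zero_in.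
  move: X Xn; apply: lspan_ind => [|_ [C [FC C0] <-]].
    by apply: lin_closedI; [apply: lin_closed_vs | apply: lin_closed_supp].
  split; first exact: wmx_g.
  have [k _ W] := ent_wmx R p r.
  move=> u v; rewrite W; case: u v => [i|[i|i]] [j|[j|j]] //=; rewrite ?eqxx//.
    by case: (ltnP j a) => // ja; rewrite C0// scaler0 !eqxx.
  by case: (ltnP i a) => // ja; rewrite C0// conjq0 scaler0 !eqxx.
Qed.

(** A root vector for omega_i is some [wmx C], and its parity tells which columns of [C] vanish:
    even vectors go to W_a, odd ones to [sqrt(-1)] W_b. All other roots give even vectors. *)
Lemma phi_na x : x \in e -> phi x \in na_ R F p r a b.
Proof.
move=> xe; have [al [wx alp _]] := e_wt xe; have xg := (e_pos xe).1.
have [aln|aln] := boolP (al \in omegas R p); last first.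
  have ex := wt_evn a alp aln wx.
  have -> : phi x = tensor1 x by apply: (@phi_of_parity _ _ _ _ false) => u v /ex ->.
  apply: (subvP (addvSl _ _)); apply: (subvP (addvSl _ _)).
  apply: memv_lspan; exists x => //=.
  by apply: (memv_big_sum alp) => //; apply/mem_root_space.
have [i al_i] : exists i : 'I_p, al = omega R p i.
  by move: aln => /mapP[i]; rewrite mem_iota /= => ip ->; exists (Ordinal ip).
subst al; have [C FC xC] := omega_wmx xg wx.
have [k k0 W] := ent_wmx R p r.
have [[] hx] := exists_parity (e_par xe); rewrite (phi_of_parity hx) xC.
  apply: (subvP (addvSr _ _)); apply: memv_lspan; exists (wmx C) => //=.
  apply: memv_lspan; exists C => //; split=> // s0 j ja.
  apply/eqP; apply: contraT => Cnz; have := hx (inl s0) (inr (inr j)).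
  rewrite xC W scaler_eq0 negb_or k0 => /(_ Cnz) /=.
  by rewrite leqNgt ja.
apply: (subvP (addvSl _ _)); apply: (subvP (addvSr _ _)).
apply: memv_lspan; exists (wmx C) => //=.
apply: memv_lspan; exists C => //; split=> // s0 j; rewrite hb subKn// => ja.
apply/eqP; apply: contraT => Cnz; have := hx (inl s0) (inr (inr j)).
by rewrite xC W scaler_eq0 negb_or k0 => /(_ Cnz) /=; rewrite ja.
Qed.

(** Replaces the defining sum of root spaces by a concrete basis. In one direction, an element of
    n_a of weight [al] has an even first and an odd second component, so it is [phi] of their
    sum. *)
Lemma attached_sE : s = <<E>>%VS.
Proof.
apply/eqP; rewrite eqEsubv; apply/andP; split; apply/subvP => U; last first.
  move: U; apply: span_ind => [|U]; first exact: lin_closed_vs.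
  move=> /mapP[x]; rewrite mem_cat => /orP[xf|xe] ->.
    have [d fd ->] := f_flat xf; apply: (subvP (addvSl _ _)).
    rewrite (phi_of_parity (@amx_parity R p r a d)) (flat_span fd).
    have amxl := @amx_lin R p r; have iol := @iota_lin R p r false.
    rewrite (lfE_sum amxl) (lfE_sum iol) memv_suml// => i iI.
    rewrite (lfEZ amxl) (lfEZ iol) memvZ//; apply: memv_lspan.
    by exists i.
  apply: (subvP (addvSr _ _)); have [al [wx alp alZ]] := e_wt xe.
  apply: (memv_big_sum alp alZ); apply: memv_lspan; split; first exact: phi_na.
  move=> d; have [c0 hx] := exists_parity (e_par xe).
  rewrite -[tensor1 _]/(iota_C false (amx r d)) -(phi_of_parity (@amx_parity R p r a d)).
  rewrite (comm_brC_phi (@amx_parity R p r a d) hx) scale1r (wt_br d wx).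
  exact: (lfEZ (@phi_lin R p r a)).
move=> /memv_addP[U1 U1a [U2 U2n {U}->]]; apply: memvD.
  move: U1 U1a; apply: lspan_ind => [|U [i iI <-]]; first exact: lin_closed_vs.
  rewrite -[tensor1 _]/(iota_C false (amx r (H i))) -(phi_of_parity (@amx_parity R p r a (H i))).
  apply: (@E_span f); last exact/flat_f/flat_H.
  by move=> x xf; rewrite mem_cat xf.
move: U2 U2n; apply: big_sum_ind => [|al U2 alZ]; first exact: lin_closed_vs.
move: U2; apply: lspan_ind => [|U [Un wU]].
  exact: lin_closed_vs.
have [U1g eU1 U2g oU2] := na_parity Un.
have wt12 d : br (amx r d) U.1 = form_eval al d *: U.1 /\
    br (amx r d) U.2 = form_eval al d *: U.2.
  move: (congr1 fst (wU d)) (congr1 snd (wU d)).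
  by rewrite /comm_brC /= !(b0l brb) subr0 addr0 => -> ->.
have w1 : wt al U.1 by apply: br_wt => d; have [] := wt12 d.
have w2 : wt al U.2 by apply: br_wt => d; have [] := wt12 d.
have -> : U = phi (U.1 + U.2).
  rewrite (lfED (@phi_lin R p r a)).
  rewrite (@phi_of_parity _ _ _ _ false) => [|u v /eU1 ->//].
  rewrite (@phi_of_parity _ _ _ _ true) => [|u v /oU2 //].
  exact: iota_split.
apply: (@E_span e); first by move=> x xe; rewrite mem_cat xe orbT.
apply: pos_e; split; first by apply: memvD.
apply: (lin_closedD (@lin_closed_supp R p r (fun u v => zt v < zt u))) => u v nz.
  by rewrite -subr_gt0 -form_evalB (w1 u v nz).
by rewrite -subr_gt0 -form_evalB (w2 u v nz).
Qed.

End AttachedSolvmanifold.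

(** * Structure constants, solvability and curvature of the attached algebra *)

Section AttachedBasis.
Variables (R : realType) (F : base_field) (p r a : nat).
Local Notation n := (p + (p + r))%N.
Local Notation T := ('I_p + ('I_p + 'I_r))%type.
Local Notation V := (hmx R n).
Local Notation VC := (V * V)%type.
Local Notation br := (@comm_br R p r).
Local Notation brC := (@comm_brC R p r).
Local Notation g := (g_ R F p r).
Local Notation lam := (@lam R p r).
Local Notation phi := (@phi R p r a).
Local Notation ipC := (@ip_sa R F p r).
Implicit Types (X Y : V) (al d : 'rV[R]_p) (U : VC).

Variables (B Bs : V -> V -> R).
Hypotheses (B_def : B = @killing R F p r) (Bs_def : Bs = @killing_sigma R F p r).
Variable Z : 'rV[R]_p.
Let zt (t : T) := form_eval (lam t) Z.
Hypothesis r_gt0 : (0 < r)%N.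
Hypothesis Z_simple : forall k : 'I_p, 0 <= form_eval (simple_root R p k) Z.
Hypothesis Z_gap : forall u v : T, form_eval (lam v) Z < form_eval (lam u) Z ->
  1 <= form_eval (lam u) Z - form_eval (lam v) Z.
Local Notation flat := (@flat R p r Z).
Local Notation gpos := (@gpos R F p r Z).

Variables (e f : seq V).
Hypothesis oe : orthonormal_seq Bs e.
Hypothesis e_wt : forall x, x \in e -> exists al,
  [/\ wt al x, al \in pos_roots R F p & 0 < form_eval al Z].
Hypothesis e_pos : forall x, x \in e -> gpos x.
Hypothesis e_par : forall x, x \in e -> is_evn a x \/ is_odn a x.
Hypothesis pos_e : forall X, gpos X -> X \in <<e>>%VS.
Hypothesis of_ : orthonormal_seq (Bs2 Bs) f.
Hypothesis f_flat : forall A, A \in f -> exists2 d, flat d & A = amx r d.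
Hypothesis flat_f : forall d, flat d -> amx r d \in <<f>>%VS.

Let brCb := @comm_brC_bilin R p r.
Let Bsb : bilform Bs. Proof. by rewrite Bs_def; apply: killing_sigma_form. Qed.
Let ipb : bilform (@ip_s R F p r) := ip_s_form Bs_def.
Let Bs_wt al be X Y : X \in g -> Y \in g -> wt al X -> wt be Y -> al != be ->
  Bs X Y = 0.
Proof. rewrite Bs_def; exact: killing_sigma_wt. Qed.
Let Bs_par X Y : X \in g -> Y \in g -> is_evn a X -> is_odn a Y -> Bs X Y = 0.
Proof. rewrite Bs_def; exact: killing_sigma_parity. Qed.
Let Bs_par' X Y : X \in g -> Y \in g -> is_odn a X -> is_evn a Y -> Bs X Y = 0.
Proof.
move=> Xg Yg oX eY; transitivity (Bs Y X); last exact: Bs_par.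
by rewrite Bs_def; apply: killing_sigmaC.
Qed.

Local Notation fC := (map phi f).
Local Notation eC := (map phi e).
Local Notation E := (map phi (f ++ e)).

Let eg x : x \in e -> x \in g. Proof. by move/e_pos => -[]. Qed.

Let phi_inj : injective phi. Proof. exact: can_inj (@to_s_phi R p r a). Qed.

Let ip_phi X Y : ipC (phi X) (phi Y) = ip_s F X Y.
Proof. by rewrite /ip_sa !to_s_phi. Qed.

Let ipCb : bilform ipC.
Proof.
have to_s_lin k (U W : VC) : to_s (k *: U + W) = k *: to_s U + to_s W.
  by rewrite /to_s /= scalerDr addrACA.
by split=> W k U U'; rewrite /ip_sa to_s_lin;
  [apply: (ipb.1 (to_s W) k (to_s U)) | apply: (ipb.2 (to_s W) k (to_s U))].
Qed.

Let e_n x : x \in e -> x \in n_ R F p r.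
Proof. by move=> xe; have [al [wx alp _]] := e_wt xe; apply: root_space_n alp (eg xe) wx. Qed.

Let gpos_n X : gpos X -> X \in n_ R F p r.
Proof. by move/pos_e; move: X; apply: span_ind; [apply: lin_closed_vs | apply: e_n]. Qed.

Let f_a A : A \in f -> A \in a_ R p r.
Proof. by move=> /f_flat[d _ ->]; apply/mem_a; exists d. Qed.

Let fe_ne A x : A \in f -> x \in e -> (A == x) = false.
Proof.
move=> Af xe; apply/eqP => Ax; subst x.
have : A \in (a_ R p r :&: n_ R F p r)%VS by rewrite memv_cap f_a ?e_n.
rewrite capv_an memv0 => /eqP A0; have := oe.2 A A xe xe.
by rewrite eqxx {1}A0 (b0l Bsb) => /esym/eqP; rewrite oner_eq0.
Qed.

Lemma attached_basis_orthonormal : orthonormal_seq ipC E.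
Proof.
split.
  rewrite map_inj_uniq// cat_uniq of_.1 oe.1 andbT /=.
  by apply/hasPn => x xe; apply/negP => xf; have := fe_ne xf xe; rewrite eqxx.
move=> _ _ /mapP[X Xfe ->] /mapP[Y Yfe ->]; rewrite ip_phi (inj_eq phi_inj).
move: Xfe Yfe; rewrite !mem_cat => /orP[Xf|Xe] /orP[Yf|Ye].
- by rewrite (ip_s_aa Bs_def (f_a Xf) (f_a Yf)); apply: (of_.2 X Y Xf Yf).
- by have [-> _] := ip_s_an Bs_def (f_a Xf) (e_n Ye); rewrite fe_ne.
- by have [_ ->] := ip_s_an Bs_def (f_a Yf) (e_n Xe); rewrite eq_sym fe_ne.
- by rewrite (ip_s_nn Bs_def (e_n Xe) (e_n Ye)); apply: oe.2.
Qed.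
Let oE := attached_basis_orthonormal.

Let br_ff A A' : A \in f -> A' \in f -> brC (phi A) (phi A') = 0.
Proof.
move=> /f_flat[d _ ->] /f_flat[d' _ ->].
rewrite (comm_brC_phi (@amx_parity R p r a d) (@amx_parity R p r a d')) br_amx.
by rewrite (lfE0 (@phi_lin R p r a)) scaler0.
Qed.

Let br_fe A x : A \in f -> x \in e -> brC (phi A) (phi x) = ad_eigenvalue Bs A x *: phi x.
Proof.
move=> /f_flat[d _ ->] xe; have [c0 hx] := exists_parity (e_par xe).
rewrite (comm_brC_phi (@amx_parity R p r a d) hx) scale1r (br_amx_e Bs_def oe e_wt)//.
exact: (lfEZ (@phi_lin R p r a)).
Qed.

Lemma attached_basis_br : {in <<E>>%VS &, forall U W, brC U W \in <<eC>>%VS}.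
Proof.
move=> U W Us Ws; move: U Us; apply: span_ind => [|U UE].
  split=> [|k U U' Ue Ue']; first by rewrite (b0l brCb) mem0v.
  by rewrite (bDl brCb) (bZl brCb); apply: memvD Ue'; apply: memvZ.
move: W Ws; apply: span_ind => [|W WE].
  split=> [|k W W' We We']; first by rewrite (b0r brCb) mem0v.
  by rewrite (bDr brCb) (bZr brCb); apply: memvD We'; apply: memvZ.
have e_eC x : x \in e -> phi x \in <<eC>>%VS by move=> xe; apply/memv_span/map_f.
move: UE WE => /mapP[X Xfe ->] /mapP[Y Yfe ->].
move: Xfe Yfe; rewrite !mem_cat => /orP[Xf|Xe] /orP[Yf|Ye].
- by rewrite br_ff ?mem0v.
- by rewrite br_fe ?memvZ ?e_eC.
- by rewrite comm_brC_antisym br_fe// memvN memvZ ?e_eC.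
- have [c0 hX] := exists_parity (e_par Xe); have [c1 hY] := exists_parity (e_par Ye).
  rewrite (comm_brC_phi hX hY) memvZ//; apply/phi_span/pos_e.
  exact: gpos_br (e_pos Xe) (e_pos Ye).
Qed.

Let eC_E U : U \in <<eC>>%VS -> U \in <<E>>%VS.
Proof.
apply: (subvP (sub_span _)) => W /mapP[x xe ->].
by apply: map_f; rewrite mem_cat xe orbT.
Qed.

Let br_E : {in <<E>>%VS &, forall U W, brC U W \in <<E>>%VS}.
Proof. by move=> U W Us Ws; apply/eC_E/attached_basis_br. Qed.

Lemma attached_lie_algebra : is_lie_algebra brC <<E>>%VS.
Proof.
split=> [//|k U U' W _ _ _|U _|U1 U2 U3 _ _ _]; last exact: comm_brC_jacobi.
  by rewrite (bDl brCb) (bZl brCb) (bDr brCb) (bZr brCb).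
have := comm_brC_antisym U U; move/eqP; rewrite -addr_eq0 -mulr2n -scaler_nat.
by rewrite scaler_eq0 pnatr_eq0 => /eqP.
Qed.

Lemma attached_inner_product : is_inner_product ipC <<E>>%VS.
Proof.
split=> [k U U' W _ _ _||U Us U0].
- by rewrite (bDl ipCb) (fZl _ _ _ ipCb).
- exact: orthonormal_sym ipCb oE.
- exact: orthonormal_gt0 ipCb oE U Us U0.
Qed.

(** A lower bound [k] for the ad Z eigenvalues occurring in [X]. The derived algebra lies in level
    1, and each further derivation raises the level by at least one, since 2 (k + 1) >= k + 2. *)
Let filt (k : nat) X := supp (fun u v => k%:R <= zt u - zt v) X.
Let filtC k U := filt k U.1 /\ filt k U.2.

Let filt_lin k : lin_closed (filt k). Proof. exact: lin_closed_supp. Qed.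

Let filtC_lin k : lin_closed (filtC k).
Proof.
split=> [|c0 U W [U1 U2] [W1 W2]]; first by split; apply: (filt_lin k).1.
by split; apply: (filt_lin k).2.
Qed.

Let filtC_br k U W : filtC k.+1 U -> filtC k.+1 W -> filtC k.+2 (brC U W).
Proof.
have filt_br X Y : filt k.+1 X -> filt k.+1 Y -> filt k.+2 (br X Y).
  have E1 (x y z : R) : k.+1%:R <= x - y -> k.+1%:R <= y - z -> k.+2%:R <= x - z.
    by have := ler0n R k; rewrite !mulrS; lra.
  by move=> fX fY; apply: (supp_br fX fY) => u t v; apply: E1.
move=> [U1 U2] [W1 W2]; split; last by apply: (lin_closedD (filt_lin _)); apply: filt_br.
by apply: (lin_closedB (filt_lin _)); apply: filt_br.
Qed.

Lemma attached_solvable : is_solvable brC <<E>>%VS.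
Proof.
(* No eigenvalue of ad Z on matrices exceeds [2 * S], so a level above this bound contains only
   0. *)
pose S := \sum_(t : T) `|zt t|; exists (Num.bound (2 * S)).+1.
have S_ge0 : 0 <= S by apply: sumr_ge0.
have zt_S t : `|zt t| <= S by rewrite /S (bigD1 t)//= lerDl sumr_ge0.
have filt_e U : U \in <<eC>>%VS -> filtC 1 U.
  move: U; apply: span_ind => // _ /mapP[x /e_pos[_ sx] ->].
  by split; [apply: supp_evn | apply: supp_odn] => u v /sx /Z_gap.
have filt_s k U : U \in iter k.+1 (derived brC) <<E>>%VS -> filtC k.+1 U.
  elim: k U => [|k IH] U; move: U; apply: lspan_ind => // _ [U [W [Us Ws ->]]].
    exact/filt_e/attached_basis_br.
  by apply: filtC_br; apply: IH.
have ltS : 2 * S < (Num.bound (2 * S)).+1%:R.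
  have : 2 * S < (Num.bound (2 * S))%:R by apply: archi_boundP; rewrite mulr_ge0.
  by rewrite mulrS; lra.
apply/eqP; rewrite -subv0; apply/subvP => -[X Y] /filt_s[/= fX fY].
have filt0 X' : filt (Num.bound (2 * S)).+1 X' -> X' = 0.
  move=> fX'; apply: (supp_ent0 fX') => u v le.
  by move: (zt_S u) (zt_S v); rewrite !ler_norml => /andP[? ?] /andP[? ?]; lra.
by rewrite (filt0 X fX) (filt0 Y fY) memv0.
Qed.

Let ip_eC_f U A : U \in <<eC>>%VS -> A \in f -> ipC U (phi A) = 0.
Proof.
move=> + Af; move: U; apply: span_ind => [|_ /mapP[x xe ->]].
  split=> [|k U U' U0 U'0]; first by rewrite (b0l ipCb).
  by rewrite (bDl ipCb) (fZl _ _ _ ipCb) U0 U'0 mulr0 addr0.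
by rewrite ip_phi; have [_ ->] := ip_s_an Bs_def (f_a Af) (e_n xe).
Qed.

Let c_e b c X Y W : X \in e -> Y \in e -> W \in e -> of_parity a b X -> of_parity a c Y ->
  ipC (brC (phi X) (phi Y)) (phi W) = (-1) ^+ (b && c) * Bs (br X Y) W.
Proof.
move=> Xe Ye We hX hY; rewrite (comm_brC_phi hX hY) (fZl _ _ _ ipCb) ip_phi.
by rewrite (ip_s_nn Bs_def (gpos_n (gpos_br (e_pos Xe) (e_pos Ye))) (e_n We)).
Qed.

(** The ad Z eigenvalue of a basis vector, zero on [f] and positive on [e]; brackets with [e]
    strictly increase it. *)
Let delta U := Bs (br (amx r Z) (to_s U)) (to_s U).

Let delta_e al x : x \in e -> wt al x -> delta (phi x) = form_eval al Z.
Proof.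
move=> xe wx; rewrite /delta to_s_phi (wt_br Z wx) (fZl _ _ _ Bsb).
by rewrite oe.2// eqxx mulr1.
Qed.

Let delta_f A : A \in f -> delta (phi A) = 0.
Proof. by move=> /f_flat[d _ ->]; rewrite /delta to_s_phi br_amx (b0l Bsb). Qed.

Let delta_gt0 x : x \in e -> 0 < delta (phi x).
Proof. by move=> xe; have [al [wx _ al0]] := e_wt xe; rewrite (delta_e xe wx). Qed.

Let c_raises U W W' : U \in eC -> W \in E -> W' \in E -> delta W' <= delta W ->
  ipC (brC U W) W' = 0.
Proof.
move=> /mapP[x xe ->] /mapP[z zfe ->] /mapP[m mfe ->] le_d.
move: zfe mfe; rewrite !mem_cat => /orP[zf|ze] /orP[mf|me].
- apply: ip_eC_f => //; rewrite comm_brC_antisym br_fe// memvN memvZ//.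
  exact/memv_span/map_f.
- rewrite comm_brC_antisym br_fe// (bNl ipCb) (fZl _ _ _ ipCb) oE.2; last 2 first.
  + by apply: map_f; rewrite mem_cat xe orbT.
  + by apply: map_f; rewrite mem_cat me orbT.
  rewrite (inj_eq phi_inj); have [xm|_] := eqVneq x m; last by rewrite mulr0 oppr0.
  by move: le_d; rewrite leNgt (delta_f zf) (delta_gt0 me).
- by apply: ip_eC_f => //; apply: attached_basis_br; apply/memv_span/map_f;
    rewrite mem_cat ?xe ?ze orbT.
- have [c0 hx] := exists_parity (e_par xe); have [c1 hz] := exists_parity (e_par ze).
  rewrite (c_e xe ze me hx hz).
  have [al [wx _ al0]] := e_wt xe; have [be [wz _ _]] := e_wt ze.
  have [ga [wm _ _]] := e_wt me.
  (* [x, z] has weight [al + be]; if [m] had the same weight, its eigenvalue would exceed that of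
     [z] by al(Z) > 0. *)
  rewrite (Bs_wt (comm_br_g (eg xe) (eg ze)) (eg me) (wt_brD wx wz) wm) ?mulr0//.
  apply: contraTneq le_d => ga_def; rewrite -ltNge (delta_e ze wz) (delta_e me wm).
  by rewrite -ga_def form_evalD ltrDr.
Qed.

(* If x and y have different parities, then [x, z] or [y, z] is orthogonal to m. *)
Let c_nn_sq x y z m : x \in e -> y \in e -> z \in e -> m \in e ->
  ipC (brC (phi x) (phi z)) (phi m) * ipC (brC (phi y) (phi z)) (phi m) =
  Bs (br x z) m * Bs (br y z) m.
Proof.
move=> xe ye ze me; have [b hx] := exists_parity (e_par xe); have [b' hy] := exists_parity (e_par ye).
have [c hz] := exists_parity (e_par ze).
apply: etrans (congr2 *%R (c_e xe ze me hx hz) (c_e ye ze me hy hz)) _.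
suff : b != b' -> Bs (br x z) m = 0 \/ Bs (br y z) m = 0.
  move: (Bs (br x z) m) (Bs (br y z) m) => S1 S2.
  have [<- _|_ /(_ isT)[->|->]] := eqVneq b b'; last 2 first.
  - by rewrite !(mulr0, mul0r).
  - by rewrite !mulr0.
  by rewrite mulrACA -expr2 sqrr_sign mul1r.
move=> bb'; have E0 x' b1 : x' \in e -> of_parity a b1 x' ->
    (if b1 (+) c then is_evn a m else is_odn a m) -> Bs (br x' z) m = 0.
  move=> xe' hx'; have gb := comm_br_g (eg xe') (eg ze).
  have := of_parity_br hx' hz; case: (b1 (+) c) => hb em.
    by apply: (Bs_par' gb (eg me) _ em) => u v /hb.
  by apply: (Bs_par gb (eg me) _ em) => u v /hb /negbFE.
have := E0 x b xe hx; have := E0 y b' ye hy.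
by move: bb'; case: (e_par me) => em; case: b {hx}; case: b' {hy}; case: c {hz E0} => //=;
  move=> _ Ey Ex; (by left; apply: Ex) || (by right; apply: Ey).
Qed.

Let c_nn_sq' z m x y : x \in e -> y \in e -> z \in e -> m \in e ->
  ipC (brC (phi z) (phi m)) (phi x) * ipC (brC (phi z) (phi m)) (phi y) =
  Bs (br z m) x * Bs (br z m) y.
Proof.
move=> xe ye ze me; have [b hz] := exists_parity (e_par ze); have [c hm] := exists_parity (e_par me).
apply: etrans (congr2 *%R (c_e ze me xe hz hm) (c_e ze me ye hz hm)) _.
move: (Bs (br z m) x) (Bs (br z m) y) => S1 S2.
by rewrite mulrACA -expr2 sqrr_sign mul1r.
Qed.

Lemma attached_einstein : is_einstein brC ipC <<E>>%VS.
Proof.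
pose w (U W : VC) := ad_eigenvalue Bs (to_s U) (to_s W).
apply: (ricci_criterion brCb (@comm_brC_antisym R p r) br_E ipCb
  (orthonormal_sym ipCb oE) oE (f := fC) (n := eC) (w := w) (delta := delta)).
- exact: map_cat.
- by move=> _ _ /mapP[A Af ->] /mapP[A' Af' ->]; apply: br_ff.
- by move=> _ _ /mapP[A Af ->] /mapP[x xe ->]; rewrite /w !to_s_phi; apply: br_fe.
- move=> U W _ Ue We /mapP[A Af ->]; apply: ip_eC_f Af.
  by apply: attached_basis_br; [apply/eC_E/memv_span | apply: memv_span].
- exact: c_raises.
- move=> _ _ /mapP[A Af ->] /mapP[A' Af' ->]; rewrite big_map (inj_eq phi_inj).
  rewrite -(sum_ad_eigenvalue B_def Bs_def oe e_wt e_pos pos_e of_ f_flat Af Af').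
  by apply: eq_bigr => x _; rewrite /w !to_s_phi.
- move=> _ _ /mapP[x xe ->] /mapP[y ye ->]; rewrite (inj_eq phi_inj).
  have := ricci_gpos B_def Bs_def r_gt0 Z_simple oe e_wt e_pos pos_e of_ f_flat flat_f xe ye.
  have -> : \sum_(A <- fC) (\sum_(z <- eC) w A z) * w A (phi x) =
      \sum_(A <- f) (\sum_(z <- e) ad_eigenvalue Bs A z) * ad_eigenvalue Bs A x.
    rewrite big_map; apply: eq_bigr => A _; rewrite big_map /w !to_s_phi.
    by congr (_ * _); apply: eq_bigr => z _; rewrite to_s_phi.
  move=> <-; rewrite big_map !big_seq; apply: eq_bigr => z ze.
  rewrite big_map !big_seq; apply: eq_bigr => m me.
  by congr (_ * _ + _ * _); [apply: c_nn_sq | apply: c_nn_sq'].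
Qed.

Lemma attached_einstein_solvmanifold : einstein_solvmanifold brC ipC <<E>>%VS.
Proof.
split; [exact: attached_lie_algebra | exact: attached_solvable |
  exact: attached_inner_product | exact: attached_einstein].
Qed.

End AttachedBasis.

Theorem proposition3p1 (R : realType) (F : base_field) (p q a b : nat)
    (hp : (1 <= p)%N) (hq : (2 <= q - p)%N) (ha : (1 <= a <= q - p)%N)
    (hb : b = (q - p - a)%N)
    (H : 'I_p -> 'rV[R]_p)
    (hH : forall i j : 'I_p, form_eval (simple_root R p i) (H j) = (i == j)%:R)
    (I : {set 'I_p}) (hI : I != set0)
    (c : 'I_p -> nat) (hc : forall i, i \in I -> (0 < c i)%N)
    (Z : 'rV[R]_p) (hZ : Z = \sum_(i in I) (c i)%:R *: H i) :
  einstein_solvmanifold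
    (@comm_brC R p (q - p))
    (@ip_sa R F p (q - p))
    (attached_s F (q - p) a b H I Z).
Proof.
have r_gt0 : (0 < q - p)%N by apply: leq_trans hq.
have /andP[_ ar] := ha; move: (q - p)%N r_gt0 ar hb {hq ha} => r r_gt0 ar hb.
have Zs := characteristic_ge0 hH hZ; have Zg := characteristic_gap (r := r) hH hZ.
(* An abstract name for B_sigma, kept from unfolding into a trace. *)
have [Bs Bs_def] : {Bs | Bs = @killing_sigma R F p r} by eexists.
have [e [oe e_wt e_pos e_par pos_e]] := gpos_basis Bs_def a Zs.
have [f [of_ f_flat flat_f]] := amx_basis Bs_def r_gt0 (flat_lin r Z).
rewrite (attached_sE r_gt0 ar hb hH hc hZ e_wt e_pos e_par pos_e f_flat flat_f).
exact: (attached_einstein_solvmanifold erefl Bs_def r_gt0 Zs Zg oe e_wt e_pos e_par pos_e of_ f_flat flat_f).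
Qed.
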